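(* Let $u_0\in L^\infty(\mathbb{R}^2)$ be a divergence-free vector field with vorticity $\omega_0\in Y^\Theta_{\rm ul}(\mathbb{R}^2)$, where $\Theta\in\mathcal{A}_1$. Assume that $u$ is a smooth solution of the two-dimensional Euler system with initial velocity $u_0$, and let $\omega$ be its vorticity. Then for all $t\ge0$ $$\|u(t)\|_{L^\infty(\mathbb{R}^2)}+\|\omega(t)\|_{Y^\Theta_{\rm ul}(\mathbb{R}^2)}\le C(t),$$ where the positive smooth function $C(t)$ depends on the initial data.
   Context: The two-dimensional incompressible Euler system is $\partial_tu+(u\cdot\nabla)u+\nabla\Pi=0$, $\operatorname{div}u=0$ on $[0,\infty[\times\mathbb{R}^2$, $u|_{t=0}=u_0$. The vorticity of $u=(u_1,u_2)$ is $\omega=\partial_1u_2-\partial_2u_1$ (the overall sign plays no role), and $\omega_0$ is the vorticity of $u_0$. The pressure is the one recovered from $u$ by $\Pi=\sum_{i,j=1}^2\frac{\partial_i\partial_j}{-\Delta}(u_iu_j)$, i.e. $\nabla\Pi=\sum_{i,j}\nabla\partial_i\partial_j(-\Delta)^{-1}(u_iu_j)$ (a Fourier multiplier of order one, well defined on bounded functions because its low-frequency part is convolution with an integrable kernel). A modulus of continuity is a nondecreasing nonzero continuous function $\phi$ on $[0,\infty[$ with $\phi(0)=0$ and $\phi(2h)\le C_\phi\,\phi(h)$ for all $h\in\,]0,\infty[$. $\mathcal{A}_1$ is the class of moduli of continuity $\phi$ with $\int_a^\infty\frac{dp}{p\,\phi(\log p)}=\infty$ for some $a>1$. $\|f\|_{L^p_{\rm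 ul}}:=\sup_{x}\big(\int_{|x-y|<1}|f(y)|^p\,dy\big)^{1/p}$, and $L^p_{\rm ul}$ is the space of locally integrable $f$ for which this is finite. For a nondecreasing $\Theta$ with $\Theta\ge1$ on $[1,\infty[$ (assumed whenever $Y^\Theta_{\rm ul}$ is used), $Y^\Theta_{\rm ul}(\mathbb{R}^2)$ is the set of $f\in\bigcap_{1\le p<\infty}L^p_{\rm ul}(\mathbb{R}^2)$ with $\|f\|_{Y^\Theta_{\rm ul}}:=\sup_{p\ge1}\|f\|_{L^p_{\rm ul}}/\Theta(p)<\infty$. *)

(* Defs.v *)
From HB Require Import structures.
From mathcomp Require Import all_boot all_order all_algebra.
From mathcomp Require Import all_classical all_reals all_analysis.
From mathcomp Require Import complex.

Set Implicit Arguments.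
Unset Strict Implicit.
Unset Printing Implicit Defensive.

Import Order.TTheory GRing.Theory Num.Theory.
Import numFieldNormedType.Exports.

Local Open Scope classical_set_scope.
Local Open Scope ring_scope.

Section Smooth.
Context {R : realType} {V W : normedModType R}.

(* For finite-dimensional V this is the class C^n: all directional derivatives
   of order at most n exist everywhere and are continuous. *)
Fixpoint class_C (n : nat) (f : V -> W) : Prop :=
  if n is m.+1 then
    [/\ continuous f,
        forall v x, derivable f x v &
        forall v, class_C m (fun x => 'D_v f x)]
  else continuous f.

Definition smooth (f : V -> W) : Prop := forall n, class_C n f.

End Smooth.

Section Plane.
Context {R : realType}.
Local Notation R2 := (R * R)%type.

Definition lebesgue2 :
    {measure set (measurableTypeR R * measurableTypeR R) -> \bar R} :=
  (@lebesgue_measure R \x @lebesgue_measure R)%E.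

Definition coord2 (i : 'I_2) (x : R2) : R := if i == ord0 then x.1 else x.2.

Definition basis2 (i : 'I_2) : R2 := ((i == ord0)%:R, (i != ord0)%:R).

Definition partial (i : 'I_2) (f : R2 -> R) (x : R2) : R := 'D_(basis2 i) f x.

Definition dot2 (x y : R2) : R := x.1 * y.1 + x.2 * y.2.

(* The library norm on R * R is the maximum norm. *)
Definition enorm (x : R2) : R := Num.sqrt (dot2 x x).

Definition unit_disk (x : R2) : set R2 := [set y | enorm (x - y) < 1].

Definition test_function (psi : R2 -> R) : Prop :=
  smooth psi /\ compact (closure [set x | psi x != 0]).

Definition Linf_norm (v : R2 -> R2) : \bar R :=
  Lnorm lebesgue2 +oo%E (fun x => (enorm (v x))%:E).

Definition in_Linf (v : R2 -> R2) : Prop :=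
  measurable_fun setT v /\ (Linf_norm v < +oo)%E.

Definition locally_integrable2 (f : R2 -> R) : Prop :=
  measurable_fun setT f /\
  forall K : set R2, compact K -> lebesgue2.-integrable K (EFin \o f).

Definition Lpul_norm (p : R) (f : R2 -> R) : \bar R :=
  ereal_sup [set (poweR (\int[lebesgue2]_(y in unit_disk x)
                           (powR `|f y| p)%:E) p^-1)%E | x in [set: R2]].

Definition in_Lpul (p : R) (f : R2 -> R) : Prop :=
  locally_integrable2 f /\ (Lpul_norm p f < +oo)%E.

Definition Yul_norm (Theta : R -> R) (f : R2 -> R) : \bar R :=
  ereal_sup [set (Lpul_norm p f * ((Theta p)^-1)%:E)%E | p in `[1, +oo[].

Definition in_Yul (Theta : R -> R) (f : R2 -> R) : Prop :=
  (forall p, 1 <= p -> in_Lpul p f) /\ (Yul_norm Theta f < +oo)%E.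

Definition modulus_of_continuity (phi : R -> R) : Prop :=
  [/\ forall x y, 0 <= x -> x <= y -> phi x <= phi y,
      exists2 h, 0 <= h & phi h != 0,
      {within `[0, +oo[, continuous phi},
      phi 0 = 0 &
      exists C : R, forall h, 0 < h -> phi (2 * h) <= C * phi h].

(* A modulus of continuity is positive on ]0, +oo[ (doubling would otherwise
   force it to vanish identically), so no division by 0 occurs below. *)
Definition class_A1 (phi : R -> R) : Prop :=
  modulus_of_continuity phi /\
  exists2 a : R, 1 < a &
    (\int[lebesgue_measure]_(p in `]a, +oo[) ((p * phi (ln p))^-1)%:E = +oo)%E.

(* Distributional divergence and vorticity, for fields that are merely
   bounded or locally integrable. *)
Definition weak_div_free (v : R2 -> R2) : Prop :=
  forall psi, test_function psi ->
    \int[lebesgue2]_x (\sum_(i < 2) coord2 i (v x) * partial i psi x) = 0.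

Definition weak_vorticity (v : R2 -> R2) (w : R2 -> R) : Prop :=
  forall psi, test_function psi ->
    \int[lebesgue2]_x (w x * psi x) =
    \int[lebesgue2]_x
      (coord2 0 (v x) * partial 1 psi x - coord2 1 (v x) * partial 0 psi x).

Definition vorticity (v : R2 -> R2) (x : R2) : R :=
  partial 0 (fun y => coord2 1 (v y)) x - partial 1 (fun y => coord2 0 (v y)) x.

Definition expi (t : R) : R[i] := (cos t +i* sin t)%C.

(* hat psi (xi) = \int e^{-i x.xi} psi(x) dx for real-valued psi *)
Definition fourier (psi : R2 -> R) (xi : R2) : R[i] :=
  ((\int[lebesgue2]_x (psi x * cos (dot2 x xi))) +i*
   (- \int[lebesgue2]_x (psi x * sin (dot2 x xi))))%C.

(* m(D) psi (x) = (2 pi)^-2 \int e^{i x.xi} m(xi) hat psi(xi) dxi.  The symbols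
   used here satisfy m(-xi) = conj (m(xi)), so for real psi the imaginary part
   of this integral vanishes and only the real part is integrated. *)
Definition fourier_multiplier (m : R2 -> R[i]) (psi : R2 -> R) (x : R2) : R :=
  ((2 * pi) ^+ 2)^-1 *
  \int[lebesgue2]_xi complex.Re (expi (dot2 x xi) * m xi * fourier psi xi).

(* The distribution m(D) f, for f bounded: <m(D) f, psi> = \int f m(-D) psi,
   where m(-D) is the multiplier of symbol xi |-> m(-xi). *)
Definition multiplier_pairing (m : R2 -> R[i]) (f psi : R2 -> R) : R :=
  \int[lebesgue2]_x (f x * fourier_multiplier (fun xi => m (- xi)) psi x).

Definition partial_symbol (i : 'I_2) (xi : R2) : R[i] := (0 +i* coord2 i xi)%C.

(* Symbol of d_k d_i d_j (- Delta)^-1; its value at xi = 0 is 0 / 0 = 0, which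
   is its limit there, m being homogeneous of degree one. *)
Definition pressure_symbol (k i j : 'I_2) (xi : R2) : R[i] :=
  partial_symbol k xi * partial_symbol i xi * partial_symbol j xi
  / (real_complex R (dot2 xi xi)).

(* grad P = \sum_(i, j) grad d_i d_j (- Delta)^-1 (v_i v_j) as distributions *)
Definition is_pressure (v : R2 -> R2) (P : R2 -> R) : Prop :=
  smooth P /\
  forall (k : 'I_2) (psi : R2 -> R), test_function psi ->
    \int[lebesgue2]_x (partial k P x * psi x) =
    \sum_(i < 2) \sum_(j < 2)
      multiplier_pairing (pressure_symbol k i j)
        (fun x => coord2 i (v x) * coord2 j (v x)) psi.

(* Smoothness on [0, +oo[ x R^2, up to the boundary t = 0 *)
Definition smooth_forward (u : R -> R2 -> R2) : Prop :=
  exists2 U : R * R2 -> R2, smooth U &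
    forall t x, 0 <= t -> u t x = U (t, x).

Definition locally_bounded_in_time (u : R -> R2 -> R2) : Prop :=
  forall T, exists M : R,
    forall t, 0 <= t -> t <= T -> (Linf_norm (u t) <= M%:E)%E.

(* d_t is the derivative from the right, so as to make sense also at t = 0;
   for u smooth it is the derivative in time at every t > 0. *)
Definition momentum_equation (u : R -> R2 -> R2) (P : R -> R2 -> R) : Prop :=
  forall t, 0 <= t -> forall (x : R2) (k : 'I_2),
    h^-1 * (coord2 k (u (t + h) x) - coord2 k (u t x)) @[h --> 0^'+] -->
    - (\sum_(j < 2) coord2 j (u t x) * partial j (fun y => coord2 k (u t y)) x)
    - partial k (P t) x.

Definition div_free (v : R2 -> R2) : Prop :=
  forall x, \sum_(i < 2) partial i (fun y => coord2 i (v y)) x = 0.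

(* The values of u at negative times are irrelevant. *)
Definition smooth_euler_solution (u0 : R2 -> R2) (u : R -> R2 -> R2) : Prop :=
  [/\ smooth_forward u,
      locally_bounded_in_time u,
      forall t, 0 <= t -> div_free (u t),
      exists P : R -> R2 -> R,
        (forall t, 0 <= t -> is_pressure (u t) (P t)) /\
        momentum_equation u P &
      {ae lebesgue2, forall x, u 0 x = u0 x}].

End Plane.

(* Main.v *)
(** Every velocity field that solves the Euler system on [0, T] satisfies |u(t)| <= G e^(lam t)
    for some G >= 1, and for lam large, depending only on the data, the least such G is controlled
    by |u_0|.  Take a radial mollifier at a scale r.  The average of u(t) at this scale differs from
    that of u_0 by at most C G^2 e^(2 lam t) / (lam r), by the momentum equation: the pressure operator
    applied to the mollifier has an L^1 norm of order 1 / r, since the difference of two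
    successive dyadic mollifiers is the divergence of a gradient field, on which the operator is local.
    The difference between u(t) and its average is a sum over dyadic scales 4^-n r of averages of the
    vorticity, and is controlled by the L^4 norm of the vorticity on a ball of radius of order r.  As the
    vorticity is transported, its local L^p norms at time t are at most those of the initial vorticity on
    a ball enlarged by G e^(lam t) / lam.  This is seen with the convex function (1 + s^2)^(p/2) and a
    cutoff whose support shrinks with the speed G e^(lam t); on large balls the L^p_ul norm costs a factor
    quadratic in the radius.  Choosing r = G e^(lam t) / sqrt lam, all the errors are at most half of
    G e^(lam t). *)

Require Import Defs.
From HB Require Import structures.
From mathcomp Require Import all_boot all_order all_algebra.
From mathcomp Require Import all_classical all_reals all_analysis.
From mathcomp Require Import complex measurable_realfun ess_sup_inf ring lra.

Set Implicit Arguments.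
Unset Strict Implicit.
Unset Printing Implicit Defensive.

Import Order.TTheory GRing.Theory Num.Theory.
Import numFieldNormedType.Exports.

Local Open Scope classical_set_scope.
Local Open Scope ring_scope.

(** * Smooth functions *)

(** The exponent 4 is an instance of p > 2: against an L^p vorticity the scale r contributes r^(1 -
    2/p), and these contributions have to be summable over small scales. For p = 4 they are of size
    sqrt r, and the pointwise inequality |s| <= a^3 s^4 + 1/a, with a proportional to sqrt r,
    replaces Hölder's inequality. The momentum equation is quadratic in the velocity. The argument
    still closes because integrating e^(2 lam t) gains 1 / lam and because r is itself proportional
    to the bound G e^(lam t): every error is then linear in G. The local bound that comes with a
    solution only shows that some G is admissible; improving G to U0 + G / 2 removes every trace of
    it. The norm of Y^Theta requires constants uniform in p: factors at least 1 that stand outside a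
    p-th power are absorbed in its base. The initial vorticity is known only as a distribution;
    convexity carries its L^p bounds over to the curl of u(0) without identifying the two almost
    everywhere. As the pressure is defined by a Fourier multiplier, one exact inversion formula is
    needed, for smooth functions of compact support. *)

Section ClassC.
Context {R : realType}.
Implicit Types V W : normedModType R.

Lemma is_deriveE V W (f : V -> W) (x v : V) df : is_derive x v f df -> 'D_v f x = df.
Proof. by case. Qed.

(** A directional derivative is an ordinary derivative at 0 along the line through [x]. The real
    chain rule then yields the chain rules over any normed space. *)
Lemma is_derive_line V W (f : V -> W) (x v : V) df :
  is_derive x v f df <-> is_derive (0 : R) 1 (fun h : R => f (h *: v + x)) df.
Proof.
have E : (fun h : R => h^-1 *: ((f \o shift x) (h *: v) - f x)) =
   (fun h : R => h^-1 *: (((fun h : R => f (h *: v + x)) \o shift 0) (h *: 1)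
     - (fun h : R => f (h *: v + x)) 0)).
  apply/funext => h /=; rewrite scale0r add0r addr0.
  by have -> : h *: (1 : R) = h by exact: mulr1.
split=> -[dx dv]; split.
- by move: dx; rewrite /derivable E.
- by move: dv; rewrite /derive E.
- by move: dx; rewrite /derivable E.
- by move: dv; rewrite /derive E.
Qed.

Lemma is_derive_chain V (phi : R -> R) (f : V -> R) (x v : V) df dphi :
  is_derive x v f df -> is_derive (f x) 1 phi dphi ->
  is_derive x v (phi \o f) (dphi * df).
Proof.
move=> /is_derive_line fx phix; apply/is_derive_line.
have phix' : is_derive ((fun h : R => f (h *: v + x)) 0) 1 phi dphi.
  by rewrite scale0r add0r.
exact: (@is_derive1_comp _ phi (fun h : R => f (h *: v + x)) 0 dphi df phix' fx).
Qed.

(** [L] only has to be affine along the line through [x], so the same lemma serves slices,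
    translations, rescalings and coordinate maps. *)
Lemma is_derive_affine V W V' (f : V -> W) (L : V' -> V) (x v : V') w df :
  (forall h : R, L (h *: v + x) = h *: w + L x) ->
  is_derive (L x) w f df -> is_derive x v (f \o L) df.
Proof.
move=> Lh /is_derive_line H; apply/is_derive_line.
rewrite (_ : (fun h : R => _) = (fun h : R => f (h *: w + L x)))//.
by apply/funext => h /=; rewrite Lh.
Qed.

Lemma is_derive_mul V (f g : V -> R) (x v : V) df dg :
  is_derive x v f df -> is_derive x v g dg ->
  is_derive x v (fun y => f y * g y) (f x * dg + g x * df).
Proof. by move=> ? ?; exact: is_deriveM. Qed.

Lemma is_derive_add V W (f g : V -> W) (x v : V) df dg :
  is_derive x v f df -> is_derive x v g dg ->
  is_derive x v (fun y => f y + g y) (df + dg).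
Proof. by move=> ? ?; exact: is_deriveD. Qed.

Lemma is_derive_sub V W (f g : V -> W) (x v : V) df dg :
  is_derive x v f df -> is_derive x v g dg ->
  is_derive x v (fun y => f y - g y) (df - dg).
Proof. by move=> ? ?; exact: is_deriveB. Qed.

Lemma is_derive_cmul V (k : R) (f : V -> R) (x v : V) df :
  is_derive x v f df -> is_derive x v (fun y => k * f y) (k * df).
Proof. by move=> ?; exact: is_deriveZ. Qed.

Lemma is_derive_linear (k x : R) : is_derive (x : R) 1 (fun y => k * y) k.
Proof. by have := is_derive_cmul k (is_derive_id x 1); rewrite mulr1. Qed.

Lemma class_C_continuous V W n (f : V -> W) : class_C n f -> continuous f.
Proof. by case: n => [//|n []]. Qed.

Lemma class_CW V W n (f : V -> W) : class_C n.+1 f -> class_C n f.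
Proof.
elim: n f => [f /class_C_continuous//|n IH f [cf df Df]].
by split => // v; apply: IH; exact: Df.
Qed.

(** The criterion behind the inductions on [n] below: [F v] is a closed form of the derivative in
    the direction [v]. *)
Lemma class_C_is_derive V W n (f : V -> W) (F : V -> V -> W) :
  continuous f -> (forall v x, is_derive x v f (F v x)) ->
  (forall v, class_C n (F v)) -> class_C n.+1 f.
Proof.
move=> cf dF CF; split => [//|v x|v]; first by have [] := dF v x.
have -> : 'D_v f = F v by apply/funext => x; have [_ ->] := dF v x.
exact: CF.
Qed.

Lemma class_C_deriv V W n (f : V -> W) v : class_C n.+1 f -> class_C n (fun x => 'D_v f x).
Proof. by move=> [_ _ Df]; exact: Df. Qed.

Lemma class_C_derive V W n (f : V -> W) v x : class_C n.+1 f -> is_derive x v f ('D_v f x).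
Proof. by case=> _ df _; exact/derivableP/df. Qed.

Lemma smooth_deriv V W (f : V -> W) v : smooth f -> smooth (fun x => 'D_v f x).
Proof. by move=> sf n; exact/class_C_deriv/sf. Qed.

Lemma smooth_is_derive V W (f : V -> W) v x : smooth f -> is_derive x v f ('D_v f x).
Proof. by move=> sf; exact: class_C_derive (sf 1%N). Qed.

Lemma smooth_continuous V W (f : V -> W) : smooth f -> continuous f.
Proof. by move=> /(_ 0%N). Qed.

Lemma class_C_cst V W n (a : W) : class_C n (cst a : V -> W).
Proof.
elim: n a => [a x|n IH a]; first exact: cvg_cst.
apply: (@class_C_is_derive _ _ _ _ (fun _ => cst 0)) => //.
by move=> x; exact: cvg_cst.
Qed.

Lemma class_CD V W n (f g : V -> W) : class_C n f -> class_C n g -> class_C n (f \+ g).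
Proof.
elim: n f g => [f g cf cg x|n IH f g Cf Cg]; first by apply: cvgD; [exact: cf|exact: cg].
apply: (@class_C_is_derive _ _ _ _ (fun v => (fun x => 'D_v f x) \+ (fun x => 'D_v g x))).
- by move=> x; apply: cvgD; [exact: class_C_continuous Cf _|exact: class_C_continuous Cg _].
- by move=> v x; apply: is_deriveD; [exact: class_C_derive Cf|exact: class_C_derive Cg].
- by move=> v; apply: IH; exact: class_C_deriv.
Qed.

Lemma class_CM V n (f g : V -> R) : class_C n f -> class_C n g -> class_C n (f \* g).
Proof.
elim: n f g => [f g cf cg x|n IH f g Cf Cg]; first by apply: cvgM; [exact: cf|exact: cg].
apply: (@class_C_is_derive _ _ _ _
  (fun v => (f \* (fun x => 'D_v g x)) \+ (g \* (fun x => 'D_v f x)))).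
- by move=> x; apply: cvgM; [exact: class_C_continuous Cf _|exact: class_C_continuous Cg _].
- by move=> v x; apply: is_deriveM; [exact: class_C_derive Cf|exact: class_C_derive Cg].
- move=> v; apply: class_CD; apply: IH.
  + exact: class_CW.
  + exact: class_C_deriv.
  + exact: class_CW.
  + exact: class_C_deriv.
Qed.

Lemma class_CZ V n (k : R) (f : V -> R) : class_C n f -> class_C n (fun x => k * f x).
Proof. by move=> Cf; exact: (class_CM (@class_C_cst V _ n k) Cf). Qed.

Lemma class_CN V n (f : V -> R) : class_C n f -> class_C n (fun x => - f x).
Proof.
move=> /(class_CZ (-1)); rewrite (_ : (fun x => -1 * f x) = (fun x => - f x))//.
by apply/funext => x; rewrite mulN1r.
Qed.

Lemma class_CB V n (f g : V -> R) : class_C n f -> class_C n g -> class_C n (f \- g).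
Proof. by move=> Cf Cg; exact: (class_CD Cf (class_CN Cg)). Qed.

Lemma class_C_affine V V' W n (f : V -> W) (L : V' -> V) (l : V' -> V) :
  continuous L -> (forall v x (h : R), L (h *: v + x) = h *: l v + L x) ->
  class_C n f -> class_C n (f \o L).
Proof.
move=> cL Ll; elim: n f => [f cf|n IH f Cf].
  by move=> x; apply: continuous_comp; [exact: cL|exact: cf].
apply: (@class_C_is_derive _ _ _ _ (fun v => (fun x => 'D_(l v) f x) \o L)).
- by move=> x; apply: continuous_comp; [exact: cL|exact: class_C_continuous Cf _].
- move=> v x; apply: (@is_derive_affine _ _ _ f L x v (l v)) => //.
  exact: class_C_derive Cf.
- by move=> v; apply: IH; exact: class_C_deriv.
Qed.

Lemma class_C_comp V n (phi : R -> R) (f : V -> R) :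
  class_C n phi -> class_C n f -> class_C n (phi \o f).
Proof.
elim: n phi f => [phi f cphi cf x|n IH phi f Cphi Cf].
  by apply: continuous_comp; [exact: cf|exact: cphi].
apply: (@class_C_is_derive _ _ _ _
  (fun v => ((fun x => 'D_1 phi x) \o f) \* (fun x => 'D_v f x))).
- move=> x; apply: continuous_comp;
    [exact: class_C_continuous Cf _|exact: class_C_continuous Cphi _].
- by move=> v x; apply: is_derive_chain; [exact: class_C_derive Cf|exact: class_C_derive Cphi].
- by move=> v; apply: class_CM; [apply: IH; [exact: class_C_deriv|exact: class_CW]|exact: class_C_deriv].
Qed.

(** The derivative of 1/f contains 1/f twice, so the induction on [n] keeps [f] fixed and uses its
    hypothesis for both factors. *)
Lemma class_CV V n (f : V -> R) : (forall x, f x != 0) -> class_C n f ->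
  class_C n (fun x => (f x)^-1).
Proof.
move=> f0; elim: n => [cf x|n IH Cf]; first by apply: cvgV => //; exact: cf.
apply: (@class_C_is_derive _ _ _ _
  (fun v => (fun x => - ((f x)^-1 * (f x)^-1)) \* (fun x => 'D_v f x))).
- by move=> x; apply: cvgV => //; exact: class_C_continuous Cf _.
- move=> v x; have [df _] := class_C_derive v x Cf.
  split; first exact: derivableV.
  by rewrite deriveV// /= -expr2 exprVn.
- move=> v; apply: class_CM; last exact: class_C_deriv.
  by apply: class_CN; apply: class_CM; apply: IH; exact: class_CW.
Qed.

Lemma class_C_linear V W n (f : V -> W) : continuous f ->
  (forall v x (h : R), f (h *: v + x) = h *: f v + f x) -> class_C n f.
Proof.
move=> cf lf.
have Cid : class_C n (id : W -> W).
  case: n => [|n]; first by move=> x; exact: cvg_id.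
  apply: (@class_C_is_derive _ _ _ _ (fun v => cst v)).
  - by move=> x; exact: cvg_id.
  - by move=> v; exact: (@class_C_cst W W n v).
exact: (class_C_affine cf lf Cid).
Qed.

Lemma class_C_id n : class_C n (id : R -> R).
Proof. by apply: class_C_linear => x //; exact: cvg_id. Qed.

Lemma class_C_1D n (f f' : R -> R) :
  (forall x : R, is_derive x 1 f (f' x)) -> class_C n f' -> class_C n.+1 f.
Proof.
move=> df Cf'.
refine (@class_C_is_derive _ _ _ f (fun v x => v * f' x) _ _ _).
- move=> x; apply: differentiable_continuous; apply/derivable1_diffP.
  by have [] := df x.
(* The chain rule with inner function [id], whose derivative in the direction [v] is [v]. *)
- move=> v x; rewrite mulrC -[f](_ : f \o id = f)//.
  by apply: is_derive_chain.
- by move=> v; exact: class_CZ.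
Qed.

Lemma smooth_cst V W (a : W) : smooth (cst a : V -> W).
Proof. by move=> n; exact: class_C_cst. Qed.

Lemma smoothD V W (f g : V -> W) : smooth f -> smooth g -> smooth (f \+ g).
Proof. by move=> Cf Cg n; exact: class_CD. Qed.

Lemma smoothM V (f g : V -> R) : smooth f -> smooth g -> smooth (f \* g).
Proof. by move=> Cf Cg n; exact: class_CM. Qed.

Lemma smoothZ V (k : R) (f : V -> R) : smooth f -> smooth (fun x => k * f x).
Proof. by move=> Cf n; exact: class_CZ. Qed.

Lemma smoothB V (f g : V -> R) : smooth f -> smooth g -> smooth (f \- g).
Proof. by move=> Cf Cg n; exact: class_CB. Qed.

Lemma smoothV V (f : V -> R) : (forall x, f x != 0) -> smooth f -> smooth (fun x => (f x)^-1).
Proof. by move=> f0 Cf n; exact: class_CV. Qed.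

Lemma smooth_comp V (phi : R -> R) (f : V -> R) : smooth phi -> smooth f -> smooth (phi \o f).
Proof. by move=> Cf Cg n; exact: class_C_comp. Qed.

Lemma smooth_affine V V' W (f : V -> W) (L : V' -> V) (l : V' -> V) :
  continuous L -> (forall v x (h : R), L (h *: v + x) = h *: l v + L x) ->
  smooth f -> smooth (f \o L).
Proof. by move=> cL Ll Cf n; exact: class_C_affine. Qed.

Lemma smooth_linear V W (f : V -> W) : continuous f ->
  (forall v x (h : R), f (h *: v + x) = h *: f v + f x) -> smooth f.
Proof. by move=> cf lf n; exact: class_C_linear. Qed.

Lemma smooth_id : smooth (id : R -> R).
Proof. by move=> n; exact: class_C_id. Qed.

Lemma derive_affine V V' W (f : V -> W) (L : V' -> V) (x v : V') w : smooth f ->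
  (forall h : R, L (h *: v + x) = h *: w + L x) ->
  'D_v (f \o L) x = 'D_w f (L x).
Proof.
move=> sf Lw; apply: is_deriveE; apply: is_derive_affine => //.
exact: smooth_is_derive.
Qed.

Lemma derive_chain V (phi : R -> R) (f : V -> R) (x v : V) : smooth phi -> smooth f ->
  'D_v (phi \o f) x = 'D_1 phi (f x) * 'D_v f x.
Proof.
move=> sphi sf; apply: is_deriveE; apply: is_derive_chain;
  exact: smooth_is_derive.
Qed.

Lemma smooth_deriveM V (f g : V -> R) x v : smooth f -> smooth g ->
  'D_v (f \* g) x = f x * 'D_v g x + g x * 'D_v f x.
Proof. by move=> sf sg; apply: is_deriveE; apply: is_deriveM; exact: smooth_is_derive. Qed.

Lemma smooth_deriveD V W (f g : V -> W) x v : smooth f -> smooth g ->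
  'D_v (f \+ g) x = 'D_v f x + 'D_v g x.
Proof. by move=> sf sg; apply: is_deriveE; apply: is_deriveD; exact: smooth_is_derive. Qed.

Lemma smooth_deriveB V W (f g : V -> W) x v : smooth f -> smooth g ->
  'D_v (f \- g) x = 'D_v f x - 'D_v g x.
Proof. by move=> sf sg; apply: is_deriveE; apply: is_deriveB; exact: smooth_is_derive. Qed.

Lemma smooth_deriveZ V (k : R) (f : V -> R) x v : smooth f ->
  'D_v (fun x => k * f x) x = k * 'D_v f x.
Proof.
move=> sf; have H := smooth_is_derive v x sf.
by apply: is_deriveE; exact: (@is_deriveZ _ _ _ f k x v _ H).
Qed.

Lemma smooth_fst V W1 W2 (f : V -> W1 * W2) : smooth f -> smooth (fun x => (f x).1).
Proof.
move=> + n; move=> /(_ n); elim: n f => [f cf|n IH f Cf].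
  by move=> x; apply: continuous_comp; [exact: cf|exact: cvg_fst].
have D1 v x : is_derive x v (fun x => (f x).1) ('D_v f x).1.
  have [/cvg_ex[l Hl] D] := class_C_derive v x Cf.
  have E : 'D_v f x = l by rewrite /derive; apply: cvg_lim.
  have H : h^-1 *: (((fun x => (f x).1) \o shift x) (h *: v) - (f x).1) @[h --> 0^'] --> l.1.
    by apply: (@cvg_comp _ _ _ _ (@fst W1 W2) _ _ _ Hl); exact: cvg_fst.
  split; first by apply/cvg_ex; exists l.1.
  by rewrite E /derive; apply: cvg_lim.
apply: (@class_C_is_derive _ _ _ _ (fun v x => ('D_v f x).1)) => //.
- by move=> x; apply: continuous_comp; [exact: class_C_continuous Cf _|exact: cvg_fst].
- by move=> v; apply: IH; exact: class_C_deriv.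
Qed.

Lemma smooth_snd V W1 W2 (f : V -> W1 * W2) : smooth f -> smooth (fun x => (f x).2).
Proof.
move=> + n; move=> /(_ n); elim: n f => [f cf|n IH f Cf].
  by move=> x; apply: continuous_comp; [exact: cf|exact: cvg_snd].
have D1 v x : is_derive x v (fun x => (f x).2) ('D_v f x).2.
  have [/cvg_ex[l Hl] D] := class_C_derive v x Cf.
  have E : 'D_v f x = l by rewrite /derive; apply: cvg_lim.
  have H : h^-1 *: (((fun x => (f x).2) \o shift x) (h *: v) - (f x).2) @[h --> 0^'] --> l.2.
    by apply: (@cvg_comp _ _ _ _ (@snd W1 W2) _ _ _ Hl); exact: cvg_snd.
  split; first by apply/cvg_ex; exists l.2.
  by rewrite E /derive; apply: cvg_lim.
apply: (@class_C_is_derive _ _ _ _ (fun v x => ('D_v f x).2)) => //.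
- by move=> x; apply: continuous_comp; [exact: class_C_continuous Cf _|exact: cvg_snd].
- by move=> v; apply: IH; exact: class_C_deriv.
Qed.

End ClassC.

(** * A smooth step *)

Section Step.
Context {R : realType}.

Lemma is_deriveV (V : normedModType R) (f : V -> R) x v df :
  is_derive x v f df -> f x != 0 ->
  is_derive x v (fun y => (f y)^-1) (- (f x) ^- 2 * df).
Proof. by move=> [dx <-] fx0; split; [exact: derivableV|rewrite deriveV]. Qed.

(** The functions x^-n e^(-1/x), extended by 0. Differentiation stays within the span of the family,
    so one induction makes all of them smooth. *)
Definition flat (n : nat) (x : R) : R :=
  if 0 < x then x^-1 ^+ n * expR (- x^-1) else 0.

Lemma flat_ge0 n x : 0 <= flat n x.
Proof.
rewrite /flat; case: ifP => // x0.
by rewrite mulr_ge0 ?expR_ge0// exprn_ge0// invr_ge0 ltW.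
Qed.

Lemma flat_gt0 n x : 0 < x -> 0 < flat n x.
Proof. by move=> x0; rewrite /flat x0 mulr_gt0 ?expR_gt0// exprn_gt0// invr_gt0. Qed.

Lemma flat_le0 n x : x <= 0 -> flat n x = 0.
Proof. by move=> x0; rewrite /flat ltNge x0. Qed.

(** One term of the exponential series, (1/x)^(n+1) / (n+1)! <= e^(1/x), absorbs x^-n and leaves one
    power of x. *)
Lemma flat_le n : exists2 C : R, 0 < C & forall x, flat n x <= C * `|x|.
Proof.
have n1 : 0 < (n.+1)`!%:R :> R by rewrite ltr0n fact_gt0.
exists (n.+1)`!%:R => // x.
rewrite /flat; case: ifP => x0; last by rewrite mulr_ge0// ltW.
rewrite gtr0_norm// expRN.
have y0 : 0 < x^-1 by rewrite invr_gt0.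
have H : x^-1 ^+ n.+1 / (n.+1)`!%:R <= expR x^-1.
  by apply: le_trans (expR_ge1Dxn n (ltW y0)); rewrite lerDr.
rewrite ler_pdivrMr ?expR_gt0// -(ler_pM2l y0).
move: H; rewrite ler_pdivrMr// -exprS => /le_trans; apply.
have xn0 : x != 0 by rewrite gt_eqF.
set E := expR _; set F := _%:R.
by rewrite (_ : _ * (F * x * E) = E * F)//; field.
Qed.

Lemma is_derive_flat n x :
  is_derive (x : R) 1 (flat n) (flat n.+2 x - n%:R * flat n.+1 x).
Proof.
have [x0|x0|<-] := ltgtP 0 x.
- have xn0 : x != 0 by rewrite gt_eqF.
  have DV : is_derive x 1 (fun y : R => y^-1) (- x ^- 2 * 1).
    by apply: (@is_deriveV _ id) => //; exact: is_derive_id.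
  have H : is_derive x 1 ((fun s : R => s ^+ n * expR (- s)) \o (fun y : R => y^-1))
      (flat n.+2 x - n%:R * flat n.+1 x).
    rewrite (_ : _ - _ = (n%:R * x^-1 ^+ n.-1 * expR (- x^-1) - x^-1 ^+ n * expR (- x^-1)) * (- x ^- 2 * 1)); last first.
      rewrite /flat x0 -exprVn; case: n => [|n] /=; rewrite !exprS ?expr0; ring.
    apply: is_derive_chain => //.
    rewrite (_ : n%:R * _ * _ - _ = x^-1 ^+ n * (expR (- x^-1) * - 1) + expR (- x^-1) * (n%:R * x^-1 ^+ n.-1)); last by ring.
    apply: (@is_deriveM _ _ (fun s : R => s ^+ n) (fun s => expR (- s))).
      split; first exact: exprn_derivable.
      by rewrite exp_derive /GRing.scale/= mulr1.
  apply: near_eq_is_derive H.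
  near=> y; rewrite /flat ifT//.
  by near: y; exact: lt_nbhsr.
- rewrite !flat_le0 ?ltW// mulr0 subr0.
  apply: (@near_eq_is_derive _ _ _ (cst 0)).
  near=> y; rewrite flat_le0//; apply/ltW.
  by near: y; exact: lt_nbhsl.
- rewrite !flat_le0// mulr0 subr0.
  (* To the right of 0 the difference quotient of [flat n] at 0 is [flat n.+1], and the linear bound
     sends it to 0. *)
  have [C C0 HC] := flat_le n.+1.
  have H : h^-1 *: ((flat n \o shift 0) (h *: (1:R)) - flat n 0) @[h --> 0^'] --> (0 : R).
    apply/cvgr0Pnorm_lt => e e0; near=> h.
    have hC : `|h| < e / C by near: h; apply: dnbhs0_lt; rewrite divr_gt0.
    rewrite /= (flat_le0 _ (lexx 0)) subr0 addr0.
    have -> : h *: (1 : R) = h by exact: mulr1.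
    have -> : h^-1 *: flat n h = flat n.+1 h.
      rewrite /flat; case: ifP => h0; last by rewrite scaler0.
      by rewrite exprS -mulrA.
    rewrite ger0_norm ?flat_ge0//; apply: le_lt_trans (HC h) _.
    by rewrite mulrC -ltr_pdivlMr.
  split; first by apply/cvg_ex; exists 0.
  by rewrite /derive; apply: cvg_lim.
Unshelve. all: by end_near. Qed.

Lemma class_C_flat k n : class_C k (flat n).
Proof.
elim: k n => [n|k IH n].
  move=> x; apply: differentiable_continuous; apply/derivable1_diffP.
  by have [] := is_derive_flat n x.
apply: (class_C_1D (is_derive_flat n)).
apply: (@class_CB _ _ _ (flat n.+2) (fun x => n%:R * flat n.+1 x)); first exact: IH.
exact/class_CZ/IH.
Qed.

Lemma smooth_flat n : smooth (flat n). Proof. by move=> k; exact: class_C_flat. Qed.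

Lemma smooth_flat_onem n : smooth (fun x : R => flat n (1 - x)).
Proof.
have s1 : smooth (fun x : R => 1 - x).
  by apply: (smoothB (@smooth_cst _ R R 1)); exact: smooth_id.
exact: (smooth_comp (smooth_flat n) s1).
Qed.

Definition step (x : R) : R := flat 0 x / (flat 0 x + flat 0 (1 - x)).

Lemma step_den_gt0 x : 0 < flat 0 x + flat 0 (1 - x).
Proof.
have [x0|x0] := leP x 0.
  by rewrite ltr_wpDl ?flat_ge0// flat_gt0// subr_gt0 (le_lt_trans x0).
by rewrite ltr_wpDr ?flat_ge0// flat_gt0.
Qed.

Lemma smooth_step : smooth step.
Proof.
apply: (smoothM (smooth_flat 0)); apply: smoothV.
  by move=> x; rewrite gt_eqF// step_den_gt0.
exact: (smoothD (smooth_flat 0) (smooth_flat_onem 0)).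
Qed.

Lemma step_le0 x : x <= 0 -> step x = 0.
Proof. by move=> x0; rewrite /step flat_le0// mul0r. Qed.

Lemma step_ge1 x : 1 <= x -> step x = 1.
Proof.
move=> x1; rewrite /step (@flat_le0 _ (1 - x)) ?subr_le0// addr0 divff//.
by rewrite gt_eqF// flat_gt0// (lt_le_trans ltr01).
Qed.

Lemma step_ge0 x : 0 <= step x.
Proof. by rewrite divr_ge0 ?flat_ge0// ltW// step_den_gt0. Qed.

Lemma step_le1 x : step x <= 1.
Proof. by rewrite ler_pdivrMr ?step_den_gt0// mul1r lerDl flat_ge0. Qed.

Definition dstep (x : R) : R := 'D_1 step x.

Lemma smooth_dstep : smooth dstep.
Proof. exact: smooth_deriv smooth_step. Qed.

Lemma is_derive_step x : is_derive (x : R) 1 step (dstep x).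
Proof. exact: smooth_is_derive smooth_step. Qed.

(** In the quotient rule the terms a a' cancel, and (a' b + a b') / (a + b)^2 remains, with
    nonnegative terms only. Monotonicity of [step] gives a nonnegative mollifier and the sign in the
    transport of the cutoff. *)
Lemma dstep_ge0 x : 0 <= dstep x.
Proof.
have den0 : flat 0 x + flat 0 (1 - x) != 0 by rewrite gt_eqF// step_den_gt0.
have d0 y : is_derive (y : R) 1 (flat 0) (flat 2 y).
  by have := is_derive_flat 0 y; rewrite mul0r subr0.
have d1 : is_derive (x : R) 1 (fun x => flat 0 (1 - x)) (flat 2 (1 - x) * (0 - 1)).
  have d2 : is_derive (x : R) 1 (fun x => 1 - x) (0 - 1).
    by rewrite (_ : (fun x => 1 - x) = cst 1 - id)//; exact: is_deriveB.
  exact: (is_derive_chain d2 (d0 _)).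
have D := is_deriveV (is_deriveD (d0 x) d1) den0.
have -> : dstep x = _ := is_deriveE (is_deriveM (d0 x) D).
rewrite /= /GRing.scale/=; rewrite ?fctE /=.
set a := flat 0 x; set b := flat 0 (1 - x); set a' := flat 2 x; set b' := flat 2 (1 - x).
have den0' : a + b != 0 by exact: den0.
rewrite (_ : _ + _ = (a' * b + a * b') * (a + b) ^- 2).
  by rewrite mulr_ge0// ?addr_ge0 ?mulr_ge0 ?flat_ge0// invr_ge0 exprn_ge0// addr_ge0 ?flat_ge0.
by field.
Qed.

Lemma dstep_gt1 x : 1 < x -> dstep x = 0.
Proof.
move=> x0; rewrite /dstep (near_eq_derive _ (g := cst (1:R))) ?derive_cst//.
near=> y; rewrite step_ge1//; apply/ltW; by near: y; exact: lt_nbhsr.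
Unshelve. all: by end_near. Qed.

(** [step] climbs from 0 to 1, so the mean value theorem applies. This makes the mass of the
    mollifier positive. *)
Lemma dstep_pos : exists2 x, 0 < x < 1 & 0 < dstep x.
Proof.
have [c c01 E] := @MVT R step dstep 0 1 ltr01 (fun x _ => is_derive_step x)
  (continuous_subspaceT (smooth_continuous smooth_step)).
exists c; first by move: c01; rewrite in_itv.
by move: E; rewrite (step_le0 (lexx 0)) (step_ge1 (lexx 1)) !subr0 mulr1 => <-.
Qed.

End Step.

(** * Integration on the plane *)

Section Plane_integration.
Context {R : realType}.
Local Notation mR := (measurableTypeR R).
Local Notation P2 := (measurableTypeR R * measurableTypeR R)%type.
Local Notation leb2 := (@lebesgue2 R).
Local Notation leb := (@lebesgue_measure R).

(** Squares rather than disks: as products of segments they have an explicit measure and are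
    compact. *)
Definition box (c : R * R) (r : R) : set P2 :=
  [set` `[c.1 - r, c.1 + r]] `*` [set` `[c.2 - r, c.2 + r]].

Lemma boxP c r y : box c r y <-> `|y.1 - c.1| <= r /\ `|y.2 - c.2| <= r.
Proof.
by rewrite /box/= !in_itv/= -!ler_distl.
Qed.

Lemma measurable_box c r : measurable (box c r).
Proof. by apply: measurableX; exact: measurable_itv. Qed.

Lemma lebesgue2_box c r : 0 <= r -> leb2 (box c r) = ((2 * r) ^+ 2)%:E.
Proof.
pose I (a : R) : set R := [set` `[a - r, a + r]].
move=> r0; transitivity (leb (I c.1) * leb (I c.2))%E.
  by apply: product_measure1E; exact: measurable_itv.
have E (a : R) : leb (I a) = (2 * r)%:E.
  rewrite /I lebesgue_measure_itv/= lte_fin; case: ifPn => H.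
    by rewrite -EFinB; congr EFin; ring.
  have -> : r = 0 by apply/eqP; rewrite eq_le r0 andbT; lra.
  by rewrite mulr0.
by rewrite !E -EFinM expr2.
Qed.

Lemma subset_box c d r s : `|d.1 - c.1| + s <= r -> `|d.2 - c.2| + s <= r ->
  box d s `<=` box c r.
Proof.
move=> h1 h2 y /boxP[y1 y2]; apply/boxP; split.
- rewrite (le_trans _ h1)// (le_trans _ (lerD (lexx _) y1))//.
  by rewrite (_ : y.1 - c.1 = (d.1 - c.1) + (y.1 - d.1)); [exact: ler_normD|ring].
- rewrite (le_trans _ h2)// (le_trans _ (lerD (lexx _) y2))//.
  by rewrite (_ : y.2 - c.2 = (d.2 - c.2) + (y.2 - d.2)); [exact: ler_normD|ring].
Qed.

Lemma compact_box c r : compact (box c r : set (R * R)).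
Proof. by apply: compact_setX; exact: segment_compact. Qed.

(** The sigma-algebra is the product one, so an open set is written as the countable union of the
    rational rectangles that it contains; the other indices contribute the empty set. *)
Lemma open_measurable_plane (A : set (R * R)) : open A -> measurable (A : set P2).
Proof.
move=> oA.
pose rect (i : (rat * rat) * (rat * rat)) : set P2 :=
  [set` `]ratr i.1.1, ratr i.1.2[] `*` [set` `]ratr i.2.1, ratr i.2.2[].
pose F i : set P2 := if `[< rect i `<=` A >] then rect i else set0.
have -> : A = \bigcup_i F i.
  rewrite eqEsubset; split => [[x y] Axy|x [i _]]; last first.
    by rewrite /F; case: ifPn => [/asboolP|//]; exact.
  have [e /= e0 eA] : exists2 e : R, 0 < e & ball (x, y) e `<=` A.
    by apply/nbhs_ballP; apply: open_nbhs_nbhs.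
  have [a1] := @rat_in_itvoo R (x - e) x ltac:(by rewrite ltrBlDr ltrDl).
  have [b1] := @rat_in_itvoo R x (x + e) ltac:(by rewrite ltrDl).
  have [a2] := @rat_in_itvoo R (y - e) y ltac:(by rewrite ltrBlDr ltrDl).
  have [b2] := @rat_in_itvoo R y (y + e) ltac:(by rewrite ltrDl).
  rewrite !in_itv/= => /andP[yb2 b2e] /andP[ea2 a2y] /andP[xb1 b1e] /andP[ea1 a1x].
  exists ((a1, b1), (a2, b2)) => //; rewrite /F ifT; first by split; rewrite /= in_itv/= ?a1x ?a2y.
  apply/asboolP => -[u v] [] /=; rewrite !in_itv/= => /andP[u1 u2] /andP[v1 v2].
  apply: eA; split; rewrite /ball/= ltr_distl.
    by rewrite ltrBlDr; apply/andP; split; lra.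
  by rewrite ltrBlDr; apply/andP; split; lra.
apply: countable_bigcupT_measurable => [|i]; first exact: countableP.
rewrite /F; case: ifP => _; last exact: measurable0.
by apply: measurableX; exact: measurable_itv.
Qed.

Lemma continuous_measurable_plane (f : R * R -> R) :
  continuous f -> measurable_fun [set: P2] (f : P2 -> mR).
Proof.
move=> /continuousP cf; apply: (measurability _ (RGenOpens.measurableE R)).
move=> _ [_ [a [b ->] <-]]; rewrite setTI; apply: open_measurable_plane.
exact/cf/interval_open.
Qed.

Lemma continuous_bounded_box (f : R * R -> R) c r : continuous f ->
  exists2 M, 0 <= M & forall y, box c r y -> `|f y| <= M.
Proof.
move=> cf.
have cK : compact (f @` (box c r : set (R * R))).
  apply: continuous_compact; last exact: compact_box.
  exact: continuous_subspaceT.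
have [M [_ HM]] := compact_bounded cK.
exists (`|M| + 1); first by rewrite addr_ge0.
move=> y By; apply: (HM (`|M| + 1)); last by exists y.
by rewrite (le_lt_trans (ler_norm _))// ltrDl.
Qed.

Lemma integrable_supported (f : R * R -> R) c r M : 0 <= r ->
  measurable_fun [set: P2] (f : P2 -> mR) ->
  (forall y, `|f y| <= M) -> (forall y, ~ box c r y -> f y = 0) ->
  leb2.-integrable setT (EFin \o f).
Proof.
move=> r0 mf fM f0.
apply: (@le_integrable _ _ _ _ _ _ _ (fun x : P2 => M%:E * (\1_(box c r) x)%:E)%E) => //.
- exact/measurable_EFinP.
- move=> x _ /=; rewrite lee_fin normrM indicE.
  have [xb|/negP xb] := boolP (x \in box c r).
    by rewrite normr1 mulr1 (le_trans (fM x))// ler_norm.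
  by rewrite normr0 mulr0 f0 ?normr0// => /mem_set.
- apply: integrableZl => //; apply/integrableP; split.
    by apply/measurable_EFinP; exact: measurable_indic (measurable_box _ _).
  rewrite (eq_integral (fun x => (\1_(box c r) x)%:E)); last first.
    by move=> x _; rewrite gee0_abs// lee_fin.
  rewrite integral_indic//; last exact: measurable_box.
  by rewrite setIT lebesgue2_box// ltry.
Qed.

(** Compact support with an explicit square, so that bounds on integrals are explicit in the scale
    [r]. *)
Definition csupp (c : R * R) (r : R) (f : R * R -> R) :=
  [/\ 0 <= r, continuous f & forall y, ~ box c r y -> f y = 0].

Lemma csupp_bounded c r f : csupp c r f -> exists2 M, 0 <= M & forall y, `|f y| <= M.
Proof.
move=> [r0 cf f0]; have [M M0 HM] := continuous_bounded_box c r cf.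
exists M => // y; have [/HM//|/f0 ->] := pselect (box c r y).
by rewrite normr0.
Qed.

Lemma csupp_integrable c r f : csupp c r f -> leb2.-integrable setT (EFin \o f).
Proof.
move=> sf; have [M _ fM] := csupp_bounded sf; case: sf => r0 cf f0.
exact: (integrable_supported r0 (continuous_measurable_plane cf) fM f0).
Qed.



Lemma integral_box_cst c r M : 0 <= r -> (\int[leb2]_(x in box c r) M%:E)%E = (M * (2 * r) ^+ 2)%:E.
Proof.
by move=> r0; rewrite integral_cst ?lebesgue2_box//; exact: measurable_box.
Qed.

Lemma integral_supported_le (f : R * R -> R) c r M : 0 <= r -> 
  measurable_fun [set: P2] (f : P2 -> mR) ->
  (forall y, `|f y| <= M) -> (forall y, ~ box c r y -> f y = 0) ->
  (\int[leb2]_x `|f x|%:E <= (M * (2 * r) ^+ 2)%:E)%E.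
Proof.
move=> r0 mf fM f0.
rewrite (_ : (fun x => _) = (fun x => `|f x|%:E) \_ (box c r)); last first.
  apply/funext => x; rewrite patchE; case: ifPn => // /negP xb.
  by rewrite f0 ?normr0// => /mem_set.
rewrite -integral_mkcond -(@integral_box_cst c r M)//; apply: ge0_le_integral => //.
- exact: measurable_box.
- by apply/measurable_EFinP/measurableT_comp => //; exact: measurable_funTS.
- by move=> x _; rewrite lee_fin (le_trans _ (fM x)).
Qed.

Lemma csupp_integral_le c r f M : csupp c r f -> (forall y, `|f y| <= M) ->
  `|\int[leb2]_x f x| <= M * (2 * r) ^+ 2.
Proof.
move=> sf fM; have if_ := csupp_integrable sf; case: sf => r0 cf f0.
apply: le_trans (le_normr_Rintegral _ _) _ => //.
rewrite -lee_fin fineK; last first.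
  by apply: integrable_fin_num => //; exact: integrable_norm.
exact: (integral_supported_le r0 (continuous_measurable_plane cf) fM f0).
Qed.

End Plane_integration.

(** * Integration by parts and one-dimensional changes of variable *)

Section Compact_support.
Context {R : realType}.
Local Notation P2 := (measurableTypeR R * measurableTypeR R)%type.
Local Notation leb2 := (@lebesgue2 R).
Local Notation leb := (@lebesgue_measure R).

Lemma csuppW c d r s (f : R * R -> R) : box c r `<=` box d s -> 0 <= s ->
  csupp c r f -> csupp d s f.
Proof. by move=> cd s0 [r0 cf f0]; split => // y yd; apply: f0 => /cd. Qed.

Lemma csuppM c r (f g : R * R -> R) : csupp c r f -> continuous g -> csupp c r (f \* g).
Proof.
move=> [r0 cf f0] cg; split => // [x|y /f0 /= ->]; last by rewrite mul0r.
by apply: cvgM; [exact: cf|exact: cg].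
Qed.

Lemma csuppMl c r (f g : R * R -> R) : continuous g -> csupp c r f -> csupp c r (g \* f).
Proof.
move=> cg [r0 cf f0]; split => // [x|y /f0 /= ->]; last by rewrite mulr0.
by apply: cvgM; [exact: cg|exact: cf].
Qed.

Lemma csuppD c r (f g : R * R -> R) : csupp c r f -> csupp c r g -> csupp c r (f \+ g).
Proof.
move=> [r0 cf f0] [_ cg g0]; split => // [x|y yc /=]; last by rewrite f0// g0// addr0.
by apply: cvgD; [exact: cf|exact: cg].
Qed.

Lemma csuppB c r (f g : R * R -> R) : csupp c r f -> csupp c r g -> csupp c r (f \- g).
Proof.
move=> [r0 cf f0] [_ cg g0]; split => // [x|y yc /=]; last by rewrite f0// g0// subr0.
by apply: cvgB; [exact: cf|exact: cg].
Qed.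

Lemma csuppZ c r k (f : R * R -> R) : csupp c r f -> csupp c r (fun x => k * f x).
Proof.
by apply: (@csuppMl _ _ f (cst k)) => x; exact: cvg_cst.
Qed.

Lemma csuppN c r (f : R * R -> R) : csupp c r f -> csupp c r (fun x => - f x).
Proof.
move=> /(csuppZ (-1)); rewrite (_ : (fun x => -1 * f x) = (fun x => - f x))//.
by apply/funext => x; rewrite mulN1r.
Qed.

Lemma pair_line (h : R) (v x : R * R) : h *: v + x = (h * v.1 + x.1, h * v.2 + x.2).
Proof. by case: v x => [a b] [x y]. Qed.

Lemma continuous_pairl (T U : topologicalType) (y : U) : continuous (fun x : T => (x, y)).
Proof. by move=> x; apply: cvg_pair; [exact: cvg_id|exact: cvg_cst]. Qed.

Lemma continuous_pairr (T U : topologicalType) (x : T) : continuous (fun y : U => (x, y)).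
Proof. by move=> y; apply: cvg_pair; [exact: cvg_cst|exact: cvg_id]. Qed.

Lemma continuous_slice1 (f : R * R -> R) (y : R) : continuous f -> continuous (fun x : R => f (x, y)).
Proof.
move=> cf x; apply: (@continuous_comp _ _ _ (fun x : R => (x, y)) f); last exact: cf.
exact: continuous_pairl.
Qed.

Lemma continuous_slice2 (f : R * R -> R) (x : R) : continuous f -> continuous (fun y : R => f (x, y)).
Proof.
move=> cf y; apply: (@continuous_comp _ _ _ (fun y : R => (x, y)) f); last exact: cf.
exact: continuous_pairr.
Qed.

Lemma closed_box c r : closed (box c r : set (R * R)).
Proof.
apply: compact_closed; last exact: compact_box.
exact: norm_hausdorff.
Qed.

Lemma csupp_deriv c r (f : R * R -> R) v : smooth f -> csupp c r f ->
  csupp c r (fun x => 'D_v f x).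
Proof.
move=> sf [r0 cf f0]; split => //; first exact: smooth_continuous (smooth_deriv _ sf).
move=> y yc; rewrite (near_eq_derive _ (g := cst (0:R))) ?derive_cst//.
have : nbhs y (~` (box c r : set (R * R))).
  by apply: open_nbhs_nbhs; split => //; exact/closed_openC/closed_box.
by apply: filterS => z /f0.
Qed.

Lemma integral_deriv_eq0 (h dh : R -> R) a b : a < b ->
  (forall x, is_derive (x : R) 1 h (dh x)) -> continuous dh ->
  (forall x, ~ (a <= x <= b) -> h x = 0) ->
  (\int[leb]_x (dh x)%:E = 0)%E.
Proof.
move=> ab dhx cdh h0.
(* The margin of 1 puts the end points where [h] vanishes, so the fundamental theorem of calculus
   gives 0 - 0. *)
have dh0 x : ~ (a - 1 <= x <= b + 1) -> dh x = 0.
  move=> xab; have [_ <-] := dhx x.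
  rewrite (near_eq_derive _ (g := cst (0:R))) ?derive_cst//.
  have [xa|xa] := ltP x a.
    near=> y; apply: h0 => /andP[ay _].
    by have : y < a by [near: y; exact: lt_nbhsl]; lra.
  have bx : b < x by rewrite ltNge; apply/negP => xb; apply: xab; lra.
  near=> y; apply: h0 => /andP[_ yb].
  by have : b < y by [near: y; exact: lt_nbhsr]; lra.
rewrite (_ : (fun x => _) = (fun x => (dh x)%:E) \_ [set` `[a - 1, b + 1]]); last first.
  apply/funext => x; rewrite patchE; case: ifPn => // /negP xb.
  by rewrite dh0// => xab; apply: xb; rewrite inE /= in_itv.
rewrite -integral_mkcond.
have ch : continuous h.
  move=> x; apply: differentiable_continuous; apply/derivable1_diffP.
  by have [] := dhx x.
rewrite (@continuous_FTC2 _ _ h).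
- by rewrite !h0 ?subee//; lra.
- lra.
- exact: continuous_subspaceT.
- split.
  + by move=> x _; have [] := dhx x.
  + exact/cvg_at_right_filter/ch.
  + exact/cvg_at_left_filter/ch.
- by move=> x _; rewrite derive1E; have [_ ->] := dhx x.
Unshelve. all: by end_near. Qed.

Lemma integral_plane12 (f : P2 -> R) : leb2.-integrable setT (EFin \o f) ->
  (\int[leb2]_x (f x)%:E = \int[leb]_x \int[leb]_y (f (x, y))%:E)%E.
Proof. by move=> If; rewrite -(integral12_prod_meas1 If). Qed.

Lemma integral_plane21 (f : P2 -> R) : leb2.-integrable setT (EFin \o f) ->
  (\int[leb2]_x (f x)%:E = \int[leb]_y \int[leb]_x (f (x, y))%:E)%E.
Proof. by move=> If; rewrite -(integral21_prod_meas1 If). Qed.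

(** Fubini is used with the variable of differentiation innermost, hence in a different order for
    each [i]. *)
Lemma integral_partial (f : R * R -> R) c r i : smooth f -> csupp c r f ->
  \int[leb2]_x (partial i f x) = 0.
Proof.
move=> sf sp; have [r0 cf f0] := sp.
have spi := csupp_deriv (basis2 i) sf sp.
have Ip := csupp_integrable spi.
rewrite /Rintegral.
have spi' := smooth_continuous (smooth_deriv (basis2 i) sf).
have [i0|i1] := eqVneq i ord0.
- rewrite (integral_plane21 Ip) integral0_eq// => y _.
  apply: (@integral_deriv_eq0 (fun x => f (x, y)) _ (c.1 - (r+1)) (c.1 + (r+1))).
  + lra.
  + move=> x; apply: (@is_derive_affine _ _ _ _ f (fun x => (x, y)) x 1 (basis2 i)).
      by move=> h; rewrite pair_line /basis2 i0 eqxx /= mulr0 add0r.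
    exact: smooth_is_derive sf.
  + exact: (@continuous_slice1 _ y spi').
  + move=> x xab; apply: f0 => /boxP[/= x1 _]; apply: xab.
    move: x1; rewrite ler_distl; lra.
- rewrite (integral_plane12 Ip) integral0_eq// => x _.
  apply: (@integral_deriv_eq0 (fun y => f (x, y)) _ (c.2 - (r+1)) (c.2 + (r+1))).
  + lra.
  + move=> y; apply: (@is_derive_affine _ _ _ _ f (fun y => (x, y)) y 1 (basis2 i)).
      by move=> h; rewrite pair_line /basis2 (negbTE i1) /= mulr0 add0r.
    exact: smooth_is_derive sf.
  + exact: (@continuous_slice2 _ x spi').
  + move=> y xab; apply: f0 => /boxP[/= _ x1]; apply: xab.
    move: x1; rewrite ler_distl; lra.
Qed.

Lemma integral_by_parts (f g : R * R -> R) c r i : smooth f -> smooth g -> csupp c r g ->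
  \int[leb2]_x (partial i f x * g x) = - \int[leb2]_x (f x * partial i g x).
Proof.
move=> sf sg sp.
have sfg : smooth (f \* g) := smoothM sf sg.
have spfg : csupp c r (f \* g) by apply: csuppMl => //; exact: smooth_continuous.
have := integral_partial i sfg spfg.
under eq_Rintegral do rewrite /partial smooth_deriveM//.
rewrite RintegralD//; last 2 first.
- apply: (@csupp_integrable _ c r); apply: (csuppMl (smooth_continuous sf)).
  exact: csupp_deriv.
- apply: (@csupp_integrable _ c r); apply: (csuppM sp).
  exact: smooth_continuous (smooth_deriv _ sf).
move/eqP; rewrite addrC addr_eq0 => /eqP <-.
by apply: eq_Rintegral => x _; rewrite mulrC.
Qed.

Lemma ge0_integral_scale (G : R -> R) (d s : R) : 0 < s -> (forall x, 0 <= G x) -> continuous G ->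
  (\int[leb]_x (G (s^-1 * (x - d)))%:E = s%:E * \int[leb]_x (G x)%:E)%E.
Proof.
move=> s0 G0 cG.
pose F x := s^-1 * (x - d).
have dF x : is_derive (x : R) 1 F s^-1.
  have D1 : is_derive (x : R) 1 (fun x => x - d) (1 - 0).
    rewrite (_ : (fun x => x - d) = id - cst d)//; exact: is_deriveB.
  have := @is_deriveZ _ _ _ _ s^-1 x 1 _ D1.
  by rewrite subr0 /GRing.scale/= mulr1.
have F' : derive1 F = cst s^-1.
  by apply/funext => x; rewrite derive1E; have [_ ->] := dF x.
have cF : continuous F.
  move=> x; apply: differentiable_continuous; apply/derivable1_diffP.
  by have [] := dF x.
rewrite (@increasing_ge0_integration_by_substitutionT _ F G)//.
- rewrite F' -ge0_integralZl//.
  + apply: eq_integral => x _; rewrite -EFinM; congr EFin.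
    rewrite [X in s * X](_ : _ = G (F x) * s^-1)//.
    by rewrite mulrCA mulfV ?mulr1// gt_eqF.
  + apply/measurable_EFinP; apply: continuous_measurable_fun => x.
    by apply: cvgM; [apply: continuous_comp; [exact: cF|exact: cG]|exact: cvg_cst].
  + by move=> x _; rewrite lee_fin; apply: mulr_ge0; [exact: G0|rewrite /= invr_ge0 ltW].
  + exact: ltW.
- by move=> x y xy; rewrite ltr_pM2l ?invr_gt0// ltrD2r.
- by rewrite F' => x; exact: cvg_cst.
- by rewrite F'; exact: is_cvg_cst.
- by rewrite F'; exact: is_cvg_cst.
- apply/cvgrNyPle => A; near=> x.
  rewrite ler_pdivrMl// lerBlDr.
  by near: x; apply: nbhs_ninfty_le; rewrite num_real.
- apply/cvgryPge => A; near=> x.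
  rewrite ler_pdivlMl// lerBrDr.
  by near: x; apply: nbhs_pinfty_ge; rewrite num_real.
Unshelve. all: by end_near. Qed.
End Compact_support.

(** * Translations and dilations of the plane *)

Section Plane_scaling.
Context {R : realType}.
Local Notation P2 := (measurableTypeR R * measurableTypeR R)%type.
Local Notation leb2 := (@lebesgue2 R).

Lemma continuous_pair (T U V : topologicalType) (f : T -> U) (g : T -> V) :
  continuous f -> continuous g -> continuous (fun x => (f x, g x)).
Proof. by move=> cf cg x; apply: cvg_pair; [exact: cf|exact: cg]. Qed.

Definition rescale_pt (d : R * R) (s : R) (y : R * R) : R * R :=
  (s^-1 * (y.1 - d.1), s^-1 * (y.2 - d.2)).

Definition rescale (d : R * R) (s : R) (f : R * R -> R) (y : R * R) : R :=
  f (rescale_pt d s y).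

Lemma rescale_pt_line d s (h : R) v x :
  rescale_pt d s (h *: v + x) = h *: (s^-1 *: v) + rescale_pt d s x.
Proof.
rewrite !pair_line /rescale_pt /=.
case: v => v1 v2; rewrite /= /GRing.scale/=; congr (_ , _); ring.
Qed.

Lemma continuous_rescale_pt d s : continuous (rescale_pt d s).
Proof.
apply: continuous_pair => y; apply: (@cvgM _ _ _ _ (cst s^-1)); try exact: cvg_cst.
  by apply: (@cvgB _ _ _ _ _ fst); [exact: cvg_fst|exact: cvg_cst].
by apply: (@cvgB _ _ _ _ _ snd); [exact: cvg_snd|exact: cvg_cst].
Qed.

Lemma continuous_rescale d s f : continuous f -> continuous (rescale d s f).
Proof. by move=> cf y; apply: continuous_comp; [exact: continuous_rescale_pt|exact: cf]. Qed.

Lemma smooth_rescale d s f : smooth f -> smooth (rescale d s f).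
Proof.
apply: (@smooth_affine _ _ _ _ _ (rescale_pt d s) (fun v => s^-1 *: v)).
  exact: continuous_rescale_pt.
by move=> v x h; rewrite rescale_pt_line.
Qed.

Lemma rescale_deriv d s f v x : smooth f -> s != 0 ->
  'D_v (rescale d s f) x = s^-1 * rescale d s (fun x => 'D_v f x) x.
Proof.
move=> sf s0.
have /is_derive_line D : is_derive (rescale_pt d s x) v f ('D_v f (rescale_pt d s x)).
  exact: smooth_is_derive.
apply: is_deriveE; apply/is_derive_line.
have D0 : is_derive (0:R) 1 (fun h : R => s^-1 * h) s^-1.
  have := @is_deriveZ _ _ _ id s^-1 (0:R) 1 _ (is_derive_id _ _).
  by rewrite /GRing.scale/= mulr1.
have D' : is_derive ((fun h : R => s^-1 * h) 0) 1 (fun h : R => f (h *: v + rescale_pt d s x))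
   ('D_v f (rescale_pt d s x)) by rewrite mulr0.
rewrite (_ : (fun h : R => _) = (fun h : R => f (h *: v + rescale_pt d s x)) \o (fun h : R => s^-1 * h)).
  by rewrite mulrC; exact: is_derive_chain.
by apply/funext => h /=; rewrite /rescale rescale_pt_line scalerA mulrC.
Qed.

Lemma csupp_rescale r d s f : 0 < s -> csupp 0 r f -> csupp d (s * r) (rescale d s f).
Proof.
move=> s0 [r0 cf f0]; split; first by rewrite mulr_ge0// ltW.
  by move=> y; apply: continuous_comp; [exact: continuous_rescale_pt|exact: cf].
move=> y yd; apply: f0 => /boxP[/=].
rewrite !subr0 !normrM gtr0_norm ?invr_gt0// !ler_pdivrMl// => y1 y2.
by apply: yd; apply/boxP.
Qed.

Lemma ge0_integral_rescale (f : R * R -> R) d s : 0 < s -> (forall x, 0 <= f x) -> continuous f ->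
  (\int[leb2]_x (rescale d s f x)%:E = (s ^+ 2)%:E * \int[leb2]_x (f x)%:E)%E.
Proof.
move=> s0 f0 cf.
pose g (y : R * R) := f (s^-1 * (y.1 - d.1), y.2).
have mE (h : R * R -> R) : continuous h -> measurable_fun [set: P2] (fun x : P2 => (h x)%:E).
  by move=> ch; apply/measurable_EFinP; exact: continuous_measurable_plane.
have cg : continuous g.
  move=> y; apply: (@continuous_comp _ _ _ (fun y : R * R => (s^-1 * (y.1 - d.1), y.2)) f); last exact: cf.
  apply: continuous_pair => {}y; last exact: cvg_snd.
  apply: (@cvgM _ _ _ _ (cst s^-1)); first exact: cvg_cst.
  by apply: (@cvgB _ _ _ _ _ fst); [exact: cvg_fst|exact: cvg_cst].
have cr : continuous (rescale d s f).
  by move=> y; apply: continuous_comp; [exact: continuous_rescale_pt|exact: cf].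
transitivity (s%:E * \int[leb2]_x (g x)%:E)%E.
  rewrite /lebesgue2 fubini_tonelli1; [|exact: mE|by move=> x; rewrite lee_fin; exact: f0].
  rewrite fubini_tonelli1; [|exact: mE|by move=> x; rewrite lee_fin; exact: f0].
  rewrite -ge0_integralZl//; last 3 first.
  - by apply: measurable_fun_fubini_tonelli_F; [exact: mE|by move=> x; rewrite lee_fin; exact: f0].
  - by move=> x _; apply: integral_ge0 => y _; rewrite lee_fin; exact: f0.
  - by rewrite lee_fin ltW.
  apply: eq_integral => x _; rewrite /fubini_F.
  rewrite -(@ge0_integral_scale _ (fun y => g (x, y)) d.2 s)//.
  - by move=> y; exact: f0.
  - exact: (@continuous_slice2 _ g x cg).
rewrite expr2 EFinM -muleA; congr (_ * _)%E.
rewrite /lebesgue2 fubini_tonelli2; [|exact: mE|by move=> x; rewrite lee_fin; exact: f0].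
rewrite fubini_tonelli2; [|exact: mE|by move=> x; rewrite lee_fin; exact: f0].
rewrite -ge0_integralZl//; last 3 first.
- by apply: measurable_fun_fubini_tonelli_G; [exact: mE|by move=> x; rewrite lee_fin; exact: f0].
- by move=> x _; apply: integral_ge0 => y _; rewrite lee_fin; exact: f0.
- by rewrite lee_fin ltW.
apply: eq_integral => y _; rewrite /fubini_G.
rewrite -(@ge0_integral_scale _ (fun x => f (x, y)) d.1 s)//.
exact: (@continuous_slice1 _ f y cf).
Qed.

(** Positive and negative parts reduce this to [ge0_integral_rescale]. They are merely continuous,
    which is why [csupp] asks for no smoothness. *)
Lemma integral_rescale (f : R * R -> R) c r d s c' r' : 0 < s -> csupp c r f ->
  csupp c' r' (rescale d s f) ->
  \int[leb2]_x (rescale d s f x) = s ^+ 2 * \int[leb2]_x (f x).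
Proof.
move=> s0 sf sr; have [r0 cf f0] := sf.
pose fp x := Num.max (f x) 0; pose fn x := Num.max (- f x) 0.
have cfp : continuous fp by move=> x; apply: (continuous_max (cf x)); exact: cvg_cst.
have cfn : continuous fn.
  by move=> x; apply: (continuous_max (cvgN (cf x))); exact: cvg_cst.
have fE x : f x = fp x - fn x.
  rewrite /fp /fn; have [h|h] := leP (f x) 0.
    by rewrite max_l ?oppr_ge0// sub0r opprK.
  by rewrite max_r ?oppr_le0 ?subr0// ltW.
have sfp : csupp c r fp by split => // y /f0; rewrite /fp => ->; rewrite maxxx.
have sfn : csupp c r fn by split => // y /f0; rewrite /fn => ->; rewrite oppr0 maxxx.
have [r0' cr fr0] := sr.
have srp : csupp c' r' (rescale d s fp).
  split => [||y /fr0]; [by []| |].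
    exact: continuous_rescale.
  by rewrite /rescale /fp => ->; rewrite maxxx.
have srn : csupp c' r' (rescale d s fn).
  split => [||y /fr0]; [by []| |].
    exact: continuous_rescale.
  by rewrite /rescale /fn => ->; rewrite oppr0 maxxx.
have key g : csupp c r g -> (forall x, 0 <= g x) -> 
    \int[leb2]_x (rescale d s g x) = s ^+ 2 * \int[leb2]_x (g x).
  move=> sg g0; have [_ cg _] := sg.
  rewrite /Rintegral ge0_integral_rescale// fineM//.
  by apply: integrable_fin_num => //; exact: csupp_integrable sg.
transitivity (\int[leb2]_x (rescale d s fp x - rescale d s fn x)).
  by apply: eq_Rintegral => x _; rewrite /rescale fE.
rewrite RintegralB//; [|exact: csupp_integrable srp|exact: csupp_integrable srn].
rewrite key//; last by move=> x; rewrite le_max lexx orbT.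
rewrite key//; last by move=> x; rewrite le_max lexx orbT.
rewrite -mulrBr -RintegralB//; [|exact: csupp_integrable sfp|exact: csupp_integrable sfn].
by congr (_ * _); apply: eq_Rintegral => x _; rewrite fE.
Qed.

End Plane_scaling.

(** * Fourier inversion *)

Section Fourier1D.
Context {R : realType}.
Local Notation mR := (measurableTypeR R).
Local Notation leb := (@lebesgue_measure R).

Lemma is_derive_continuous (f df : R -> R) : (forall x : R, is_derive x 1 f (df x)) -> continuous f.
Proof.
move=> H x; apply: differentiable_continuous; apply/derivable1_diffP.
by have [] := H x.
Qed.

Lemma onepcos_ge0 (x : R) : 0 <= 1 + cos x.
Proof. by have := cos_geN1 x; lra. Qed.

Lemma ge0_integral_fold (G : R -> R) : (forall x, 0 <= G x) -> continuous G ->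
  (\int[leb]_x (G x)%:E = \int[leb]_(x in `[0%R, +oo[) (G x + G (- x))%:E)%E.
Proof.
move=> f0 cf.
have mf : measurable_fun [set: mR] G by exact: continuous_measurable_fun.
have mp : measurable [set` `[(0:R), +oo[] by [].
have mfN : measurable_fun [set: mR] (fun x => G (- x)).
  apply: continuous_measurable_fun => x.
  by apply: continuous_comp; [exact: opp_continuous|exact: cf].
under [RHS]eq_integral do rewrite EFinD.
rewrite [RHS]ge0_integralD//; last 4 first.
- by move=> x _; rewrite lee_fin.
- by apply/measurable_EFinP; exact: measurable_funTS.
- by move=> x _; rewrite lee_fin.
- by apply/measurable_EFinP; exact: measurable_funTS.
rewrite -(setUv [set` `[(0:R), +oo[]) ge0_integral_setU//= ; last 4 first.
- exact: measurableC.
- by apply/measurable_EFinP; rewrite setUv.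
- by move=> x _; rewrite lee_fin.
- exact/disj_setPCl.
congr (_ + _)%E; rewrite setCitvr.
rewrite integral_itv_bndo_bndc; last exact/measurable_EFinP/measurable_funTS.
rewrite -{1}oppr0 ge0_integration_by_substitutionNy//.
exact: continuous_subspaceT.
Qed.

(** Adding 1 to the cosine makes the integrand nonnegative, so the fundamental theorem applies on
    the half-line with the explicit primitive [F]; the integral of the exponential alone is
    subtracted later. *)
Lemma integral_laplace_cos (e z : R) : 0 < e ->
  (\int[leb]_(x in `[0%R, +oo[) (expR (- e * x) * (1 + cos (z * x)))%:E
   = (e^-1 + e / (e ^+ 2 + z ^+ 2))%:E)%E.
Proof.
move=> e0.
have e_neq0 : e != 0 by rewrite gt_eqF.
have q0 : e ^+ 2 + z ^+ 2 != 0 by rewrite gt_eqF// ltr_pwDl ?exprn_gt0// sqr_ge0.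
pose q := (e ^+ 2 + z ^+ 2).
pose F x := expR (- e * x) * (- e^-1 + q^-1 * (z * sin (z * x) - e * cos (z * x))).
have dE x : is_derive (x : R) 1 (fun x => expR (- e * x)) (expR (- e * x) * - e).
  by apply: (@is_derive_chain _ _ expR (fun x => - e * x)); exact: is_derive_linear.
have dS x : is_derive (x : R) 1 (fun x => sin (z * x)) (cos (z * x) * z).
  by apply: (@is_derive_chain _ _ sin (fun x => z * x)); exact: is_derive_linear.
have dC x : is_derive (x : R) 1 (fun x => cos (z * x)) (- sin (z * x) * z).
  by apply: (@is_derive_chain _ _ cos (fun x => z * x)); exact: is_derive_linear.
have dF x : is_derive (x : R) 1 F (expR (- e * x) * (1 + cos (z * x))).
  have D := is_derive_mul (dE x) (is_derive_add (is_derive_cst (- e^-1) x 1)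
    (is_derive_cmul q^-1 (is_derive_sub (is_derive_cmul z (dS x)) (is_derive_cmul e (dC x))))).
  by apply: (is_derive_eq D); rewrite /q /=; field; rewrite ?q0 ?e_neq0.
have cf : continuous (fun x => expR (- e * x) * (1 + cos (z * x))).
  move=> x; apply: cvgM; first exact: (is_derive_continuous dE).
  by apply: cvgD; [exact: cvg_cst|exact: (is_derive_continuous dC)].
rewrite (@ge0_continuous_FTC2y _ _ F _ 0).
- rewrite /F !mulr0 expR0 sin0 cos0 mul1r sub0e; congr EFin.
  by rewrite /q; field; rewrite q0 e_neq0.
- by move=> x _; apply: mulr_ge0; [exact: expR_ge0|exact: onepcos_ge0].
- exact: continuous_subspaceT.
- apply/cvgr0Pnorm_lt => d d0.
  pose K := e^-1 + q^-1 * (`|z| + e).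
  have K0 : 0 < K.
    rewrite /K ltr_pwDl ?invr_gt0// mulr_ge0 ?invr_ge0 ?addr_ge0 ?sqr_ge0//; exact: ltW.
  have : \forall x \near +oo, expR (- x) < d / K.
    have /cvgr0Pnorm_lt/(_ (d / K)) := @cvgr_expR R.
    rewrite divr_gt0// => /(_ isT); apply: filterS => x.
    by rewrite ger0_norm// expR_ge0.
  move=> [M [Mr HM]]; near=> x.
  have x0 : 0 <= x by near: x; apply: nbhs_pinfty_ge; rewrite num_real.
  have := HM (e * x).
  have -> : M < e * x.
    by rewrite -ltr_pdivrMl//; near: x; apply: nbhs_pinfty_gt; rewrite num_real.
  move=> /(_ isT); rewrite /F normrM ger0_norm ?expR_ge0// -mulNr => H.
  rewrite -(divfK (lt0r_neq0 K0) d); apply: (@le_lt_trans _ _ (expR (- e * x) * K)).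
    rewrite ler_wpM2l ?expR_ge0// /K (le_trans (ler_normD _ _))// lerD//.
      by rewrite normrN gtr0_norm// invr_gt0.
    rewrite normrM ger0_norm ?invr_ge0 ?addr_ge0 ?sqr_ge0// ler_wpM2l ?invr_ge0 ?addr_ge0 ?sqr_ge0//.
    rewrite (le_trans (ler_normB _ _))// !normrM (gtr0_norm e0) lerD//.
      by apply: ler_piMr => //; rewrite ler_norml sin_le1 sin_geN1.
    by apply: ler_piMr; [exact: ltW|rewrite ler_norml cos_le1 cos_geN1].
  by rewrite ltr_pM2r.
- by move=> x _; have [] := dF x.
- exact/cvg_at_right_filter/(is_derive_continuous dF).
- by move=> x _; rewrite derive1E; have [_ ->] := dF x.
Unshelve. all: by end_near. Qed.

Definition eabs (e x : R) := expR (- e * `|x|).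

Lemma eabs_ge0 e x : 0 <= eabs e x. Proof. exact: expR_ge0. Qed.

Lemma continuous_eabs e : continuous (eabs e).
Proof.
move=> x; apply: (@continuous_comp _ _ _ (fun x => - e * `|x|) expR); last exact: continuous_expR.
by apply: cvgM; [exact: cvg_cst|exact: norm_continuous].
Qed.

Lemma ge0_integral_eabs_cos1 e z : 0 < e ->
  (\int[leb]_x (eabs e x * (1 + cos (z * x)))%:E = (2 * (e^-1 + e / (e ^+ 2 + z ^+ 2)))%:E)%E.
Proof.
move=> e0; rewrite ge0_integral_fold; last 2 first.
- by move=> x; apply: mulr_ge0; [exact: expR_ge0|exact: onepcos_ge0].
- move=> x; apply: cvgM; first exact: continuous_eabs.
  apply: cvgD; first exact: cvg_cst.
  apply: (@continuous_comp _ _ _ (fun x => z * x) cos); last exact: continuous_cos.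
  by apply: cvgM; [exact: cvg_cst|exact: cvg_id].
transitivity (\int[leb]_(x in `[0%R, +oo[) (2%:E * (expR (- e * x) * (1 + cos (z * x)))%:E))%E.
  apply: eq_integral => x; rewrite inE/= in_itv/= andbT => x0.
  by rewrite /eabs normrN ger0_norm// mulrN cosN -EFinM; congr EFin; ring.
have mf : measurable_fun [set: mR] (fun x => expR (- e * x) * (1 + cos (z * x))).
  apply: continuous_measurable_fun => x; apply: cvgM.
    apply: (@continuous_comp _ _ _ (fun x => - e * x) expR); last exact: continuous_expR.
    by apply: cvgM; [exact: cvg_cst|exact: cvg_id].
  apply: cvgD; first exact: cvg_cst.
  apply: (@continuous_comp _ _ _ (fun x => z * x) cos); last exact: continuous_cos.
  by apply: cvgM; [exact: cvg_cst|exact: cvg_id].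
rewrite ge0_integralZl//.
- by rewrite integral_laplace_cos.
- by apply/measurable_EFinP; exact: measurable_funTS.
Qed.

Lemma ge0_integral_eabs e : 0 < e -> (\int[leb]_x (eabs e x)%:E = (2 / e)%:E)%E.
Proof.
move=> e0; rewrite (@ge0_integral_fold (eabs e) (@eabs_ge0 e) (@continuous_eabs e)).
transitivity (\int[leb]_(x in `[0%R, +oo[) (expR (- e * x) * (1 + cos (0 * x)))%:E)%E.
  apply: eq_integral => x; rewrite inE/= in_itv/= andbT => x0.
  by rewrite /eabs normrN ger0_norm// mul0r cos0; congr EFin; ring.
rewrite integral_laplace_cos//; congr EFin.
by field; rewrite gt_eqF.
Qed.

Lemma integrable_eabs e : 0 < e -> leb.-integrable setT (EFin \o eabs e).
Proof.
move=> e0; apply/integrableP; split.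
  by apply/measurable_EFinP; exact: (continuous_measurable_fun (@continuous_eabs e)).
under eq_integral do rewrite /= ger0_norm ?eabs_ge0//.
by rewrite ge0_integral_eabs// ltry.
Qed.

Lemma integrable_eabsM e (f : R -> R) : 0 < e -> continuous f -> (forall x, `|f x| <= 1) ->
  leb.-integrable setT (EFin \o (fun x => eabs e x * f x)).
Proof.
move=> e0 cf f1; apply: le_integrable (integrable_eabs e0) => //.
  have ch : continuous (fun x => eabs e x * f x).
    by move=> x; apply: cvgM; [exact: continuous_eabs|exact: cf].
  by apply/measurable_EFinP; exact: (continuous_measurable_fun ch).
by move=> x _ /=; rewrite lee_fin normrM ler_piMr.
Qed.

Lemma continuous_scale_cos z : continuous (fun x : R => cos (z * x)).
Proof.
move=> x; apply: (@continuous_comp _ _ _ (fun x => z * x) cos); last exact: continuous_cos.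
by apply: cvgM; [exact: cvg_cst|exact: cvg_id].
Qed.

Lemma continuous_scale_sin z : continuous (fun x : R => sin (z * x)).
Proof.
move=> x; apply: (@continuous_comp _ _ _ (fun x => z * x) sin); last exact: continuous_sin.
by apply: cvgM; [exact: cvg_cst|exact: cvg_id].
Qed.

Lemma norm_cos_le1 (x : R) : `|cos x| <= 1.
Proof. by rewrite ler_norml cos_le1 cos_geN1. Qed.

Lemma norm_sin_le1 (x : R) : `|sin x| <= 1.
Proof. by rewrite ler_norml sin_le1 sin_geN1. Qed.

Lemma integral_eabs_cos e z : 0 < e ->
  \int[leb]_x (eabs e x * cos (z * x)) = 2 * e / (e ^+ 2 + z ^+ 2).
Proof.
move=> e0.
have Ic : leb.-integrable setT (EFin \o (fun x => eabs e x * cos (z * x))).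
  apply: integrable_eabsM => //; first exact: continuous_scale_cos.
  by move=> x; exact: norm_cos_le1.
have E : \int[leb]_x (eabs e x + eabs e x * cos (z * x)) = 2 * (e^-1 + e / (e ^+ 2 + z ^+ 2)).
  rewrite /Rintegral -[RHS]/(fine (_%:E)) -(ge0_integral_eabs_cos1 z e0); congr fine.
  by apply: eq_integral => x _; rewrite mulrDr mulr1.
move: E; rewrite RintegralD//; last exact: integrable_eabs.
rewrite [X in X + _](_ : _ = 2 / e); last by rewrite /Rintegral ge0_integral_eabs.
by move=> /(canRL (addKr _)) ->; ring.
Qed.

(** As for the cosine, [eabs e] is added to have a nonnegative integrand; folding the line at 0 then
    cancels the odd part. *)
Lemma integral_eabs_sin e z : 0 < e ->
  \int[leb]_x (eabs e x * sin (z * x)) = 0.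
Proof.
move=> e0.
have Ic : leb.-integrable setT (EFin \o (fun x => eabs e x * sin (z * x))).
  apply: integrable_eabsM => //; first exact: continuous_scale_sin.
  by move=> x; exact: norm_sin_le1.
have E : \int[leb]_x (eabs e x + eabs e x * sin (z * x)) = 2 / e.
  rewrite /Rintegral -[RHS]/(fine (_%:E)) -(ge0_integral_eabs e0); congr fine.
  have H (f : R -> R) : continuous f -> (forall x, `|f x| <= 1) -> (forall x, 0 <= eabs e x + eabs e x * f x)
     /\ continuous (fun x => eabs e x + eabs e x * f x).
    move=> cf f1; split=> x.
      rewrite -{1}[eabs e x]mulr1 -mulrDr mulr_ge0 ?eabs_ge0//.
      by move: (f1 x); rewrite ler_norml; lra.
    by apply: cvgD; [exact: continuous_eabs|apply: cvgM; [exact: continuous_eabs|exact: cf]].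
  have [H1 H2] := H _ (@continuous_scale_sin z) (fun x => norm_sin_le1 _).
  rewrite !ge0_integral_fold//; last 2 first.
  - by move=> x; exact: eabs_ge0.
  - exact: continuous_eabs.
  apply: eq_integral => x _; congr EFin.
  by rewrite /eabs normrN mulrN sinN; ring.
move: E; rewrite RintegralD//; last exact: integrable_eabs.
rewrite [X in X + _](_ : _ = 2 / e); last by rewrite /Rintegral ge0_integral_eabs.
by move=> /(canRL (addKr _)) ->; ring.
Qed.

Definition cauchy (x : R) : R := (1 + x ^+ 2)^-1.

Lemma cauchy_gt0 x : 0 < cauchy x.
Proof. by rewrite invr_gt0 ltr_pwDl// sqr_ge0. Qed.

Lemma continuous_cauchy : continuous cauchy.
Proof. exact: continuous_oneDsqrV. Qed.

Lemma integral_cauchy : (\int[leb]_x (cauchy x)%:E = (pi)%:E)%E.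
Proof.
rewrite ge0_symfun_integralT.
- by rewrite -set_itvcy integral0y_oneDsqr -EFinM; congr EFin; field.
- by move=> x; exact: ltW (cauchy_gt0 x).
- exact: continuous_cauchy.
- by move=> x; rewrite /cauchy /= sqrrN.
Qed.

Lemma integrable_cauchy : leb.-integrable setT (EFin \o cauchy).
Proof.
apply/integrableP; split.
  by apply/measurable_EFinP; exact: (continuous_measurable_fun continuous_cauchy).
under eq_integral do rewrite /= gtr0_norm ?cauchy_gt0//.
by rewrite integral_cauchy ltry.
Qed.

End Fourier1D.

(** * Integrals of tensor products *)

Section Product_integrals.
Context d1 d2 (T1 : measurableType d1) (T2 : measurableType d2) (R : realType).
Variables (m1 : {sigma_finite_measure set T1 -> \bar R}).
Variables (m2 : {sigma_finite_measure set T2 -> \bar R}).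

Lemma Rintegral_EFin d (T : measurableType d) (m : {measure set T -> \bar R}) (f : T -> R) :
  m.-integrable setT (EFin \o f) -> (\int[m]_x (f x)%:E = (\int[m]_x f x)%:E)%E.
Proof. by move=> If; rewrite /Rintegral fineK//; exact: integrable_fin_num. Qed.

Lemma integrable_tensor (a : T1 -> R) (b : T2 -> R) :
  m1.-integrable setT (EFin \o a) -> m2.-integrable setT (EFin \o b) ->
  (m1 \x m2)%E.-integrable setT (EFin \o (fun z => a z.1 * b z.2)).
Proof.
move=> Ia Ib.
have ma : measurable_fun setT a by apply/measurable_EFinP; exact: measurable_int Ia.
have mb : measurable_fun setT b by apply/measurable_EFinP; exact: measurable_int Ib.
apply/integrable12ltyP => /=.
  apply/measurable_EFinP; apply: measurable_funM.
    by apply: measurableT_comp ma _; exact: measurable_fst.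
  by apply: measurableT_comp mb _; exact: measurable_snd.
have Ia' := integrable_norm Ia; have Ib' := integrable_norm Ib.
under eq_integral => x _.
  under eq_integral do rewrite normrM EFinM.
  rewrite integralZl//.
  rewrite (Rintegral_EFin Ib') -EFinM mulrC EFinM.
  over.
rewrite integralZl// (Rintegral_EFin Ia') -EFinM ltry//.
Qed.

Lemma Rintegral_tensor (a : T1 -> R) (b : T2 -> R) :
  m1.-integrable setT (EFin \o a) -> m2.-integrable setT (EFin \o b) ->
  \int[(m1 \x m2)%E]_z (a z.1 * b z.2) = (\int[m1]_x a x) * (\int[m2]_y b y).
Proof.
move=> Ia Ib; rewrite {1}/Rintegral -(integral12_prod_meas1 (integrable_tensor Ia Ib)).
rewrite /fubini_F /=.
under eq_integral => x _.
  under eq_integral do rewrite EFinM.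
  rewrite integralZl// (Rintegral_EFin Ib) -EFinM mulrC EFinM.
  over.
by rewrite integralZl// (Rintegral_EFin Ia) -EFinM /= mulrC.
Qed.

End Product_integrals.

(** * Cosine and sine transforms on the plane *)

Section Fourier2D.
Context {R : realType}.
Local Notation leb2 := (@lebesgue2 R).

(** [cosT] and [- sinT] are the real and imaginary parts of [fourier]; all computations stay in the
    reals. *)
Definition cosT (f : R * R -> R) (xi : R * R) : R := \int[leb2]_x (f x * cos (dot2 x xi)).
Definition sinT (f : R * R -> R) (xi : R * R) : R := \int[leb2]_x (f x * sin (dot2 x xi)).

Lemma class_C_sin_cos n : class_C n (@sin R) /\ class_C n (@cos R).
Proof.
elim: n => [|n [IHs IHc]]; first by split; [exact: continuous_sin|exact: continuous_cos].
split; first exact: (class_C_1D (@is_derive_sin R)).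
by apply: (class_C_1D (@is_derive_cos R)); exact: class_CN.
Qed.

Lemma smooth_sin : smooth (@sin R). Proof. by move=> n; case: (class_C_sin_cos n). Qed.
Lemma smooth_cos : smooth (@cos R). Proof. by move=> n; case: (class_C_sin_cos n). Qed.

Lemma continuous_dot2 (xi : R * R) : continuous (fun x => dot2 x xi).
Proof.
move=> x; apply: cvgD; apply: cvgM; try exact: cvg_cst.
  exact: cvg_fst.
exact: cvg_snd.
Qed.

Lemma dot2_line (h : R) v x xi : dot2 (h *: v + x) xi = h *: dot2 v xi + dot2 x xi.
Proof. by rewrite pair_line /dot2 /GRing.scale/=; ring. Qed.

Lemma smooth_dot2 (xi : R * R) : smooth (fun x => dot2 x xi).
Proof.
apply: smooth_linear; first exact: continuous_dot2.
by move=> v x h; exact: dot2_line.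
Qed.

Lemma dot2_basis i xi : dot2 (basis2 i) xi = coord2 i xi :> R.
Proof. by rewrite /dot2 /basis2 /coord2; case: (i == ord0) => /=; ring. Qed.

Lemma derive_dot2 xi v x : 'D_v (fun x : R * R => dot2 x xi) x = dot2 v xi.
Proof.
have -> : (fun x : R * R => dot2 x xi) = id \o (fun x => dot2 x xi) by [].
rewrite (@derive_affine R R (R * R)%type R id _ x v (dot2 v xi) smooth_id).
  by rewrite (@is_deriveE _ _ _ id _ _ _ (is_derive_id _ _)).
by move=> h; exact: dot2_line.
Qed.

Lemma smooth_cos_dot2 xi : smooth (fun x : R * R => cos (dot2 x xi)).
Proof. exact: (smooth_comp smooth_cos (smooth_dot2 xi)). Qed.

Lemma smooth_sin_dot2 xi : smooth (fun x : R * R => sin (dot2 x xi) : R).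
Proof. exact: (smooth_comp smooth_sin (smooth_dot2 xi)). Qed.

Lemma partial_cos_dot2 xi i x :
  partial i (fun x => cos (dot2 x xi) : R) x = - coord2 i xi * sin (dot2 x xi).
Proof.
rewrite /partial (@derive_chain R _ (@cos R) (fun x => dot2 x xi))//; [|exact: smooth_cos|exact: smooth_dot2].
by rewrite derive_dot2 dot2_basis (is_deriveE (is_derive_cos _)); ring.
Qed.

Lemma partial_sin_dot2 xi i x :
  partial i (fun x => sin (dot2 x xi) : R) x = coord2 i xi * cos (dot2 x xi).
Proof.
rewrite /partial (@derive_chain R _ (@sin R) (fun x => dot2 x xi))//; [|exact: smooth_sin|exact: smooth_dot2].
by rewrite derive_dot2 dot2_basis (is_deriveE (is_derive_sin _)); ring.
Qed.

Variables (c : R * R) (r : R).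

Lemma csupp_cos f xi : csupp c r f -> csupp c r (fun x => f x * cos (dot2 x xi)).
Proof. by move=> sp; apply: (csuppM sp); exact: smooth_continuous (smooth_cos_dot2 xi). Qed.

Lemma csupp_sin f xi : csupp c r f -> csupp c r (fun x => f x * sin (dot2 x xi)).
Proof. by move=> sp; apply: (csuppM sp); exact: smooth_continuous (smooth_sin_dot2 xi). Qed.

Lemma cosT_partial f i xi : smooth f -> csupp c r f ->
  cosT (partial i f) xi = coord2 i xi * sinT f xi.
Proof.
move=> sf sp; rewrite /cosT /sinT.
have := integral_by_parts i (smooth_cos_dot2 xi) sf sp.
under eq_Rintegral do rewrite partial_cos_dot2 -mulrA.
rewrite RintegralZl//; last first.
  rewrite (_ : _ \o _ = EFin \o (fun x => f x * sin (dot2 x xi))).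
    exact: csupp_integrable (csupp_sin xi sp).
  by apply/funext => x /=; rewrite mulrC.
under [X in _ = - X -> _]eq_Rintegral do rewrite mulrC.
move/eqP; rewrite mulNr eqr_opp => /eqP <-; congr (_ * _).
by apply: eq_Rintegral => x _; rewrite mulrC.
Qed.

Lemma sinT_partial f i xi : smooth f -> csupp c r f ->
  sinT (partial i f) xi = - coord2 i xi * cosT f xi.
Proof.
move=> sf sp; rewrite /cosT /sinT.
have := integral_by_parts i (smooth_sin_dot2 xi) sf sp.
under eq_Rintegral do rewrite partial_sin_dot2 -mulrA.
rewrite RintegralZl//; last first.
  rewrite (_ : _ \o _ = EFin \o (fun x => f x * cos (dot2 x xi))).
    exact: csupp_integrable (csupp_cos xi sp).
  by apply/funext => x /=; rewrite mulrC.
under [X in _ = - X -> _]eq_Rintegral do rewrite mulrC.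
move/(congr1 -%R); rewrite opprK => <-; rewrite mulNr; congr (- (_ * _)).
by apply: eq_Rintegral => x _; rewrite mulrC.
Qed.

Lemma cosT_le f xi M : csupp c r f -> (forall x, `|f x| <= M) ->
  `|cosT f xi| <= M * (2 * r) ^+ 2.
Proof.
move=> sp fM; apply: csupp_integral_le; first exact: csupp_cos.
move=> x; rewrite normrM (le_trans _ (fM x))// ler_piMr//.
exact: norm_cos_le1.
Qed.

Lemma sinT_le f xi M : csupp c r f -> (forall x, `|f x| <= M) ->
  `|sinT f xi| <= M * (2 * r) ^+ 2.
Proof.
move=> sp fM; apply: csupp_integral_le; first exact: csupp_sin.
move=> x; rewrite normrM (le_trans _ (fM x))// ler_piMr//.
exact: norm_sin_le1.
Qed.

Lemma cosTB f g xi : csupp c r f -> csupp c r g ->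
  cosT (f \- g) xi = cosT f xi - cosT g xi.
Proof.
move=> sf sg; rewrite /cosT -RintegralB//; last 2 first.
- exact: csupp_integrable (csupp_cos xi sf).
- exact: csupp_integrable (csupp_cos xi sg).
by apply: eq_Rintegral => x _; rewrite mulrBl.
Qed.

Lemma sinTB f g xi : csupp c r f -> csupp c r g ->
  sinT (f \- g) xi = sinT f xi - sinT g xi.
Proof.
move=> sf sg; rewrite /sinT -RintegralB//; last 2 first.
- exact: csupp_integrable (csupp_sin xi sf).
- exact: csupp_integrable (csupp_sin xi sg).
by apply: eq_Rintegral => x _; rewrite mulrBl.
Qed.

End Fourier2D.

(** * Continuity and decay of the transforms *)

Section Fourier_decay.
Context {R : realType}.
Local Notation leb2 := (@lebesgue2 R).
Local Notation leb := (@lebesgue_measure R).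

Definition cauchy2 (xi : R * R) : R := cauchy xi.1 * cauchy xi.2.

Lemma cauchy2_gt0 xi : 0 < cauchy2 xi.
Proof. by rewrite mulr_gt0// cauchy_gt0. Qed.

Lemma integrable_cauchy2 : leb2.-integrable setT (EFin \o cauchy2).
Proof. exact: (integrable_tensor (@integrable_cauchy R) (@integrable_cauchy R)). Qed.

Lemma Rintegral_cauchy2 : \int[leb2]_xi cauchy2 xi = pi ^+ 2.
Proof.
transitivity ((\int[leb]_x cauchy x) * (\int[leb]_x cauchy x)).
  exact: (Rintegral_tensor (@integrable_cauchy R) (@integrable_cauchy R)).
by rewrite /Rintegral integral_cauchy expr2.
Qed.

Lemma cos_lip (x y : R) : `|cos x - cos y| <= `|x - y|.
Proof.
wlog xy : x y / x < y.
  move=> H; have [/H//|yx|->] := ltgtP x y; last by rewrite !subrr.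
  by rewrite distrC [leRHS]distrC; exact: H.
rewrite distrC [leRHS]distrC.
have [z _ ->] := @MVT R cos (fun x => - sin x) x y xy (fun z _ => is_derive_cos z)
  (continuous_subspaceT (@continuous_cos R)).
by rewrite normrM normrN ler_piMl// norm_sin_le1.
Qed.

Lemma sin_lip (x y : R) : `|sin x - sin y| <= `|x - y|.
Proof.
wlog xy : x y / x < y.
  move=> H; have [/H//|yx|->] := ltgtP x y; last by rewrite !subrr.
  by rewrite distrC [leRHS]distrC; exact: H.
rewrite distrC [leRHS]distrC.
have [z _ ->] := @MVT R sin (fun x => cos x) x y xy (fun z _ => is_derive_sin z)
  (continuous_subspaceT (@continuous_sin R)).
by rewrite normrM ler_piMl// norm_cos_le1.
Qed.

Variables (c : R * R) (r : R).

Lemma box_norm y : box c r y -> `|y.1| <= `|c.1| + `|c.2| + r /\ `|y.2| <= `|c.1| + `|c.2| + r.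
Proof.
move=> /boxP[y1 y2]; split.
- have : `|y.1| <= `|y.1 - c.1| + `|c.1| by rewrite -[leLHS](congr1 Num.norm (subrK c.1 y.1)) ler_normD.
  by have := normr_ge0 c.2; lra.
- have : `|y.2| <= `|y.2 - c.2| + `|c.2| by rewrite -[leLHS](congr1 Num.norm (subrK c.2 y.2)) ler_normD.
  by have := normr_ge0 c.1; lra.
Qed.

(** On the support x is bounded by [B], so the phase x.xi is Lipschitz in xi. The 1 added to the
    constant only makes it positive. *)
Lemma trigT_lip (tg : R -> R) f : continuous tg -> (forall x y, `|tg x - tg y| <= `|x - y|) ->
  csupp c r f -> exists2 K, 0 < K & forall xi eta : R * R,
   `|\int[leb2]_x (f x * tg (dot2 x xi)) - \int[leb2]_x (f x * tg (dot2 x eta))|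
     <= K * (`|xi.1 - eta.1| + `|xi.2 - eta.2|).
Proof.
move=> ctg lip sf; have [M M0 fM] := csupp_bounded sf.
have [r0 cf f0] := sf.
pose B := `|c.1| + `|c.2| + r.
have B0 : 0 <= B by rewrite !addr_ge0.
have ctgd xi : continuous (fun x : R * R => tg (dot2 x xi)).
  by move=> x; apply: continuous_comp; [exact: continuous_dot2|exact: ctg].
have sp xi : csupp c r (fun x => f x * tg (dot2 x xi)) by exact: (csuppM sf (ctgd xi)).
exists ((M * B) * (2 * r) ^+ 2 + 1); first by rewrite ltr_wpDl// mulr_ge0 ?sqr_ge0// mulr_ge0.
move=> xi eta; rewrite -RintegralB//; [|exact: csupp_integrable (sp _)|exact: csupp_integrable (sp _)].
set D := `|xi.1 - eta.1| + `|xi.2 - eta.2|.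
have D0 : 0 <= D by rewrite addr_ge0.
apply: (@le_trans _ _ ((M * B * D) * (2 * r) ^+ 2)); last first.
  have -> : (M * B * (2 * r) ^+ 2 + 1) * D = M * B * D * (2 * r) ^+ 2 + D by ring.
  by rewrite lerDl.
apply: csupp_integral_le; first exact: (csuppB (sp xi) (sp eta)).
move=> x; rewrite -mulrBr normrM.
have [xb|/f0 ->] := pselect (box c r x); last by rewrite normr0 mul0r !mulr_ge0.
rewrite -mulrA ler_pM// (le_trans (lip _ _))//.
have [b1 b2] := box_norm xb.
rewrite (_ : dot2 x xi - dot2 x eta = x.1 * (xi.1 - eta.1) + x.2 * (xi.2 - eta.2)); last first.
  by rewrite /dot2; ring.
by rewrite (le_trans (ler_normD _ _))// !normrM /D mulrDr lerD// ler_wpM2r.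
Qed.

Lemma lip_continuous (F : R * R -> R) K : 0 < K ->
  (forall xi eta, `|F xi - F eta| <= K * (`|xi.1 - eta.1| + `|xi.2 - eta.2|)) -> continuous F.
Proof.
move=> K0 H xi; apply/cvgrPdist_lt => e e0.
have d0 : 0 < e / (2 * K + 1) by rewrite divr_gt0// ltr_wpDl// mulr_ge0// ltW.
near=> eta.
have : ball xi (e / (2 * K + 1)) eta by near: eta; apply: (nbhsx_ballx xi _ d0).
move=> [/= b1 b2]; rewrite /ball/= in b1 b2.
apply: (le_lt_trans (H _ _)).
apply: (@le_lt_trans _ _ (K * (2 * (e / (2 * K + 1))))).
  by rewrite ler_pM2l//; lra.
have q0 : 0 < 2 * K + 1 by lra.
have -> : K * (2 * (e / (2 * K + 1))) = (2 * K * e) / (2 * K + 1) by ring.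
by rewrite ltr_pdivrMr//; lra.
Unshelve. all: by end_near. Qed.

Lemma continuous_cosT f : csupp c r f -> continuous (cosT f).
Proof.
move=> sf; have [K K0 H] := trigT_lip (@continuous_cos R) cos_lip sf.
exact: lip_continuous K0 H.
Qed.

Lemma continuous_sinT f : csupp c r f -> continuous (sinT f).
Proof.
move=> sf; have [K K0 H] := trigT_lip (@continuous_sin R) sin_lip sf.
exact: lip_continuous K0 H.
Qed.

(* (1 - d_i^2) multiplies the Fourier transform by 1 + xi_i^2; applied in both
   variables it gives a decay against the integrable function [cauchy2]. *)
Definition onemD2 (i : 'I_2) (f : R * R -> R) : R * R -> R :=
  f \- partial i (partial i f).

Lemma smooth_partial i f : smooth f -> smooth (@partial R i f).
Proof. by move=> sf; exact: smooth_deriv. Qed.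

Lemma csupp_partial i f : smooth f -> csupp c r f -> csupp c r (partial i f).
Proof. by move=> sf sp; exact: csupp_deriv. Qed.

Lemma smooth_onemD2 i f : smooth f -> smooth (onemD2 i f).
Proof. by move=> sf; apply: smoothB => //; do 2 apply: smooth_partial. Qed.

Lemma csupp_onemD2 i f : smooth f -> csupp c r f -> csupp c r (onemD2 i f).
Proof.
move=> sf sp; apply: csuppB => //; apply: csupp_partial; first exact: smooth_partial.
exact: csupp_partial.
Qed.

Lemma cosT_onemD2 i f xi : smooth f -> csupp c r f ->
  cosT (onemD2 i f) xi = (1 + coord2 i xi ^+ 2) * cosT f xi.
Proof.
move=> sf sp; have s1 := smooth_partial i sf; have p1 := csupp_partial i sf sp.
rewrite (cosTB _ sp (csupp_partial i s1 p1)) (cosT_partial _ _ s1 p1) (sinT_partial _ _ sf sp).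
by ring.
Qed.

Lemma sinT_onemD2 i f xi : smooth f -> csupp c r f ->
  sinT (onemD2 i f) xi = (1 + coord2 i xi ^+ 2) * sinT f xi.
Proof.
move=> sf sp; have s1 := smooth_partial i sf; have p1 := csupp_partial i sf sp.
rewrite (sinTB _ sp (csupp_partial i s1 p1)) (sinT_partial _ _ s1 p1) (cosT_partial _ _ sf sp).
by ring.
Qed.

Lemma coord2_0 (x : R * R) : coord2 0 x = x.1. Proof. by []. Qed.

Lemma coord2_1 (x : R * R) : coord2 1 x = x.2. Proof. by []. Qed.

Lemma fourier_decay f M : smooth f -> csupp c r f ->
  (forall x, `|onemD2 0 (onemD2 1 f) x| <= M) ->
  forall xi, `|cosT f xi| <= M * (2 * r) ^+ 2 * cauchy2 xi /\
             `|sinT f xi| <= M * (2 * r) ^+ 2 * cauchy2 xi.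
Proof.
move=> sf sp fM xi.
have s1 := smooth_onemD2 1 sf; have p1 := csupp_onemD2 1 sf sp.
have p2 := csupp_onemD2 0 s1 p1.
have q1 : 0 < 1 + xi.1 ^+ 2 by rewrite ltr_pwDl// sqr_ge0.
have q2 : 0 < 1 + xi.2 ^+ 2 by rewrite ltr_pwDl// sqr_ge0.
have q0 : 0 < (1 + xi.1 ^+ 2) * (1 + xi.2 ^+ 2) by rewrite mulr_gt0.
have E : cauchy2 xi = ((1 + xi.1 ^+ 2) * (1 + xi.2 ^+ 2))^-1 by rewrite invfM.
split; rewrite E ler_pdivlMr// -{1}(gtr0_norm q0) -normrM.
- have := cosT_le xi p2 fM.
  by rewrite (cosT_onemD2 _ _ s1 p1) (cosT_onemD2 _ _ sf sp) coord2_0 coord2_1 mulrA mulrC.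
- have := sinT_le xi p2 fM.
  by rewrite (sinT_onemD2 _ _ s1 p1) (sinT_onemD2 _ _ sf sp) coord2_0 coord2_1 mulrA mulrC.
Qed.

Lemma integrable_le_cauchy2 (F : R * R -> R) K : continuous F ->
  (forall xi, `|F xi| <= K * cauchy2 xi) -> leb2.-integrable setT (EFin \o F).
Proof.
move=> cF FK.
have I := integrableZl measurableT K integrable_cauchy2.
apply: le_integrable I => //.
  by apply/measurable_EFinP; exact: (continuous_measurable_plane cF).
move=> x _ /=; rewrite lee_fin (le_trans (FK x))// ler_norm//.
Qed.

End Fourier_decay.

(** * The inversion formula by damping *)

Section Fourier_inversion.
Context {R : realType}.
Local Notation mR := (measurableTypeR R).
Local Notation P2 := (measurableTypeR R * measurableTypeR R)%type.
Local Notation leb2 := (@lebesgue2 R).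
Local Notation leb := (@lebesgue_measure R).

(** A second name for [lebesgue2], to which the sigma-finite structure is attached; Fubini between
    the frequency plane and the space plane relies on it. *)
Definition lebesgue2_fun : set P2 -> \bar R := (leb \x leb)%E.

HB.instance Definition _ := Measure.on lebesgue2_fun.

Lemma lebesgue2_sigma_finite : sigma_finite setT lebesgue2_fun.
Proof.
exists (fun n => box (0 : R * R) n%:R).
  rewrite eqEsubset; split => // y _; exists (Num.truncn (`|y.1| + `|y.2|)).+1 => //.
  apply/boxP; rewrite !subr0.
  have h : `|y.1| + `|y.2| < (Num.truncn (`|y.1| + `|y.2|)).+1%:R.
    by rewrite truncnS_gt.
  by split; rewrite ltW// (le_lt_trans _ h)// ?lerDl ?lerDr.
move=> n; split; first exact: measurable_box.
have -> : lebesgue2_fun (box 0 n%:R) = leb2 (box 0 n%:R) by [].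
by rewrite lebesgue2_box// ltry.
Qed.

HB.instance Definition _ := Measure_isSigmaFinite.Build _ _ _ lebesgue2_fun
  lebesgue2_sigma_finite.

Definition lebesgue2_sf : {sigma_finite_measure set P2 -> \bar R} := lebesgue2_fun.

(* Damping by exp (- e (|xi_0| + |xi_1|)) makes Fubini applicable in the inversion
   formula, and turns it into convolution with a product of Poisson kernels. *)
Definition eabs2 (e : R) (xi : R * R) : R := eabs e xi.1 * eabs e xi.2.

Definition poisson (e z : R) : R := 2 * e / (e ^+ 2 + z ^+ 2).

Lemma integrable_eabs2 e : 0 < e -> leb2.-integrable setT (EFin \o eabs2 e).
Proof. by move=> e0; exact: (integrable_tensor (integrable_eabs e0) (integrable_eabs e0)). Qed.

Lemma eabs2_ge0 e xi : 0 <= eabs2 e xi.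
Proof. by rewrite mulr_ge0// eabs_ge0. Qed.

Lemma continuous_eabs2 e : continuous (eabs2 e).
Proof.
move=> xi; apply: cvgM.
  by apply: (@continuous_comp _ _ _ fst (eabs e)); [exact: cvg_fst|exact: continuous_eabs].
by apply: (@continuous_comp _ _ _ snd (eabs e)); [exact: cvg_snd|exact: continuous_eabs].
Qed.

Lemma integral_eabs2_cos e (z : R * R) : 0 < e ->
  leb2.-integrable setT (EFin \o (fun xi => eabs2 e xi * cos (dot2 z xi))) /\
  \int[leb2]_xi (eabs2 e xi * cos (dot2 z xi)) = poisson e z.1 * poisson e z.2.
Proof.
move=> e0.
have Ic t : leb.-integrable setT (EFin \o (fun x => eabs e x * cos (t * x))).
  apply: integrable_eabsM => //; first exact: continuous_scale_cos.
  by move=> x; exact: norm_cos_le1.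
have Is t : leb.-integrable setT (EFin \o (fun x => eabs e x * sin (t * x))).
  apply: integrable_eabsM => //; first exact: continuous_scale_sin.
  by move=> x; exact: norm_sin_le1.
have Icc := integrable_tensor (Ic z.1) (Ic z.2).
have Iss := integrable_tensor (Is z.1) (Is z.2).
have E : (fun xi => eabs2 e xi * cos (dot2 z xi)) =
  (fun xi : P2 => eabs e xi.1 * cos (z.1 * xi.1) * (eabs e xi.2 * cos (z.2 * xi.2))
     - eabs e xi.1 * sin (z.1 * xi.1) * (eabs e xi.2 * sin (z.2 * xi.2))).
  by apply/funext => xi; rewrite /dot2 cosD /eabs2; ring.
split; first by rewrite E; exact: (integrableB measurableT Icc Iss).
rewrite E.
transitivity ((\int[leb]_x (eabs e x * cos (z.1 * x))) * (\int[leb]_x (eabs e x * cos (z.2 * x)))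
   - (\int[leb]_x (eabs e x * sin (z.1 * x))) * (\int[leb]_x (eabs e x * sin (z.2 * x)))).
  rewrite -(Rintegral_tensor (Ic z.1) (Ic z.2)) -(Rintegral_tensor (Is z.1) (Is z.2)).
  exact: (RintegralB measurableT Icc Iss).
by rewrite !integral_eabs_cos// !integral_eabs_sin// mulr0 subr0.
Qed.

Lemma continuous_cos_sub (x xi : R * R) : continuous (fun y : R * R => cos (dot2 (x - y) xi) : R).
Proof.
move=> y.
apply: (@continuous_comp _ _ _ (fun y : R * R => dot2 (x - y) xi) (@cos R)); last exact: continuous_cos.
apply: (@continuous_comp _ _ _ (fun y : R * R => x - y) (fun y => dot2 y xi)); last exact: continuous_dot2.
by apply: cvgB; [exact: cvg_cst|exact: cvg_id].
Qed.

Variables (c : R * R) (r : R) (f : R * R -> R).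
Hypotheses (sf : smooth f) (sp : csupp c r f).

(** The real part of e^(i x.xi) times the Fourier transform of f. *)
Definition inv_integrand (x xi : R * R) : R :=
  cos (dot2 x xi) * cosT f xi + sin (dot2 x xi) * sinT f xi.

Lemma inv_integrandE x xi :
  inv_integrand x xi = \int[leb2]_y (f y * cos (dot2 (x - y) xi)).
Proof.
rewrite /inv_integrand /cosT /sinT.
rewrite -RintegralZl//; last exact: csupp_integrable (csupp_cos xi sp).
rewrite -RintegralZl//; last exact: csupp_integrable (csupp_sin xi sp).
rewrite -RintegralD//; last 2 first.
- exact: csupp_integrable (csuppZ (cos (dot2 x xi)) (csupp_cos xi sp)).
- exact: csupp_integrable (csuppZ (sin (dot2 x xi)) (csupp_sin xi sp)).
apply: eq_Rintegral => y _.
have -> : dot2 (x - y) xi = dot2 x xi - dot2 y xi.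
  by case: x y => [x1 x2] [y1 y2]; rewrite /dot2 /=; ring.
by rewrite cosB; ring.
Qed.

Lemma continuous_inv_integrand x : continuous (inv_integrand x).
Proof.
have cd : continuous (fun xi => dot2 x xi).
  move=> xi; apply: cvgD; apply: cvgM; try exact: cvg_cst; [exact: cvg_fst|exact: cvg_snd].
move=> xi; apply: cvgD; apply: cvgM.
- by apply: (@continuous_comp _ _ _ (dot2 x) (@cos R)); [exact: cd|exact: continuous_cos].
- exact: (continuous_cosT sp).
- by apply: (@continuous_comp _ _ _ (dot2 x) (@sin R)); [exact: cd|exact: continuous_sin].
- exact: (continuous_sinT sp).
Qed.

Lemma inv_integrand_le x : exists K, forall xi, `|inv_integrand x xi| <= K * cauchy2 xi.
Proof.
have s1 := smooth_onemD2 1 sf; have p1 := csupp_onemD2 1 sf sp.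
have [M M0 HM] := csupp_bounded (csupp_onemD2 0 s1 p1).
exists (2 * (M * (2 * r) ^+ 2)) => xi.
have [h1 h2] := fourier_decay sf sp HM xi.
have -> : 2 * (M * (2 * r) ^+ 2) * cauchy2 xi =
  M * (2 * r) ^+ 2 * cauchy2 xi + M * (2 * r) ^+ 2 * cauchy2 xi by ring.
rewrite (le_trans (ler_normD _ _))// !normrM lerD//.
- by rewrite (le_trans _ h1)// ler_piMl// norm_cos_le1.
- by rewrite (le_trans _ h2)// ler_piMl// norm_sin_le1.
Qed.

(** Fubini for the function [F] of the pair (xi, y), dominated by the product of [eabs2 e] and f.
    Integrating first in xi produces the Poisson kernels. *)
Lemma dampened_inversion e x : 0 < e ->
  \int[leb2]_xi (eabs2 e xi * inv_integrand x xi) =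
  \int[leb2]_y (f y * (poisson e (x.1 - y.1) * poisson e (x.2 - y.2))).
Proof.
move=> e0.
pose F (z : P2 * P2) : R := eabs2 e z.1 * f z.2 * cos (dot2 (x - z.2) z.1).
have If := csupp_integrable sp.
have mF : measurable_fun [set: P2 * P2] F.
  apply: measurable_funM; first apply: measurable_funM.
  - apply: (@measurableT_comp _ _ _ _ _ _ (eabs2 e : P2 -> mR)); last exact: measurable_fst.
    exact: continuous_measurable_plane (@continuous_eabs2 e).
  - apply: (@measurableT_comp _ _ _ _ _ _ (f : P2 -> mR)); last exact: measurable_snd.
    by case: sp => _ cf _; exact: continuous_measurable_plane cf.
  - apply: (@measurableT_comp _ _ _ _ _ _ (@cos R : mR -> mR)).
      by apply: continuous_measurable_fun; exact: continuous_cos.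
    rewrite (_ : (fun _ => _) = (fun z : P2 * P2 => (x.1 - z.2.1) * z.1.1 + (x.2 - z.2.2) * z.1.2)); last first.
      by apply/funext => -[z1 [y1 y2]]; case: (x).
    have m1 : measurable_fun [set: P2] (fst : P2 -> mR) := measurable_fst.
    have m2 : measurable_fun [set: P2] (snd : P2 -> mR) := measurable_snd.
    have M1 : measurable_fun [set: P2 * P2] (fst : P2 * P2 -> P2) := measurable_fst.
    have M2 : measurable_fun [set: P2 * P2] (snd : P2 * P2 -> P2) := measurable_snd.
    apply: measurable_funD; apply: measurable_funM.
    + by apply: measurable_funB => //; exact: (measurableT_comp m1 M2).
    + exact: (measurableT_comp m1 M1).
    + by apply: measurable_funB => //; exact: (measurableT_comp m2 M2).
    + exact: (measurableT_comp m2 M1).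
have Ie : lebesgue2_sf.-integrable setT (EFin \o eabs2 e) := integrable_eabs2 e0.
have If' : lebesgue2_sf.-integrable setT (EFin \o f) := If.
have IF : (lebesgue2_sf \x lebesgue2_sf)%E.-integrable setT (EFin \o F).
  have IT := integrable_tensor Ie If'.
  apply: le_integrable IT => //.
    exact/measurable_EFinP.
  by move=> z _ /=; rewrite lee_fin /F normrM ler_piMr// norm_cos_le1.
have := Fubini IF.
have -> : (\int[lebesgue2_sf]_xi \int[lebesgue2_sf]_y (EFin \o F) (xi, y) =
           \int[leb2]_xi (eabs2 e xi * inv_integrand x xi)%:E)%E.
  apply: eq_integral => xi _ /=.
  have sy : csupp c r (fun y => f y * cos (dot2 (x - y) xi)).
    exact: (csuppM sp (@continuous_cos_sub x xi)).
  rewrite inv_integrandE -RintegralZl//; last exact: csupp_integrable sy.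
  rewrite -Rintegral_EFin; last exact: csupp_integrable (csuppZ _ sy).
  by apply: eq_integral => y _; rewrite /F /= mulrA.
have -> : (\int[lebesgue2_sf]_y \int[lebesgue2_sf]_xi (EFin \o F) (xi, y) =
           \int[leb2]_y (f y * (poisson e (x.1 - y.1) * poisson e (x.2 - y.2)))%:E)%E.
  apply: eq_integral => y _ /=.
  have [Ic Ec] := @integral_eabs2_cos e (x - y) e0.
  transitivity (\int[leb2]_xi ((f y)%:E * (eabs2 e xi * cos (dot2 (x - y) xi))%:E))%E.
    by apply: eq_integral => xi _; rewrite /F -EFinM /= mulrA (mulrC (f y)).
  by rewrite integralZl// (Rintegral_EFin Ic) Ec.
by move=> E; rewrite /Rintegral E.
Qed.

(** The substitution y = x + e w: each Poisson kernel becomes (2 / e) times a Cauchy density, and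
    the Jacobian e^2 removes e from the weight. *)
Lemma poisson_scaled e x : 0 < e ->
  \int[leb2]_y (f y * (poisson e (x.1 - y.1) * poisson e (x.2 - y.2))) =
  \int[leb2]_w (4 * cauchy2 w * f (e * w.1 + x.1, e * w.2 + x.2)).
Proof.
move=> e0; have en0 : e != 0 by rewrite gt_eqF.
have [r0 cf f0] := sp.
pose G w := f (e * w.1 + x.1, e * w.2 + x.2) * (poisson e (e * w.1) * poisson e (e * w.2)).
have GE : rescale x e G = (fun y => f y * (poisson e (x.1 - y.1) * poisson e (x.2 - y.2))).
  apply/funext => -[y1 y2]; rewrite /rescale /rescale_pt /G /= !mulVKf// !subrK.
  by rewrite /poisson -(sqrrN (y1 - _)) -(sqrrN (y2 - _)) !opprB.
have cpo : continuous (poisson e).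
  move=> z; apply: cvgM; first exact: cvg_cst.
  apply: cvgV; first by rewrite gt_eqF// ltr_pwDl ?exprn_gt0// sqr_ge0.
  apply: cvgD; first exact: cvg_cst.
  exact: exprn_continuous.
have cfst : continuous (fun w : R * R => e * w.1).
  by move=> w; apply: (@cvgM _ _ _ _ (cst e)); [exact: cvg_cst|exact: cvg_fst].
have csnd : continuous (fun w : R * R => e * w.2).
  by move=> w; apply: (@cvgM _ _ _ _ (cst e)); [exact: cvg_cst|exact: cvg_snd].
have cpG : continuous (fun w : R * R => poisson e (e * w.1) * poisson e (e * w.2)).
  move=> w; apply: cvgM.
    by apply: (@continuous_comp _ _ _ (fun w : R * R => e * w.1)); [exact: cfst|exact: cpo].
  by apply: (@continuous_comp _ _ _ (fun w : R * R => e * w.2)); [exact: csnd|exact: cpo].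
have cL : continuous (fun w : R * R => (e * w.1 + x.1, e * w.2 + x.2)).
  apply: continuous_pair => w.
    by apply: cvgD; [exact: cfst|exact: cvg_cst].
  by apply: cvgD; [exact: csnd|exact: cvg_cst].
have sG : csupp (rescale_pt x e c) (e^-1 * r) G.
  apply: csuppM => //; split; first by rewrite mulr_ge0// invr_ge0 ltW.
    by move=> w; apply: (continuous_comp (cL w)); exact: cf.
  move=> y yc; apply: f0 => /boxP[/= h1 h2]; apply: yc; apply/boxP => /=; split.
    rewrite ler_pdivlMl// -{1}(gtr0_norm e0) -normrM mulrBr mulVKf//.
    by rewrite (_ : _ - _ = e * y.1 + x.1 - c.1)//; ring.
  rewrite ler_pdivlMl// -{1}(gtr0_norm e0) -normrM mulrBr mulVKf//.
  by rewrite (_ : _ - _ = e * y.2 + x.2 - c.2)//; ring.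
have sGr : csupp c r (rescale x e G).
  rewrite GE; apply: (csuppM sp) => y.
  apply: cvgM.
    apply: (@continuous_comp _ _ _ (fun y : R * R => x.1 - y.1)); last exact: cpo.
    by apply: cvgB; [exact: cvg_cst|exact: cvg_fst].
  apply: (@continuous_comp _ _ _ (fun y : R * R => x.2 - y.2)); last exact: cpo.
  by apply: cvgB; [exact: cvg_cst|exact: cvg_snd].
rewrite -GE (integral_rescale e0 sG sGr) -RintegralZl//; last exact: csupp_integrable sG.
apply: eq_Rintegral => w _; rewrite /G /poisson /cauchy2 /cauchy.
have q1 : 1 + w.1 ^+ 2 != 0 by rewrite gt_eqF// ltr_pwDl// sqr_ge0.
have q2 : 1 + w.2 ^+ 2 != 0 by rewrite gt_eqF// ltr_pwDl// sqr_ge0.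
have -> : e ^+ 2 + (e * w.1) ^+ 2 = e ^+ 2 * (1 + w.1 ^+ 2) by ring.
have -> : e ^+ 2 + (e * w.2) ^+ 2 = e ^+ 2 * (1 + w.2 ^+ 2) by ring.
by field; rewrite q1 q2 en0.
Qed.

Lemma dominated_cvgR (F : (R * R -> R)^nat) (F0 G : R * R -> R) :
  (forall n, continuous (F n)) -> leb2.-integrable setT (EFin \o F0) ->
  (forall x, F n x @[n --> \oo] --> F0 x) ->
  leb2.-integrable setT (EFin \o G) -> (forall n x, `|F n x| <= G x) ->
  \int[leb2]_x F n x @[n --> \oo] --> \int[leb2]_x F0 x.
Proof.
move=> cF IF0 FF0 IG FG.
have mF n : measurable_fun [set: P2] (EFin \o F n).
  by apply/measurable_EFinP; exact: (continuous_measurable_plane (cF n)).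
have IF n : leb2.-integrable setT (EFin \o F n).
  apply: le_integrable IG => // x _ /=.
  by rewrite lee_fin (le_trans (FG n x))// ler_norm.
have H : (\int[leb2]_x (F n x)%:E @[n --> \oo] --> \int[leb2]_x (F0 x)%:E)%E.
  apply: (dominated_cvg measurableT mF) IG _ => //.
  - by move=> x _; apply: cvg_EFin; [near=> n|exact: FF0].
  - by move=> n x _ /=; rewrite lee_fin.
by move: H; rewrite (Rintegral_EFin IF0) => /fine_cvg.
Unshelve. all: by end_near. Qed.

Lemma fourier_inversion x :
  \int[leb2]_xi inv_integrand x xi = (2 * pi) ^+ 2 * f x.
Proof.
pose e (n : nat) : R := n.+1%:R^-1.
have e0 n : 0 < e n by rewrite invr_gt0.
have e_cvg : e n @[n --> \oo] --> (0 : R) by exact: cvg_harmonic.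
have [K HK] := inv_integrand_le x.
have II := integrable_le_cauchy2 (@continuous_inv_integrand x) HK.
have [r0 cf f0] := sp.
have [M M0 fM] := csupp_bounded sp.
(* The damping factor tends to 1 and is at most 1, so the undamped modulus dominates. *)
have L1 : \int[leb2]_xi (eabs2 (e n) xi * inv_integrand x xi) @[n --> \oo] -->
    \int[leb2]_xi inv_integrand x xi.
  apply: (@dominated_cvgR _ _ (fun xi => `|inv_integrand x xi|)) => //.
  - by move=> n xi; apply: cvgM; [exact: continuous_eabs2|exact: continuous_inv_integrand].
  - move=> xi; rewrite -[X in _ --> X]mul1r; apply: cvgM; last exact: cvg_cst.
    have ce t : eabs (e n) t @[n --> \oo] --> (1 : R).
      have H : - e n * `|t| @[n --> \oo] --> - 0 * `|t|.
        by apply: cvgM; [exact: cvgN|exact: cvg_cst].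
      rewrite oppr0 mul0r in H; rewrite -expR0.
      exact: (cvg_comp _ _ H (@continuous_expR R 0)).
    have H : eabs (e n) xi.1 * eabs (e n) xi.2 @[n --> \oo] --> (1 * 1 : R).
      by apply: cvgM; exact: ce.
    by rewrite mulr1 in H.
  - exact: integrable_norm II.
  - move=> n xi; rewrite normrM ger0_norm ?eabs2_ge0// ler_piMl//.
    rewrite /eabs2 mulr_ile1 ?eabs_ge0// /eabs -expR0 ler_expR mulNr oppr_le0 mulr_ge0//; exact: ltW.
(* The weight [4 * cauchy2] has mass 4 pi^2, which is the constant of the formula; boundedness of f
   gives the domination. *)
have L2 : \int[leb2]_w (4 * cauchy2 w * f (e n * w.1 + x.1, e n * w.2 + x.2)) @[n --> \oo] -->
    \int[leb2]_w (4 * cauchy2 w * f x).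
  have Ic k : leb2.-integrable setT (EFin \o (fun w : P2 => k * cauchy2 w)).
    exact: (integrableZl measurableT k (@integrable_cauchy2 R)).
  have cc2 : continuous (@cauchy2 R).
    move=> w; apply: cvgM.
      by apply: (@continuous_comp _ _ _ fst); [exact: cvg_fst|exact: continuous_cauchy].
    by apply: (@continuous_comp _ _ _ snd); [exact: cvg_snd|exact: continuous_cauchy].
  apply: (@dominated_cvgR _ _ (fun w => (4 * M) * cauchy2 w)).
  - move=> n w; apply: cvgM; first by apply: cvgM; [exact: cvg_cst|exact: cc2].
    apply: (@continuous_comp _ _ _ (fun w : R * R => (e n * w.1 + x.1, e n * w.2 + x.2)) f); last exact: cf.
    apply: continuous_pair => {}w; apply: cvgD; try exact: cvg_cst.
      by apply: (@cvgM _ _ _ _ (cst (e n))); [exact: cvg_cst|exact: cvg_fst].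
    by apply: (@cvgM _ _ _ _ (cst (e n))); [exact: cvg_cst|exact: cvg_snd].
  - rewrite (_ : _ \o _ = EFin \o (fun w => (4 * f x) * cauchy2 w)); first exact: Ic.
    by apply/funext => w /=; rewrite mulrAC.
  - move=> w; apply: cvgM; first exact: cvg_cst.
    have h (a b : R) : e n * a + b @[n --> \oo] --> b.
      have H : e n * a + b @[n --> \oo] --> 0 * a + b.
        by apply: cvgD; [apply: cvgM; [exact: e_cvg|exact: cvg_cst]|exact: cvg_cst].
      by rewrite mul0r add0r in H.
    apply: (@cvg_comp _ _ _ (fun n => (e n * w.1 + x.1, e n * w.2 + x.2)) f _ (nbhs x)); last exact: cf.
    by case: (x) => x1 x2; exact: (cvg_pair (h _ _) (h _ _)).
  - exact: Ic.
  - move=> n w; rewrite normrM normrM (gtr0_norm (cauchy2_gt0 w)) ger0_norm// mulrAC.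
    by rewrite ler_pM2r ?cauchy2_gt0// ler_pM2l.
have E n : \int[leb2]_xi (eabs2 (e n) xi * inv_integrand x xi) =
  \int[leb2]_w (4 * cauchy2 w * f (e n * w.1 + x.1, e n * w.2 + x.2)).
  by rewrite dampened_inversion// poisson_scaled.
rewrite (funext E) in L1; rewrite (cvg_unique _ L1 L2)//.
transitivity (\int[leb2]_w (4 * f x * cauchy2 w)).
  by apply: eq_Rintegral => w _; rewrite mulrAC.
rewrite RintegralZl//; last exact: integrable_cauchy2.
by rewrite Rintegral_cauchy2; ring.
Qed.

End Fourier_inversion.

(** * The pressure multiplier *)

Section Pressure_multiplier.
Context {R : realType}.
Local Notation mR := (measurableTypeR R).
Local Notation P2 := (measurableTypeR R * measurableTypeR R)%type.
Local Notation leb2 := (@lebesgue2 R).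
Implicit Types (k i j : 'I_2) (x xi : R * R).

Lemma ord2_cases i : i = 0 \/ i = 1.
Proof. by case: i => -[|[|//]] ?; [left|right]; exact: val_inj. Qed.

(** The operator that [multiplier_pairing] applies to the test function, hence the reflected
    symbol. *)
Definition pressure_op k i j (psi : R * R -> R) (x : R * R) : R :=
  fourier_multiplier (fun xi => pressure_symbol k i j (- xi)) psi x.

Definition cubic_ratio k i j xi : R :=
  coord2 k xi * coord2 i xi * coord2 j xi * (dot2 xi xi)^-1.

(** Two signs cancel: i^3 = -i, and a cubic numerator is odd. The symbol is purely imaginary, so the
    operator exchanges the cosine and sine transforms. *)
Lemma pressure_symbolN k i j xi :
  pressure_symbol k i j (- xi) = (0 +i* cubic_ratio k i j xi)%C.
Proof.
have cN l : coord2 l (- xi) = - coord2 l xi by rewrite /coord2; case: ifP.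
have dN : dot2 (- xi) (- xi) = dot2 xi xi.
  by rewrite /dot2 /=; ring.
rewrite /pressure_symbol dN /partial_symbol !cN -fmorphV.
by rewrite /cubic_ratio; simpc; congr (_ +i* _)%C; ring.
Qed.

Definition pressure_integrand k i j psi x xi : R :=
  cubic_ratio k i j xi * (cos (dot2 x xi) * sinT psi xi - sin (dot2 x xi) * cosT psi xi).

Lemma pressure_opE k i j psi x :
  pressure_op k i j psi x =
  ((2 * pi) ^+ 2)^-1 * \int[leb2]_xi pressure_integrand k i j psi x xi.
Proof.
rewrite /pressure_op /fourier_multiplier; congr (_ * _).
apply: eq_Rintegral => xi _.
rewrite pressure_symbolN /expi /fourier -/(cosT psi xi) -/(sinT psi xi).
by simpc; rewrite /= /pressure_integrand; ring.
Qed.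

Lemma dot2_ge0 xi : 0 <= dot2 xi xi.
Proof. by rewrite /dot2 -!expr2 addr_ge0 ?sqr_ge0. Qed.

Lemma coord2_sq_le i xi : coord2 i xi ^+ 2 <= dot2 xi xi.
Proof.
by rewrite /dot2 -!expr2 /coord2; case: ifP => _; rewrite ?lerDl ?lerDr sqr_ge0.
Qed.

Lemma cubic_ratio_le k i j xi : `|cubic_ratio k i j xi| <= `|coord2 k xi|.
Proof.
rewrite /cubic_ratio -!mulrA normrM ler_piMr//.
have [->|d0] := eqVneq (dot2 xi xi) 0; first by rewrite invr0 !mulr0 normr0.
have d_gt0 : 0 < dot2 xi xi by rewrite lt0r d0 dot2_ge0.
rewrite mulrA normrM (gtr0_norm (x := _^-1)) ?invr_gt0// ler_pdivrMr// mul1r.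
have hi := coord2_sq_le i xi; have hj := coord2_sq_le j xi.
rewrite -(ler_pXn2r (n := 2)) ?nnegrE ?dot2_ge0// real_normK ?num_real//.
by rewrite exprMn [leRHS]expr2 ler_pM// sqr_ge0.
Qed.

Lemma continuous_coord2 i : continuous (@coord2 R i).
Proof.
move=> x; rewrite /coord2; case: (i == ord0); [exact: cvg_fst|exact: cvg_snd].
Qed.

Lemma measurable_cubic_ratio k i j : measurable_fun [set: P2] (cubic_ratio k i j : P2 -> mR).
Proof.
have mc l : measurable_fun [set: P2] (coord2 l : P2 -> mR).
  exact: continuous_measurable_plane (@continuous_coord2 l).
have cd : continuous (fun xi : R * R => dot2 xi xi).
  move=> xi; apply: cvgD; apply: cvgM; try exact: cvg_fst; exact: cvg_snd.
apply: measurable_funM; first by apply: measurable_funM; [apply: measurable_funM|]; exact: mc.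
(* The inverse is not continuous at 0; as a real power it is measurable. *)
rewrite (_ : (fun _ => _) = (fun x : R => x `^ (-1)) \o (fun xi => dot2 xi xi)); last first.
  by apply/funext => xi /=; rewrite powR_inv1// dot2_ge0.
apply: (@measurableT_comp _ _ _ _ _ _ (fun x : mR => x `^ (-1))).
  exact: measurable_powR.
exact: continuous_measurable_plane cd.
Qed.

Section One_function.
Variables (c : R * R) (r : R) (psi : R * R -> R).
Hypotheses (sp : smooth psi) (cp : csupp c r psi).

Lemma measurable_pressure_integrand k i j x :
  measurable_fun [set: P2] (pressure_integrand k i j psi x : P2 -> mR).
Proof.
apply: measurable_funM; first exact: measurable_cubic_ratio.
have cd : continuous (fun xi => dot2 x xi).
  move=> xi; apply: cvgD; apply: cvgM; try exact: cvg_cst; [exact: cvg_fst|exact: cvg_snd].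
apply: continuous_measurable_plane => xi; apply: cvgB; apply: cvgM.
- by apply: (@continuous_comp _ _ _ (dot2 x) (@cos R)); [exact: cd|exact: continuous_cos].
- exact: (continuous_sinT cp).
- by apply: (@continuous_comp _ _ _ (dot2 x) (@sin R)); [exact: cd|exact: continuous_sin].
- exact: (continuous_cosT cp).
Qed.

(** The factor |xi_k| left by [cubic_ratio_le] is absorbed by a derivative: xi_k times a transform
    of psi is, up to sign, the other transform of [partial k psi]. *)
Lemma pressure_integrand_le k i j x M :
  (forall y, `|onemD2 0 (onemD2 1 (partial k psi)) y| <= M) ->
  forall xi, `|pressure_integrand k i j psi x xi| <= 2 * (M * (2 * r) ^+ 2) * cauchy2 xi.
Proof.
move=> HM xi.
have [h1 h2] := fourier_decay (smooth_partial k sp) (csupp_partial k sp cp) HM xi.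
rewrite (cosT_partial _ _ sp cp) normrM in h1.
rewrite (sinT_partial _ _ sp cp) normrM normrN in h2.
rewrite /pressure_integrand normrM; apply: (@le_trans _ _ (`|coord2 k xi| * (`|sinT psi xi| + `|cosT psi xi|))).
  rewrite ler_pM ?cubic_ratio_le//.
  rewrite (le_trans (ler_normB _ _))// !normrM lerD// ler_piMl//;
    [exact: norm_cos_le1|exact: norm_sin_le1].
have -> : 2 * (M * (2 * r) ^+ 2) * cauchy2 xi =
  M * (2 * r) ^+ 2 * cauchy2 xi + M * (2 * r) ^+ 2 * cauchy2 xi by ring.
by rewrite mulrDr lerD.
Qed.

Lemma pressure_integrand_bound k : exists2 M, 0 <= M &
  forall y, `|onemD2 0 (onemD2 1 (partial k psi)) y| <= M.
Proof.
have s0 := smooth_partial k sp; have p0 := csupp_partial k sp cp.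
have s1 := smooth_onemD2 1 s0; have p1 := csupp_onemD2 1 s0 p0.
exact: csupp_bounded (csupp_onemD2 0 s1 p1).
Qed.

Lemma integrable_pressure_integrand k i j x :
  leb2.-integrable setT (EFin \o pressure_integrand k i j psi x).
Proof.
have [M M0 HM] := pressure_integrand_bound k.
have I := integrableZl measurableT (2 * (M * (2 * r) ^+ 2)) (@integrable_cauchy2 R).
apply: le_integrable I => //.
  by apply/measurable_EFinP; exact: measurable_pressure_integrand.
move=> xi _ /=; rewrite lee_fin (le_trans (pressure_integrand_le i j x HM xi))//.
exact: ler_norm.
Qed.

Lemma pressure_op_le k i j x M :
  (forall y, `|onemD2 0 (onemD2 1 (partial k psi)) y| <= M) ->
  `|pressure_op k i j psi x| <= M * (2 * r) ^+ 2.
Proof.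
move=> HM; rewrite pressure_opE normrM.
have I := integrable_pressure_integrand k i j x.
have pi2 : 0 < (2 * pi) ^+ 2 :> R by rewrite exprn_gt0// mulr_gt0// pi_gt0.
rewrite gtr0_norm ?invr_gt0// ler_pdivrMl//.
apply: (le_trans (le_normr_Rintegral measurableT I)).
have Ic := integrableZl measurableT (2 * (M * (2 * r) ^+ 2)) (@integrable_cauchy2 R).
have H := le_Rintegral measurableT (integrable_norm I) Ic
  (fun xi _ => pressure_integrand_le i j x HM xi).
apply: (le_trans H); rewrite RintegralZl//; last exact: integrable_cauchy2.
rewrite Rintegral_cauchy2.
have M0 : 0 <= M * (2 * r) ^+ 2.
  by rewrite mulr_ge0 ?sqr_ge0// (le_trans _ (HM 0)).
(* The exact constant is (2 pi)^-2 * 2 * pi^2 = 1/2; the other half is given away. *)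
have -> : (2 * pi) ^+ 2 * (M * (2 * r) ^+ 2) = 2 * (M * (2 * r) ^+ 2) * pi ^+ 2
  + 2 * (M * (2 * r) ^+ 2) * pi ^+ 2 by ring.
by rewrite lerDl mulr_ge0 ?sqr_ge0// mulr_ge0.
Qed.

End One_function.

Lemma pressure_opB c r (f g : R * R -> R) k i j x :
  smooth f -> smooth g -> csupp c r f -> csupp c r g ->
  pressure_op k i j (f \- g) x = pressure_op k i j f x - pressure_op k i j g x.
Proof.
move=> sf sg cf cg; rewrite !pressure_opE -mulrBr -RintegralB//; last 2 first.
- exact: (integrable_pressure_integrand sf cf).
- exact: (integrable_pressure_integrand sg cg).
congr (_ * _); apply: eq_Rintegral => xi _.
by rewrite /pressure_integrand (sinTB _ cf cg) (cosTB _ cf cg); ring.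
Qed.

Definition div2 (b : 'I_2 -> R * R -> R) : R * R -> R :=
  partial 0 (b 0) \+ partial 1 (b 1).

Lemma coord2_sum xi : dot2 xi xi = coord2 0 xi ^+ 2 + coord2 1 xi ^+ 2.
Proof. by []. Qed.

(* The symbol of the operator turns div b into a local quantity, because for a
   curl-free field |xi|^2 \hat b_j = xi_j (xi . \hat b). *)
Lemma pressure_op_div c r (b : 'I_2 -> R * R -> R) k i j x :
  (forall l, smooth (b l)) -> (forall l, csupp c r (b l)) ->
  partial 0 (b 1) =1 partial 1 (b 0) ->
  pressure_op k i j (div2 b) x = partial k (partial i (b j)) x.
Proof.
move=> sb cb curl.
have sF : smooth (partial k (partial i (b j))) by do 2 apply: smooth_partial.
have cF : csupp c r (partial k (partial i (b j))).
  by apply: csupp_partial; [apply: smooth_partial|apply: csupp_partial].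
have pi2 : (2 * pi) ^+ 2 != 0 :> R by rewrite gt_eqF// exprn_gt0// mulr_gt0// pi_gt0.
rewrite pressure_opE -[RHS](mulKf pi2) -(fourier_inversion sF cF); congr (_ * _).
apply: eq_Rintegral => xi _; rewrite /inv_integrand.
have C01 : coord2 0 xi * sinT (b 1) xi = coord2 1 xi * sinT (b 0) xi.
  by rewrite -(cosT_partial _ _ (sb 1) (cb 1)) -(cosT_partial _ _ (sb 0) (cb 0)) (funext curl).
have S01 : coord2 0 xi * cosT (b 1) xi = coord2 1 xi * cosT (b 0) xi.
  apply: oppr_inj; rewrite -!mulNr.
  by rewrite -(sinT_partial _ _ (sb 1) (cb 1)) -(sinT_partial _ _ (sb 0) (cb 0)) (funext curl).
have cN f : csupp c r f -> csupp c r (fun y => - f y) by exact: csuppN.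
have divE : div2 b = partial 0 (b 0) \- (fun y => - partial 1 (b 1) y).
  by apply/funext => y; rewrite /div2 /= opprK.
have cD : cosT (div2 b) xi = coord2 0 xi * sinT (b 0) xi + coord2 1 xi * sinT (b 1) xi.
  rewrite -(cosT_partial _ _ (sb 0) (cb 0)) -(cosT_partial _ _ (sb 1) (cb 1)).
  rewrite /cosT -RintegralD//; last 2 first.
  - exact: csupp_integrable (csupp_cos xi (csupp_partial 0 (sb 0) (cb 0))).
  - exact: csupp_integrable (csupp_cos xi (csupp_partial 1 (sb 1) (cb 1))).
  by apply: eq_Rintegral => y _; rewrite /div2 /= mulrDl.
have sD : sinT (div2 b) xi = - (coord2 0 xi * cosT (b 0) xi + coord2 1 xi * cosT (b 1) xi).
  rewrite opprD -!mulNr -(sinT_partial _ _ (sb 0) (cb 0)) -(sinT_partial _ _ (sb 1) (cb 1)).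
  rewrite /sinT -RintegralD//; last 2 first.
  - exact: csupp_integrable (csupp_sin xi (csupp_partial 0 (sb 0) (cb 0))).
  - exact: csupp_integrable (csupp_sin xi (csupp_partial 1 (sb 1) (cb 1))).
  by apply: eq_Rintegral => y _; rewrite /div2 /= mulrDl.
have sbi := smooth_partial i (sb j); have cbi := csupp_partial i (sb j) (cb j).
rewrite (cosT_partial _ _ sbi cbi) (sinT_partial _ _ sbi cbi).
rewrite (cosT_partial _ _ (sb j) (cb j)) (sinT_partial _ _ (sb j) (cb j)).
rewrite /pressure_integrand cD sD /cubic_ratio coord2_sum.
(* [B] stands for a transform of [b] at the frequency (X, Y); the vanishing curl makes it parallel
   to (X, Y), so projecting on that direction loses nothing. *)
have key (X Y : R) (B : 'I_2 -> R) : X = coord2 0 xi -> Y = coord2 1 xi ->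
    X * B 1 = Y * B 0 -> X ^+ 2 + Y ^+ 2 != 0 ->
    coord2 j xi * (X * B 0 + Y * B 1) / (X ^+ 2 + Y ^+ 2) = B j.
  move=> EX EY EB q0.
  have jj := ord2_cases j.
  apply: (canLR (mulfK q0)).
  case: jj => ->; rewrite -?EX -?EY mulrDr.
    by rewrite [X * (Y * _)]mulrCA EB; ring.
  by rewrite [Y * (X * _)]mulrCA -EB; ring.
set X := coord2 0 xi in C01 S01 cD sD *; set Y := coord2 1 xi in C01 S01 cD sD *.
(* At frequency 0 both sides vanish because of the factor xi_k. *)
have [q0|q0] := eqVneq (X ^+ 2 + Y ^+ 2) 0.
  have X0 : X = 0 by apply/eqP; move/eqP: q0; rewrite paddr_eq0 ?sqr_ge0// !sqrf_eq0 => /andP[].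
  have Y0 : Y = 0 by apply/eqP; move/eqP: q0; rewrite paddr_eq0 ?sqr_ge0// !sqrf_eq0 => /andP[].
  have k0 : coord2 k xi = 0.
    by case: (ord2_cases k) => ->.
  by rewrite k0 q0 invr0; ring.
have Ks := key X Y (fun l => sinT (b l) xi) erefl erefl C01 q0.
have Kc := key X Y (fun l => cosT (b l) xi) erefl erefl S01 q0.
rewrite -{1}Ks -{1}Kc; ring.
Qed.

End Pressure_multiplier.

(** * A radial mollifier *)

Section Mollifier.
Context {R : realType}.
Local Notation P2 := (measurableTypeR R * measurableTypeR R)%type.
Local Notation leb2 := (@lebesgue2 R).
Implicit Types (k i j : 'I_2) (x c : R * R) (r s : R).

(* Smooth on the whole line, and equal to 1 / s for s >= 1. *)
Definition recip s : R := s / (s ^+ 2 + flat 0 (1 - s)).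

Lemma recip_den_gt0 s : 0 < s ^+ 2 + flat 0 (1 - s).
Proof.
have [s1|s1] := ltP s 1; first by rewrite ltr_wpDl ?sqr_ge0// flat_gt0// subr_gt0.
by rewrite ltr_wpDr ?flat_ge0// exprn_gt0// (lt_le_trans ltr01).
Qed.

Lemma smooth_sqr : smooth (fun s : R => s ^+ 2).
Proof.
rewrite (_ : (fun s => s ^+ 2) = id \* id); first exact: smoothM (@smooth_id R) (@smooth_id R).
by apply/funext => s; rewrite expr2.
Qed.

Lemma smooth_recip : smooth recip.
Proof.
apply: (smoothM (@smooth_id R)); apply: smoothV => [s|]; first by rewrite gt_eqF// recip_den_gt0.
exact: (smoothD smooth_sqr (smooth_flat_onem 0)).
Qed.

Lemma recip_ge1 s : 1 <= s -> s * recip s = 1.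
Proof.
move=> s1; have s0 : s != 0 by rewrite gt_eqF// (lt_le_trans ltr01).
by rewrite /recip (@flat_le0 _ _ (1 - s)) ?subr_le0// addr0; field.
Qed.

(** The variable s stands for |x|^2, so 16 is the square of the ratio 4 between consecutive
    mollifiers. *)
Definition annulus s : R := step (s - 1) - step (16^-1 * s - 1).

Lemma is_derive_step_affine (a s : R) :
  is_derive (s : R) 1 (fun s => step (a * s - 1)) (dstep (a * s - 1) * a).
Proof.
have D := is_derive_sub (is_derive_linear a s) (is_derive_cst (1 : R) (s : R) (1 : R)).
rewrite subr0 in D.
exact: (is_derive_chain D (is_derive_step _)).
Qed.

Lemma smooth_affine1 (a b : R) : smooth (fun s => a * s - b).
Proof.
apply: (@smoothB _ _ (fun s => a * s) (cst b)); last exact: smooth_cst.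
exact: smoothZ (@smooth_id R).
Qed.

Lemma smooth_subC (b : R) : smooth (fun s => s - b).
Proof. exact: (smoothB (@smooth_id R) (@smooth_cst _ R R b)). Qed.

Lemma smooth_annulus : smooth annulus.
Proof.
apply: (@smoothB _ _ (fun s => step (s - 1)) (fun s => step (16^-1 * s - 1))).
  exact: (smooth_comp smooth_step (smooth_subC 1)).
exact: (smooth_comp smooth_step (smooth_affine1 16^-1 1)).
Qed.

Lemma annulus_le1 s : s <= 1 -> annulus s = 0.
Proof. by move=> s1; rewrite /annulus !step_le0 ?subrr//; lra. Qed.

Lemma annulus_ge32 s : 32 <= s -> annulus s = 0.
Proof. by move=> s1; rewrite /annulus !step_ge1 ?subrr//; lra. Qed.

(** In the plane the divergence of x p(|x|^2) is the derivative of 2 s p(s) at s = |x|^2.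
    Prescribing 2 s p(s) = [annulus s] therefore gives an explicit field; [recip] replaces 1/s where
    [annulus] vanishes. *)
Definition profile s : R := 2^-1 * (annulus s * recip s).

Lemma smooth_profile : smooth profile.
Proof. exact: smoothZ (smoothM smooth_annulus smooth_recip). Qed.

Lemma profileE s : 2 * (s * profile s) = annulus s.
Proof.
rewrite /profile; have [s1|s1] := leP s 1; first by rewrite annulus_le1//; ring.
have -> : 2 * (s * (2^-1 * (annulus s * recip s))) = annulus s * (s * recip s) by field.
by rewrite recip_ge1 ?mulr1// ltW.
Qed.

Lemma profile_deriv s :
  2 * profile s + 2 * (s * 'D_1 profile s) = dstep (s - 1) - 16^-1 * dstep (16^-1 * s - 1).
Proof.
have D1 := is_derive_cmul 2 (is_derive_mul (is_derive_id (s : R) 1) (smooth_is_derive (1 : R) s smooth_profile)).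
have D2 : is_derive (s : R) 1 annulus (dstep (1 * s - 1) * 1 - dstep (16^-1 * s - 1) * 16^-1).
  rewrite (_ : annulus = fun s => step (1 * s - 1) - step (16^-1 * s - 1)); last first.
    by apply/funext => t; rewrite mul1r.
  exact: (is_derive_sub (is_derive_step_affine 1 s) (is_derive_step_affine _ s)).
rewrite (_ : (fun _ => _) = annulus) in D1; last exact/funext/profileE.
have := is_deriveE D1; rewrite (is_deriveE D2) !mul1r !mulr1 => E.
have E' : dstep (s - 1) - dstep (16^-1 * s - 1) * 16^-1 = 2 * (s * 'D_1 profile s + profile s) by exact: E.
by rewrite [16^-1 * dstep _]mulrC E' mulrDr addrC.
Qed.

Definition normsq x : R := dot2 x x.

Lemma smooth_coord2 i : smooth (@coord2 R i).
Proof.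
apply: smooth_linear; first exact: continuous_coord2.
by move=> v x h; rewrite pair_line /coord2; case: ifP.
Qed.

Lemma derive_coord2 i x v : 'D_v (@coord2 R i) x = coord2 i v.
Proof.
have -> : @coord2 R i = id \o @coord2 R i by [].
rewrite (@derive_affine R R (R * R)%type R id _ x v (coord2 i v) (@smooth_id R)).
  by rewrite (@is_deriveE _ _ _ id _ _ _ (is_derive_id _ _)).
by move=> h; rewrite pair_line /coord2; case: ifP.
Qed.

Lemma coord2_basis2 i j : coord2 i (@basis2 R j) = (i == j)%:R.
Proof. by case: (ord2_cases i) => ->; case: (ord2_cases j) => ->. Qed.

Lemma normsqE : normsq = (@coord2 R 0 \* @coord2 R 0) \+ (@coord2 R 1 \* @coord2 R 1).
Proof. by apply/funext => x. Qed.

Lemma smooth_normsq : smooth normsq.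
Proof. by rewrite normsqE; apply: smoothD; apply: smoothM; exact: smooth_coord2. Qed.

Lemma partial_normsq i x : partial i normsq x = 2 * coord2 i x.
Proof.
rewrite /partial normsqE smooth_deriveD; [|apply: smoothM; exact: smooth_coord2..].
rewrite !smooth_deriveM; try exact: smooth_coord2.
rewrite !derive_coord2 !coord2_basis2.
by case: (ord2_cases i) => -> /=; ring.
Qed.

Definition bump x : R := dstep (normsq x - 1).

Lemma smooth_bump : smooth bump.
Proof.
have s1 := smooth_comp (smooth_subC 1) smooth_normsq.
exact: (smooth_comp smooth_dstep s1).
Qed.

Lemma bump_ge0 x : 0 <= bump x. Proof. exact: dstep_ge0. Qed.

Lemma normsq_gt x r : 0 <= r -> ~ box 0 r x -> r ^+ 2 < normsq x.
Proof.
move=> r0 xr; rewrite ltNge; apply/negP => h; apply: xr; apply/boxP; rewrite !subr0.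
have H i : `|coord2 i x| <= r.
  rewrite -(ler_pXn2r (n := 2)) ?nnegrE// real_normK ?num_real//.
  exact: le_trans (coord2_sq_le i x) h.
by split; [exact: (H 0)|exact: (H 1)].
Qed.

Lemma csupp_bump : csupp 0 2 bump.
Proof.
split => //; first exact: smooth_continuous smooth_bump.
move=> y /normsq_gt h; rewrite /bump dstep_gt1//.
have := h (ltW (ltr0n _ 2)); lra.
Qed.

(* A radial gradient field: its curl vanishes, and its divergence is the difference
   of [bump] and of its dilation by 4. *)
Definition bump_field j x : R := coord2 j x * profile (normsq x).

Lemma smooth_bump_field j : smooth (bump_field j).
Proof.
exact: (smoothM (smooth_coord2 j) (smooth_comp smooth_profile smooth_normsq)).
Qed.

(** Outside the square |x|^2 exceeds 36, and [annulus] vanishes from 32 on. *)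
Lemma csupp_bump_field j : csupp 0 6 (bump_field j).
Proof.
split => //; first exact: smooth_continuous (smooth_bump_field j).
move=> y /normsq_gt h; rewrite /bump_field /profile annulus_ge32 ?mul0r ?mulr0//.
have := h (ltW (ltr0n _ 6)); lra.
Qed.

Lemma partial_bump_field i j x : partial i (bump_field j) x =
  coord2 j x * ('D_1 profile (normsq x) * (2 * coord2 i x)) + profile (normsq x) * (i == j)%:R.
Proof.
rewrite /partial /bump_field.
have -> : (fun x => coord2 j x * profile (normsq x)) = @coord2 R j \* (profile \o normsq) by [].
rewrite smooth_deriveM; [|exact: smooth_coord2|exact: smooth_comp smooth_profile smooth_normsq].
rewrite (derive_chain _ _ smooth_profile smooth_normsq) -/(partial i normsq x).
by rewrite partial_normsq derive_coord2 coord2_basis2 (eq_sym j).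
Qed.

Lemma curl_bump_field i j x : partial i (bump_field j) x = partial j (bump_field i) x.
Proof. by rewrite !partial_bump_field (eq_sym j); ring. Qed.

Lemma div_bump_field x : div2 bump_field x = bump x - 16^-1 * rescale 0 4 bump x.
Proof.
rewrite /div2 /= !partial_bump_field !eqxx /bump /rescale.
have -> : normsq (rescale_pt 0 4 x) = 16^-1 * normsq x.
  by rewrite /normsq /rescale_pt /dot2 /= !subr0; field.
rewrite -profile_deriv.
have -> : normsq x = coord2 0 x ^+ 2 + coord2 1 x ^+ 2 by [].
by rewrite /=; ring.
Qed.

Lemma rescale_rescale c r s (f : R * R -> R) : rescale c r (rescale 0 s f) = rescale c (s * r) f.
Proof.
by apply/funext => x; rewrite /rescale /rescale_pt /= !subr0 !invfM !mulrA.
Qed.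

Lemma partial_scaled c s (a : R) (g : R * R -> R) i : s != 0 -> smooth g ->
  partial i (fun x => a * rescale c s g x) = (fun x => (a * s^-1) * rescale c s (partial i g) x).
Proof.
move=> s0 sg; apply/funext => x.
rewrite /partial smooth_deriveZ; last exact: smooth_rescale.
by rewrite rescale_deriv// mulrA.
Qed.

Lemma smooth_scaled c s (a : R) (g : R * R -> R) : smooth g -> smooth (fun x => a * rescale c s g x).
Proof. by move=> sg; apply: smoothZ; exact: smooth_rescale. Qed.

Lemma csupp_scaled c s (a r : R) (g : R * R -> R) : 0 < s -> csupp 0 r g ->
  csupp c (s * r) (fun x => a * rescale c s g x).
Proof. by move=> s0 sg; apply: csuppZ; exact: csupp_rescale. Qed.

(** The mass is [bump_mass] at every scale; instead of being normalised, this constant is carried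
    along and divided out in the final estimate. *)
Definition moll c r x : R := r ^- 2 * rescale c r bump x.

Definition moll_field c r j x : R := r^-1 * rescale c r (bump_field j) x.

Lemma smooth_moll c r : smooth (moll c r).
Proof. exact: smooth_scaled smooth_bump. Qed.

Lemma smooth_moll_field c r j : smooth (moll_field c r j).
Proof. exact: smooth_scaled (smooth_bump_field j). Qed.

Lemma csupp_moll c r : 0 < r -> csupp c (r * 2) (moll c r).
Proof. by move=> r0; exact: csupp_scaled csupp_bump. Qed.

Lemma csupp_moll_field c r j : 0 < r -> csupp c (r * 6) (moll_field c r j).
Proof. by move=> r0; exact: csupp_scaled (csupp_bump_field j). Qed.

Lemma moll_ge0 c r x : 0 <= moll c r x.
Proof. by rewrite mulr_ge0 ?bump_ge0// invr_ge0 sqr_ge0. Qed.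

Definition bump_mass : R := \int[leb2]_x bump x.

Lemma integral_moll c r : 0 < r -> \int[leb2]_x moll c r x = bump_mass.
Proof.
move=> r0; have sb := csupp_rescale c r0 csupp_bump.
rewrite RintegralZl//; last exact: csupp_integrable sb.
rewrite (integral_rescale r0 csupp_bump sb) mulKf//.
by rewrite gt_eqF// exprn_gt0.
Qed.

Lemma div_moll_field c r : 0 < r -> div2 (moll_field c r) = moll c r \- moll c (4 * r).
Proof.
move=> r0; have rn0 : r != 0 by rewrite gt_eqF.
apply/funext => x; rewrite /div2 /= !partial_scaled//; try exact: smooth_bump_field.
have := div_bump_field (rescale_pt c r x); rewrite /div2 /=.
rewrite -/(rescale c r (rescale 0 4 bump) x) rescale_rescale => E.
rewrite -mulrDr /moll -/(rescale c r bump x).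
rewrite [X in _ * X]E -/(rescale c r bump x).
by move: (rescale c r bump x) (rescale c (4 * r) bump x) => a b; field.
Qed.

Lemma curl_moll_field c r i j : 0 < r ->
  partial i (moll_field c r j) =1 partial j (moll_field c r i).
Proof.
move=> r0 x; have rn0 : r != 0 by rewrite gt_eqF.
rewrite !partial_scaled//; try exact: smooth_bump_field.
by rewrite /rescale curl_bump_field.
Qed.

Lemma bump_mass_gt0 : 0 < bump_mass.
Proof.
have [s /andP[s0 s1] ds0] := @dstep_pos R.
pose x0 : R * R := (Num.sqrt (s + 1), 0).
have bx0 : 0 < bump x0.
  rewrite /bump /normsq /dot2 /= mulr0 addr0 -expr2 sqr_sqrtr ?addrK//; lra.
have cb := smooth_continuous smooth_bump.
have /nbhs_ballP[e /= e0 eb] : nbhs x0 [set x | bump x0 / 2 < bump x].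
  by apply: (cvgr_gt (bump x0) (cb x0)); lra.
pose d := e / 2.
have d0 : 0 < d by rewrite divr_gt0.
have Bd y : box x0 d y -> bump x0 / 2 <= bump y.
  move=> /boxP[y1 y2]; apply/ltW/eb; split; rewrite /ball/= distrC.
    by rewrite (le_lt_trans y1)// /d; lra.
  by rewrite (le_lt_trans y2)// /d; lra.
rewrite -lte_fin /bump_mass /Rintegral fineK; last first.
  by apply: integrable_fin_num => //; exact: csupp_integrable csupp_bump.
have mb := measurable_box x0 d.
have mf : measurable_fun [set: P2] (fun x => (bump x)%:E).
  by apply/measurable_EFinP; exact: (continuous_measurable_plane cb).
apply: (@lt_le_trans _ _ (\int[leb2]_(x in box x0 d) (bump x0 / 2)%:E)%E).
  by rewrite integral_box_cst ?ltW// lte_fin mulr_gt0 ?exprn_gt0//; lra.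
apply: (@le_trans _ _ (\int[leb2]_(x in box x0 d) (bump x)%:E)%E).
  apply: ge0_le_integral => //.
  - by move=> x _; rewrite lee_fin; lra.
  - exact: measurable_funS mf.
apply: ge0_subset_integral; [exact: mb|exact: measurableT|exact: mf| |exact: subsetT].
by move=> x _; rewrite lee_fin bump_ge0.
Qed.

Lemma csupp_sup r (g : 'I_2 -> R * R -> R) : (forall i, csupp 0 r (g i)) ->
  exists2 M, 0 <= M & forall i x, `|g i x| <= M.
Proof.
move=> cg; have [M0 M00 H0] := csupp_bounded (cg 0).
have [M1 M10 H1] := csupp_bounded (cg 1).
exists (M0 + M1); first by rewrite addr_ge0.
move=> i x; case: (ord2_cases i) => ->.
  by rewrite (le_trans (H0 x))// lerDl.
by rewrite (le_trans (H1 x))// lerDr.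
Qed.

Lemma moll_bounds : exists2 K, 0 <= K & forall c r, 0 < r -> forall x,
  `|moll c r x| <= K * r ^- 2 /\ forall k, `|partial k (moll c r) x| <= K * r ^- 3.
Proof.
have [M M0 HM] := csupp_bounded csupp_bump.
have [N N0 HN] := csupp_sup (fun k => csupp_partial k smooth_bump csupp_bump).
exists (M + N); first by rewrite addr_ge0.
move=> c r r0 x; have rn0 : r != 0 by rewrite gt_eqF.
have r2 : 0 <= r ^- 2 by rewrite invr_ge0 exprn_ge0// ltW.
have r3 : 0 <= r ^- 3 by rewrite invr_ge0 exprn_ge0// ltW.
split=> [|k].
  rewrite /moll normrM (ger0_norm r2) mulrC ler_wpM2r// (le_trans (HM _))//.
  by rewrite lerDl.
rewrite partial_scaled//; last exact: smooth_bump.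
rewrite -invfM -exprSr normrM (ger0_norm r3) mulrC ler_wpM2r// (le_trans (HN _ _))//.
by rewrite lerDr.
Qed.

Lemma partial2_moll_field c r i j k : 0 < r ->
  partial k (partial i (moll_field c r j)) =
  fun x => r ^- 3 * rescale c r (partial k (partial i (bump_field j))) x.
Proof.
move=> r0; have rn0 : r != 0 by rewrite gt_eqF.
have sb := smooth_bump_field j.
rewrite {1}/moll_field partial_scaled// partial_scaled//; last exact: smooth_partial.
by apply/funext => x; congr (_ * _); field.
Qed.

Lemma moll_field_bounds : exists2 K, 0 <= K & forall c r, 0 < r -> forall x j,
  `|moll_field c r j x| <= K * r^-1 /\
  forall k i, `|partial k (partial i (moll_field c r j)) x| <= K * r ^- 3.
Proof.
have [M M0 HM] := csupp_sup csupp_bump_field.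
have H2 k i : exists2 M, 0 <= M & forall j x, `|partial k (partial i (bump_field j)) x| <= M.
  apply: (@csupp_sup 6) => j; apply: csupp_partial.
    exact: smooth_partial (smooth_bump_field j).
  exact: csupp_partial (smooth_bump_field j) (csupp_bump_field j).
have H1 k : exists2 M, 0 <= M & forall i j x, `|partial k (partial i (bump_field j)) x| <= M.
  have [a a0 Ha] := H2 k 0; have [b b0 Hb] := H2 k 1.
  exists (a + b) => [|i j x]; first by rewrite addr_ge0.
  case: (ord2_cases i) => ->.
    by rewrite (le_trans (Ha _ _))// lerDl.
  by rewrite (le_trans (Hb _ _))// lerDr.
have [N0 N00 HN0] := H1 0; have [N1 N10 HN1] := H1 1.
exists (M + (N0 + N1)); first by rewrite !addr_ge0.
move=> c r r0 x j.
have r1 : 0 <= r^-1 by rewrite invr_ge0 ltW.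
have r3 : 0 <= r ^- 3 by rewrite invr_ge0 exprn_ge0// ltW.
split=> [|k i].
  rewrite /moll_field normrM (ger0_norm r1) mulrC ler_wpM2r// (le_trans (HM _ _))//.
  by rewrite lerDl addr_ge0.
rewrite partial2_moll_field// normrM (ger0_norm r3) mulrC ler_wpM2r//.
case: (ord2_cases k) => ->.
  by rewrite (le_trans (HN0 _ _ _))//; lra.
by rewrite (le_trans (HN1 _ _ _))//; lra.
Qed.

Lemma onemD2_scaled c s (a : R) (g : R * R -> R) i : s != 0 -> smooth g ->
  onemD2 i (fun x => a * rescale c s g x) =
  (fun x => a * rescale c s (fun y => g y - s ^- 2 * partial i (partial i g) y) x).
Proof.
move=> s0 sg; have sg1 := smooth_partial i sg.
apply/funext => x; rewrite /onemD2 /= partial_scaled// partial_scaled//.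
by rewrite /rescale; field.
Qed.

Lemma partial_subZ i (a : R) (h g : R * R -> R) : smooth h -> smooth g ->
  partial i (fun y => h y - a * g y) = (fun y => partial i h y - a * partial i g y).
Proof.
move=> sh sg; apply/funext => z; rewrite /partial.
by rewrite (smooth_deriveB z (basis2 i) sh (smoothZ a sg)) (smooth_deriveZ a z _ sg).
Qed.

(** Each second derivative costs r^-2, which is at most 1 because r >= 1, so all the terms are
    bounded as at scale 1. *)
Lemma onemD2_scaled_le c (a r : R) (g : R * R -> R) M0 M1 M2 M3 x : smooth g -> 1 <= r ->
  (forall y, `|g y| <= M0) -> (forall y, `|partial 1 (partial 1 g) y| <= M1) ->
  (forall y, `|partial 0 (partial 0 g) y| <= M2) ->
  (forall y, `|partial 0 (partial 0 (partial 1 (partial 1 g))) y| <= M3) ->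
  `|onemD2 0 (onemD2 1 (fun x => a * rescale c r g x)) x| <= `|a| * (M0 + M1 + (M2 + M3)).
Proof.
move=> sg r1 H0 H1 H2 H3.
have r0 : 0 < r by rewrite (lt_le_trans ltr01).
have rn0 : r != 0 by rewrite gt_eqF.
have s1 i h : smooth h -> smooth (@partial R i (partial i h)).
  by move=> sh; exact/smooth_partial/smooth_partial.
have s11 := s1 1 _ sg.
rewrite (onemD2_scaled c a 1 rn0 sg) (onemD2_scaled c a 0 rn0 (smoothB sg (smoothZ _ s11))).
rewrite (partial_subZ 0 _ sg s11).
rewrite (partial_subZ 0 _ (smooth_partial 0 sg) (smooth_partial 0 s11)).
rewrite normrM ler_wpM2l// /rescale.
move: (rescale_pt c r x) => y.
have q0 : 0 <= r ^- 2 by rewrite invr_ge0 exprn_ge0// ltW.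
have q1 : r ^- 2 <= 1 by rewrite invf_le1 ?exprn_gt0// exprn_ege1.
have small (t M : R) : `|t| <= M -> `|r ^- 2 * t| <= M.
  by move=> tM; rewrite normrM (ger0_norm q0) (le_trans _ tM)// ler_piMl.
rewrite (le_trans (ler_normB _ _))// lerD//.
  by rewrite (le_trans (ler_normB _ _))// lerD// small.
by rewrite small// (le_trans (ler_normB _ _))// lerD// small.
Qed.

(** Together with [pressure_op_le] this bounds the pressure operator on a mollifier of scale r by
    r^-3 times the area r^2: it tends to 0 at large scales. *)
Lemma onemD2_moll_bound : exists2 K, 0 <= K & forall c r, 1 <= r -> forall k x,
  `|onemD2 0 (onemD2 1 (partial k (moll c r))) x| <= K * r ^- 3.
Proof.
have H k : exists2 K, 0 <= K & forall c r, 1 <= r -> forall x,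
    `|onemD2 0 (onemD2 1 (partial k (moll c r))) x| <= K * r ^- 3.
  have sg := smooth_partial k smooth_bump.
  have cg := csupp_partial k smooth_bump csupp_bump.
  move Eg : (partial k (@bump)) sg cg => g sg cg.
  have s1 i h : smooth h -> smooth (@partial R i (partial i h)).
    by move=> sh; exact/smooth_partial/smooth_partial.
  have c1 i (h : R * R -> R) : smooth h -> csupp 0 2 h -> csupp 0 2 (partial i (partial i h)).
    by move=> sh ch; apply: csupp_partial; [exact: smooth_partial|exact: csupp_partial].
  have [M0 M00 H0] := csupp_bounded cg.
  have [M1 M10 H1] := csupp_bounded (c1 1 _ sg cg).
  have [M2 M20 H2] := csupp_bounded (c1 0 _ sg cg).
  have [M3 M30 H3] := csupp_bounded (c1 0 _ (s1 1 _ sg) (c1 1 _ sg cg)).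
  exists (M0 + M1 + (M2 + M3)); first by rewrite !addr_ge0.
  move=> c r r1 x; have r0 : 0 < r by rewrite (lt_le_trans ltr01).
  have rn0 : r != 0 by rewrite gt_eqF.
  rewrite (partial_scaled c _ k rn0 smooth_bump) Eg.
  have r3 : 0 <= r ^- 3 by rewrite invr_ge0 exprn_ge0// ltW.
  rewrite -invfM -exprSr mulrC -[X in X * _](ger0_norm r3).
  exact: onemD2_scaled_le.
have [N0 N00 HN0] := H 0; have [N1 N10 HN1] := H 1.
exists (N0 + N1); first by rewrite addr_ge0.
move=> c r r1 k x.
have r3 : 0 <= r ^- 3 by rewrite invr_ge0 exprn_ge0// (le_trans ler01).
case: (ord2_cases k) => ->.
  by rewrite (le_trans (HN0 _ _ r1 _))// ler_wpM2r// lerDl.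
by rewrite (le_trans (HN1 _ _ r1 _))// ler_wpM2r// lerDr.
Qed.

End Mollifier.

(** * The L^1 norm of the pressure operator applied to a mollifier *)

Section Pressure_kernel.
Context {R : realType}.
Local Notation mR := (measurableTypeR R).
Local Notation P2 := (measurableTypeR R * measurableTypeR R)%type.
Local Notation leb2 := (@lebesgue2 R).
Implicit Types (k i j : 'I_2) (x c : R * R) (r s : R).

Lemma box_le c r s : r <= s -> box c r `<=` box c s.
Proof. by move=> rs; apply: subset_box; rewrite subrr normr0 add0r. Qed.

Lemma pressure_op_step c r k i j x : 0 < r ->
  pressure_op k i j (moll c r) x =
  partial k (partial i (moll_field c r j)) x + pressure_op k i j (moll c (4 * r)) x.
Proof.
move=> r0; have r40 : 0 < 4 * r by rewrite mulr_gt0.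
have cm : csupp c (4 * r * 2) (moll c r).
  by apply: csuppW (csupp_moll c r0); [apply: box_le; lra|lra].
rewrite -(@pressure_op_div _ c (r * 6) (moll_field c r)).
- rewrite div_moll_field// (pressure_opB _ _ _ _ (smooth_moll c r) (smooth_moll c (4 * r)) cm (csupp_moll c r40)).
  by rewrite subrK.
- by move=> l; exact: smooth_moll_field.
- by move=> l; exact: csupp_moll_field.
- exact: curl_moll_field.
Qed.

Lemma telescope_ord (t F : nat -> R) n : (forall m, t m = F m + t m.+1) ->
  t 0 = \sum_(m < n) F m + t n.
Proof.
move=> H; elim: n => [|n IH]; first by rewrite big_ord0 add0r.
by rewrite big_ord_recr /= IH H addrA.
Qed.

Lemma pressure_op_sum c r k i j x n : 0 < r ->
  pressure_op k i j (moll c r) x =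
  \sum_(m < n) partial k (partial i (moll_field c (4 ^+ m * r) j)) x
   + pressure_op k i j (moll c (4 ^+ n * r)) x.
Proof.
move=> r0.
have H := @telescope_ord (fun m => pressure_op k i j (moll c (4 ^+ m * r)) x)
  (fun m => partial k (partial i (moll_field c (4 ^+ m * r) j)) x) n.
rewrite -H; first by rewrite expr0 mul1r.
by move=> m; rewrite exprS -mulrA; apply: pressure_op_step; rewrite mulr_gt0// exprn_gt0.
Qed.

Lemma pressure_op_cvg0 c r k i j x : 0 < r ->
  pressure_op k i j (moll c (4 ^+ n * r)) x @[n --> \oo] --> (0 : R).
Proof.
move=> r0; have [K K0 HK] := @onemD2_moll_bound R.
apply/cvgr0Pnorm_le => e e0.
(* As 4^n >= n, the scale s is at least 1, as [onemD2_moll_bound] requires, and 16 K / s is at most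
   e. *)
pose N := Num.truncn (r^-1 + (16 * K) / (e * r)).
exists N.+1 => // n /= Nn.
have r1 : 0 <= r^-1 by rewrite invr_ge0 ltW.
have er : 0 < e * r by rewrite mulr_gt0.
have q0 : 0 <= (16 * K) / (e * r) by rewrite divr_ge0 ?mulr_ge0// ltW.
have h1 : r^-1 + (16 * K) / (e * r) <= n%:R.
  rewrite ltW// (lt_le_trans (truncnS_gt _))// ler_nat//.
have h2 : n%:R <= (4 : R) ^+ n.
  by rewrite -natrX ler_nat ltnW// ltn_expl.
pose s := 4 ^+ n * r; have s0 : 0 < s by rewrite mulr_gt0 ?exprn_gt0.
have s1 : 1 <= s.
  by rewrite /s -ler_pdivrMr// mul1r (le_trans _ h2)// (le_trans _ h1)// lerDl q0.
have s2 : 16 * K / s <= e.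
  by rewrite ler_pdivrMr// /s mulrCA -ler_pdivrMr// (le_trans _ h2)// (le_trans _ h1)// lerDr r1.
have H := pressure_op_le (smooth_moll c s) (csupp_moll c s0) i j x (HK c s s1 k).
rewrite (le_trans H)// (le_trans _ s2)//.
rewrite (_ : K * s ^- 3 * (2 * (s * 2)) ^+ 2 = 16 * K / s)//.
by move: s0; move: (s) => z z0; field; rewrite gt_eqF.
Qed.

Lemma sum_geometric4_le n : \sum_(m < n) (4 ^- m : R) <= 2.
Proof.
suff H : \sum_(m < n) (4 ^- m : R) <= 2 - 2 * 4 ^- n.
  by apply: (le_trans H); rewrite gerBl mulr_ge0// invr_ge0 exprn_ge0.
elim: n => [|n IH]; first by rewrite big_ord0 expr0 invr1 mulr1 subrr.
rewrite big_ord_recr /= exprS invfM.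
have : 0 < (4 ^- n : R) by rewrite invr_gt0 exprn_gt0.
by move: IH; set a := \sum_(_ < _) _; set b := 4 ^- n; lra.
Qed.

(* By [pressure_op_div] the kernel is the sum over n of second derivatives of
   the mollified field at the scales 4^n r, whose L^1 norms decay like 4^-n / r. *)
Lemma pressure_kernel : exists2 K : R, 0 <= K & forall c r k i j, 0 < r ->
  leb2.-integrable setT (EFin \o pressure_op k i j (moll c r)) /\
  (\int[leb2]_x `|pressure_op k i j (moll c r) x|%:E <= (K * r^-1)%:E)%E.
Proof.
have [B B0 HB] := @moll_field_bounds R.
(* With s = 4^n r, the n-th term is at most B s^-3 on a square of side 12 s, so its L^1 norm is at
   most 144 B / s; the 2 bounds the geometric sum. *)
exists (2 * 12 ^+ 2 * B); first by rewrite !mulr_ge0// exprn_ge0.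
move=> c r k i j r0.
pose s n := 4 ^+ n * r; have s0 n : 0 < s n by rewrite mulr_gt0 ?exprn_gt0.
pose F n := partial k (partial i (moll_field c (s n) j)).
pose T := pressure_op k i j (moll c r).
have cF n : csupp c (s n * 6) (F n).
  apply: csupp_partial; first exact/smooth_partial/smooth_moll_field.
  by apply: csupp_partial; [exact: smooth_moll_field|exact: csupp_moll_field].
have ctF n : continuous (F n) by case: (cF n).
have mF n : measurable_fun [set: P2] (F n : P2 -> mR) by exact: continuous_measurable_plane.
have T_sum n x : T x = \sum_(m < n) F m x + pressure_op k i j (moll c (s n)) x.
  exact: pressure_op_sum.
have mT : measurable_fun [set: P2] (T : P2 -> mR).
  apply: (@measurable_fun_cvg _ _ _ _ (fun n x => \sum_(m < n) F m x)).
    by move=> n; apply: measurable_sum => m; exact: mF.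
  move=> x _; rewrite (_ : (fun n => _) = (fun n => T x - pressure_op k i j (moll c (s n)) x)); last first.
    by apply/funext => n; rewrite (T_sum n) addrK.
  rewrite -[X in _ --> X]subr0; apply: cvgB; first exact: cvg_cst.
  exact: pressure_op_cvg0.
(* The remainder of each finite sum tends to 0 pointwise, hence is below any e from some rank on. *)
have T_le x : (`|T x|%:E <= \sum_(n <oo) `|F n x|%:E)%E.
  apply/lee_addgt0Pr => e e0.
  have /cvgr0Pnorm_le/(_ e e0)[N _ HN] := pressure_op_cvg0 c k i j x r0.
  have hN := HN N (leqnn N).
  rewrite (T_sum N); apply: (@le_trans _ _ ((\sum_(m < N) `|F m x|)%:E + e%:E)%E).
    rewrite -EFinD lee_fin (le_trans (ler_normD _ _))// lerD//.
    exact: ler_norm_sum.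
  rewrite leeD2r// -sumEFin -(big_mkord xpredT (fun m => `|F m x|%:E)).
  exact: nneseries_lim_ge.
have F_int n : (\int[leb2]_x `|F n x|%:E <= (12 ^+ 2 * B * r^-1 * 4 ^- n)%:E)%E.
  have H := @integral_supported_le _ (F n) c (s n * 6) (B * (s n) ^- 3).
  have -> : 12 ^+ 2 * B * r^-1 * 4 ^- n = B * s n ^- 3 * (2 * (s n * 6)) ^+ 2.
    have sn0 : s n != 0 by rewrite gt_eqF.
    have -> : B * s n ^- 3 * (2 * (s n * 6)) ^+ 2 = 12 ^+ 2 * B * (s n)^-1 by field.
    by rewrite /s invfM; ring.
  apply: H => //.
  - by case: (cF n).
  - by move=> y; have [_ h] := HB c (s n) (s0 n) y j; exact: h.
  - by case: (cF n).
have mEF n : measurable_fun [set: P2] (fun x => `|F n x|%:E).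
  by apply/measurable_EFinP; apply: (@measurableT_comp _ _ _ _ _ _ (Num.norm : mR -> mR)); [exact: normr_measurable|exact: mF].
have T_int : (\int[leb2]_x `|T x|%:E <= (2 * 12 ^+ 2 * B * r^-1)%:E)%E.
  apply: (@le_trans _ _ (\int[leb2]_x \sum_(n <oo) `|F n x|%:E)%E).
    apply: ge0_le_integral => //.
    - by apply/measurable_EFinP; apply: (@measurableT_comp _ _ _ _ _ _ (Num.norm : mR -> mR)); [exact: normr_measurable|exact: mT].
    - apply: ge0_emeasurable_sum; [by move=> *; rewrite lee_fin|by move=> n _; exact: mEF].
  rewrite integral_nneseries//.
  apply: lime_le; first by apply: is_cvg_nneseries => n _ _; exact: integral_ge0.
  apply: nearW => n.
  apply: (@le_trans _ _ (\sum_(0 <= m < n) (12 ^+ 2 * B * r^-1 * 4 ^- m)%:E)%E).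
    by apply: lee_sum => m _; exact: F_int.
  rewrite sumEFin lee_fin -mulr_sumr big_mkord.
  have -> : 2 * 12 ^+ 2 * B * r^-1 = 12 ^+ 2 * B * r^-1 * 2 by ring.
  by rewrite ler_wpM2l ?sum_geometric4_le// !mulr_ge0 ?exprn_ge0// invr_ge0 ltW.
split=> //; apply/integrableP; split; first exact/measurable_EFinP.
by apply: le_lt_trans T_int _; rewrite ltry.
Qed.

Lemma pressure_pairing_le : exists2 K : R, 0 <= K & forall c r k i j (g : R * R -> R) M, 0 < r ->
  continuous g -> (forall x, `|g x| <= M) ->
  `|multiplier_pairing (pressure_symbol k i j) g (moll c r)| <= M * (K * r^-1).
Proof.
have [K K0 HK] := pressure_kernel; exists K => // c r k i j g M r0 cg gM.
have [IT HT] := HK c r k i j r0.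
have mT : measurable_fun setT (pressure_op k i j (moll c r)).
  by apply/measurable_EFinP; exact: measurable_int IT.
have M0 : 0 <= M := le_trans (normr_ge0 _) (gM 0).
have mg : measurable_fun [set: P2] (g : P2 -> mR) := continuous_measurable_plane cg.
have Ig : leb2.-integrable setT (EFin \o (fun x => g x * pressure_op k i j (moll c r) x)).
  have I := integrableZl measurableT M IT.
  apply: le_integrable I => //.
    by apply/measurable_EFinP; exact: measurable_funM mg mT.
  by move=> x _ /=; rewrite lee_fin !normrM ler_pM// (le_trans (gM x))// ler_norm.
rewrite /multiplier_pairing -/(pressure_op k i j _).
apply: (le_trans (le_normr_Rintegral measurableT Ig)).
have I := integrableZl measurableT M (integrable_norm IT).
have H := le_Rintegral measurableT (integrable_norm Ig) I.
apply: (le_trans (H _)).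
  by move=> x _ /=; rewrite normrM ler_wpM2r.
rewrite RintegralZl//; last exact: integrable_norm IT.
rewrite ler_wpM2l// -lee_fin /Rintegral fineK//.
by apply: integrable_fin_num => //; exact: integrable_norm IT.
Qed.

End Pressure_kernel.

(** * Functions of time and space *)

Section Schwarz.
Context {R : realType}.
Implicit Types V : normedModType R.

Lemma is_derive_ray V (f : V -> R) (v y : V) (a : R) : smooth f ->
  is_derive a 1 (fun a : R => f (a *: v + y)) ('D_v f (a *: v + y)).
Proof.
move=> sf.
apply: (@is_derive_affine _ _ _ _ f (fun a : R => a *: v + y) a 1 v).
  by move=> h; rewrite scalerDl addrA [h *: (1:R)]mulr1.
exact: smooth_is_derive.
Qed.

(* Second difference quotients are symmetric in (v, w): this gives Schwarz's theorem. *)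
Lemma mean_value2 V (f : V -> R) (v w x : V) (h : R) : 0 < h -> smooth f ->
  exists2 ab : R * R, 0 < ab.1 < h /\ 0 < ab.2 < h &
    f (h *: v + (h *: w + x)) - f (h *: v + x) - (f (h *: w + x) - f x) =
    'D_w (fun y => 'D_v f y) (ab.1 *: v + (ab.2 *: w + x)) * h * h.
Proof.
move=> h0 sf.
pose g (a : R) := f (a *: v + (h *: w + x)) - f (a *: v + x).
have dg (a : R) : is_derive a 1 g ('D_v f (a *: v + (h *: w + x)) - 'D_v f (a *: v + x)).
  by apply: is_derive_sub; exact: is_derive_ray.
have cg : continuous g.
  by move=> a; apply: differentiable_continuous; apply/derivable1_diffP; have [] := dg a.
have [a a0h Ea] := @MVT R g _ 0 h h0 (fun a _ => dg a) (continuous_subspaceT cg).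
pose k (b : R) := 'D_v f (b *: w + (a *: v + x)).
have sD : smooth (fun y => 'D_v f y) := smooth_deriv v sf.
have dk (b : R) : is_derive b 1 k ('D_w (fun y => 'D_v f y) (b *: w + (a *: v + x))).
  exact: (is_derive_ray _ _ _ sD).
have ck : continuous k.
  by move=> b; apply: differentiable_continuous; apply/derivable1_diffP; have [] := dk b.
have [b b0h Eb] := @MVT R k _ 0 h h0 (fun b _ => dk b) (continuous_subspaceT ck).
exists (a, b); first by move: a0h b0h; rewrite !in_itv.
move: Ea; rewrite /g !scale0r !add0r subr0 => ->.
move: Eb; rewrite /k scale0r add0r subr0.
rewrite (addrCA (h *: w)) (addrCA (b *: w)) => -> /=.
by [].
Qed.

(** The intermediate points supplied by the two mean value arguments differ, but both tend to x with
    h, and continuity identifies the limits. *)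
Lemma eq_of_near_values V (A B : V -> R) (v w x : V) : continuous A -> continuous B ->
  (forall h : R, 0 < h -> exists p q : R * R,
     [/\ 0 < p.1 < h, 0 < p.2 < h, 0 < q.1 < h, 0 < q.2 < h &
      A (p.1 *: v + (p.2 *: w + x)) = B (q.1 *: w + (q.2 *: v + x))]) -> A x = B x.
Proof.
move=> cA cB H.
have cL (v1 w1 : V) : continuous (fun p : R * R => p.1 *: v1 + (p.2 *: w1 + x)).
  move=> p; apply: cvgD; first by apply: cvgZr_tmp; exact: cvg_fst.
  by apply: cvgD; [apply: cvgZr_tmp; exact: cvg_snd|exact: cvg_cst].
have near (F : V -> R) (v1 w1 : V) (e : R) : continuous F -> 0 < e -> exists2 d, 0 < d &
    forall p : R * R, 0 < p.1 < d -> 0 < p.2 < d ->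
     `|F x - F (p.1 *: v1 + (p.2 *: w1 + x))| < e.
  move=> cF e0; have F0 : F (0 *: v1 + (0 *: w1 + x)) = F x by rewrite !scale0r !add0r.
  have c0 := @continuous_comp (R * R)%type V R _ F 0 (cL v1 w1 0) (cF _).
  have /cvgrPdist_lt/(_ _ e0)/nbhs_ballP[d /= d0 Hd] := c0.
  exists d => // p /andP[p1 p1d] /andP[p2 p2d]; rewrite -F0; apply: Hd.
  by split; rewrite /ball/= sub0r normrN gtr0_norm.
apply/eqP; rewrite -subr_eq0 -normr_le0; apply/ler_addgt0Pr => e e0; rewrite add0r.
have e2 : 0 < e / 2 by rewrite divr_gt0.
have [d1 d10 H1] := near A v w _ cA e2.
have [d2 d20 H2] := near B w v _ cB e2.
have h0 : 0 < Num.min d1 d2 by rewrite lt_min d10.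
have [p [q [p1 p2 q1 q2 E]]] := H _ h0.
have m1 (t : R) : 0 < t < Num.min d1 d2 -> 0 < t < d1.
  by move=> /andP[-> tm]; rewrite (lt_le_trans tm)// ge_min lexx.
have m2 (t : R) : 0 < t < Num.min d1 d2 -> 0 < t < d2.
  by move=> /andP[-> tm]; rewrite (lt_le_trans tm)// ge_min lexx orbT.
have {}H1 := H1 p (m1 _ p1) (m1 _ p2).
have {}H2 := H2 q (m2 _ q1) (m2 _ q2).
move: H1 H2; rewrite E; move: (A x) (B x) (B _) => a b c.
rewrite !ltr_norml !ler_norml; lra.
Qed.

Lemma derive_comm V (f : V -> R) (v w x : V) : smooth f ->
  'D_w (fun y => 'D_v f y) x = 'D_v (fun y => 'D_w f y) x.
Proof.
move=> sf.
apply: (@eq_of_near_values _ (fun y => 'D_w (fun y => 'D_v f y) y) (fun y => 'D_v (fun y => 'D_w f y) y) v w).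
- exact: smooth_continuous (smooth_deriv w (smooth_deriv v sf)).
- exact: smooth_continuous (smooth_deriv v (smooth_deriv w sf)).
move=> h h0.
have [p [p1 p2] E1] := mean_value2 v w x h0 sf.
have [q [q1 q2] E2] := mean_value2 w v x h0 sf.
exists p, q; split; [exact: p1|exact: p2|exact: q1|exact: q2|].
apply: (mulIf (lt0r_neq0 h0)); apply: (mulIf (lt0r_neq0 h0)).
apply: (etrans (esym E1)); apply: (etrans _ E2).
rewrite (addrCA (h *: v) (h *: w) x).
by move: (f (h *: w + (h *: v + x))) (f (h *: v + x)) (f (h *: w + x)) (f x) => a b c d; ring.
Qed.

End Schwarz.

(** * Differentiation of integrals in time *)

Section Space_time.
Context {R : realType}.
Local Notation P2 := (measurableTypeR R * measurableTypeR R)%type.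
Local Notation leb2 := (@lebesgue2 R).
Local Notation ST := (R * (R * R))%type.
Implicit Types (f g : ST -> R) (t : R) (x y : R * R) (i k : 'I_2).

Definition dt f (z : ST) : R := 'D_((1, 0) : ST) f z.
Definition dx i f (z : ST) : R := 'D_((0, basis2 i) : ST) f z.

Lemma st_line (h : R) (v z : ST) : h *: v + z = (h * v.1 + z.1, h *: v.2 + z.2).
Proof. by case: v z => [a b] [c d]. Qed.

Lemma smooth_dt f : smooth f -> smooth (dt f). Proof. exact: smooth_deriv. Qed.
Lemma smooth_dx i f : smooth f -> smooth (dx i f). Proof. exact: smooth_deriv. Qed.

Lemma smooth_slice f t : smooth f -> smooth (fun y => f (t, y)).
Proof.
apply: (@smooth_affine _ _ _ _ f (fun y => (t, y)) (fun v => (0, v))).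
  exact: continuous_pairr.
by move=> v x h; rewrite st_line /= mulr0 add0r.
Qed.

Lemma partial_slice f t i x : smooth f -> partial i (fun y => f (t, y)) x = dx i f (t, x).
Proof.
move=> sf; rewrite /partial /dx -(@derive_affine _ _ _ _ f (fun y => (t, y)) x (basis2 i))//.
by move=> h; rewrite st_line /= mulr0 add0r.
Qed.

Lemma is_derive_time f t y : smooth f -> is_derive t 1 (fun s : R => f (s, y)) (dt f (t, y)).
Proof.
move=> sf; apply: (@is_derive_affine _ _ _ _ f (fun s : R => (s, y)) t 1 (1, 0)).
  by move=> h; rewrite st_line /= scaler0 add0r.
exact: smooth_is_derive.
Qed.

Lemma smooth_time : smooth (fun z : ST => z.1).
Proof. by apply: smooth_linear => [z|v x h]; [exact: cvg_fst|rewrite st_line]. Qed.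

Lemma smooth_of_space (g : R * R -> R) : smooth g -> smooth (fun z : ST => g z.2).
Proof.
apply: (@smooth_affine _ _ _ _ g (fun z : ST => z.2) (fun v => v.2)).
  by move=> z; exact: cvg_snd.
by move=> v x h; rewrite st_line.
Qed.

Lemma smooth_space i : smooth (fun z : ST => coord2 i z.2).
Proof. exact: (smooth_of_space (@smooth_coord2 R i)). Qed.

Lemma dt_of_space (g : R * R -> R) z : smooth g -> dt (fun z : ST => g z.2) z = 0.
Proof.
move=> sg; rewrite /dt.
rewrite (@derive_affine _ _ _ _ g (fun z : ST => z.2) z (1, 0) 0 sg) ?derive0//.
Qed.

Lemma smooth_of_time (g : R -> R) : smooth g -> smooth (fun z : ST => g z.1).
Proof. by move=> sg; exact: (smooth_comp sg smooth_time). Qed.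

Lemma continuous_bounded_st f (a b : R) c r : continuous f ->
  exists2 M, 0 <= M & forall t y, a <= t <= b -> box c r y -> `|f (t, y)| <= M.
Proof.
move=> cf.
have cK : compact (f @` ([set` `[a, b]] `*` (box c r : set (R * R)))).
  apply: continuous_compact; first exact: continuous_subspaceT.
  by apply: compact_setX; [exact: segment_compact|exact: compact_box].
have [M [_ HM]] := compact_bounded cK.
exists (`|M| + 1); first by rewrite addr_ge0.
move=> t y tab By; apply: (HM (`|M| + 1)); first by rewrite (le_lt_trans (ler_norm _))// ltrDl.
by exists (t, y) => //; split => //=; rewrite in_itv.
Qed.

(** Near t all supports lie in one box, and a bound of the time derivative over that box times its
    indicator is an integrable dominating function. *)
Lemma is_derive_integral f (u v t : R) c r : smooth f -> 0 <= r -> u < t < v ->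
  (forall s y, u < s < v -> ~ box c r y -> f (s, y) = 0) ->
  is_derive t 1 (fun s : R => \int[leb2]_y f (s, y)) (\int[leb2]_y dt f (t, y)).
Proof.
move=> sf r0 utv f0.
have It : [set` `]u, v[] t by rewrite /= in_itv.
have cdt : continuous (dt f) := smooth_continuous (smooth_dt sf).
have [M M0 HM] := @continuous_bounded_st (dt f) u v c r cdt.
have cs s : u < s < v -> csupp c r (fun y => f (s, y)).
  move=> us; split => //; first exact: smooth_continuous (smooth_slice s sf).
  by move=> y; exact: f0.
have intf s : [set` `]u, v[] s -> leb2.-integrable setT (EFin \o (fun y => f (s, y))).
  by rewrite /= in_itv => /cs; exact: csupp_integrable.
have df s (y : P2) : [set` `]u, v[] s -> setT y -> derivable (fun s : R => f (s, y)) s 1.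
  by move=> _ _; have [] := is_derive_time s y sf.
pose G (y : P2) := M * \1_(box c r) y.
have G0 y : 0 <= G y by rewrite mulr_ge0.
have IG : leb2.-integrable setT (EFin \o G).
  apply: (@integrable_supported _ G c r M) => //.
  - apply: measurable_funM => //; exact: measurable_indic (measurable_box c r).
  - move=> y; rewrite ger0_norm// /G indicE ler_piMr//.
    by case: (_ \in _).
  - by move=> y yc; rewrite /G indicE memNset// mulr0.
have Gub s (y : P2) : [set` `]u, v[] s -> setT y ->
    `|partial1of2 (fun s y => f (s, y)) s y| <= G y.
  rewrite /= in_itv /= => /andP[us sv] _; rewrite partial1of2E.
  have [_ ->] := is_derive_time s y sf.
  have [yb|yb] := pselect (box c r y).
    by rewrite /G indicE mem_set// mulr1; apply: HM => //; rewrite !ltW.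
  rewrite /G indicE memNset// mulr0 -(is_deriveE (is_derive_time s y sf)).
  rewrite (near_eq_derive _ (g := cst (0:R))) ?derive_cst ?normr0//.
  near=> s'; apply: f0 => //; apply/andP; split; near: s'.
    exact: lt_nbhsr.
  exact: lt_nbhsl.
have D1 := derivable_under_integral measurableT It intf df G0 IG Gub.
have D2 := differentiation_under_integral measurableT It intf df G0 IG Gub.
split; first exact: D1.
rewrite -derive1E D2; apply: eq_Rintegral => y _.
by rewrite partial1of2E; have [_ ->] := is_derive_time t y sf.
Unshelve. all: by end_near. Qed.

(** The support is controlled slightly beyond [0, T] so that two-sided derivatives exist at both
    ends; the differential inequality itself is asked only on [0, T]. [B] is a primitive of the
    allowed growth rate [b]. *)
Lemma integral_growth_le f (T : R) (b B : R -> R) c r : 0 <= T -> smooth f -> 0 <= r ->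
  (forall s y, -1 < s < T + 1 -> ~ box c r y -> f (s, y) = 0) ->
  (forall s : R, is_derive s 1 B (b s)) ->
  (forall s, 0 <= s <= T -> \int[leb2]_y dt f (s, y) <= b s) ->
  \int[leb2]_y f (T, y) <= \int[leb2]_y f (0, y) + (B T - B 0).
Proof.
move=> T0 sf r0 f0 dB H.
have [->|Tn0] := eqVneq T 0; first by rewrite subrr addr0.
have {T0 Tn0} T0 : 0 < T by rewrite lt0r Tn0.
pose g (s : R) := \int[leb2]_y f (s, y) - B s.
have dg (s : R) : -1 < s < T + 1 -> is_derive s 1 g (\int[leb2]_y dt f (s, y) - b s).
  by move=> sT; exact: (is_derive_sub (is_derive_integral sf r0 sT f0) (dB s)).
suff : g T <= g 0 by rewrite /g; lra.
apply: (@ler0_derive1_nincr R g 0 T) => //; try exact: ltW.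
- move=> s; rewrite in_itv /= => /andP[s0 sT].
  by have [] := dg s ltac:(lra).
- move=> s; rewrite in_itv /= => /andP[s0 sT].
  rewrite derive1E; have [_ ->] := dg s ltac:(lra).
  by rewrite subr_le0 H// !ltW.
- apply: derivable_within_continuous => s; rewrite in_itv /= => /andP[s0 sT].
  by have [] := dg s ltac:(lra).
Qed.

End Space_time.

(** * The vorticity equation *)

Section Euler.
Context {R : realType}.
Local Notation ST := (R * (R * R))%type.
Implicit Types (t : R) (x y c : R * R) (i j k l : 'I_2).

Variables (u : R -> R * R -> R * R) (U : ST -> R * R) (P : R -> R * R -> R).
Hypotheses (smU : smooth U) (uU : forall t x, 0 <= t -> u t x = U (t, x)).
Hypotheses (div0 : forall t, 0 <= t -> div_free (u t)).
Hypotheses (Ppr : forall t, 0 <= t -> is_pressure (u t) (P t)).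
Hypotheses (mom : momentum_equation u P).

Definition vel k (z : ST) : R := coord2 k (U z).

Lemma smooth_vel k : smooth (vel k).
Proof.
rewrite /vel /coord2; case: (k == ord0); [exact: smooth_fst smU|exact: smooth_snd smU].
Qed.

Definition vort : ST -> R := dx 0 (vel 1) \- dx 1 (vel 0).

Lemma smooth_vort : smooth vort.
Proof. by apply: smoothB; apply: smooth_dx; exact: smooth_vel. Qed.

Lemma velE t k : 0 <= t -> (fun y => coord2 k (u t y)) = (fun y => vel k (t, y)).
Proof. by move=> t0; apply/funext => y; rewrite uU. Qed.

Lemma vorticityE t x : 0 <= t -> vorticity (u t) x = vort (t, x).
Proof.
move=> t0; rewrite /vorticity (velE 1 t0) (velE 0 t0).
by rewrite (partial_slice t 0 x (smooth_vel 1)) (partial_slice t 1 x (smooth_vel 0)).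
Qed.

Lemma vel_div0 t x : 0 <= t -> dx 0 (vel 0) (t, x) + dx 1 (vel 1) (t, x) = 0.
Proof.
move=> t0; have := div0 t0 x; rewrite big_ord_recl big_ord_recl big_ord0 addr0.
rewrite (_ : lift ord0 ord0 = 1); last exact: val_inj.
rewrite (velE 0 t0) (velE 1 t0).
by rewrite (partial_slice t 0 x (smooth_vel 0)) (partial_slice t 1 x (smooth_vel 1)).
Qed.

(** The equation is given with a right derivative. [U] is smooth also across t = 0, so its two-sided
    time derivative has the same value. *)
Lemma momentum t x k : 0 <= t ->
  dt (vel k) (t, x) =
  - (vel 0 (t, x) * dx 0 (vel k) (t, x) + vel 1 (t, x) * dx 1 (vel k) (t, x)) - partial k (P t) x.
Proof.
move=> t0.
have := @mom t t0 x k.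
rewrite big_ord_recl big_ord_recl big_ord0 addr0.
rewrite (_ : lift ord0 ord0 = 1); last exact: val_inj.
rewrite (velE k t0) (partial_slice t 0 x (smooth_vel k)) (partial_slice t 1 x (smooth_vel k)).
rewrite (uU x t0) -/(vel 0 (t, x)) -/(vel 1 (t, x)) => L1.
have [/cvg_ex[l Hl] D] := is_derive_time t x (smooth_vel k).
have El : l = dt (vel k) (t, x).
  by rewrite -D /derive; apply/esym/cvg_lim.
rewrite -El.
have L2 : h^-1 * (coord2 k (u (t + h) x) - coord2 k (U (t, x))) @[h --> 0^'+] --> l.
  have : (h^-1 *: (((fun s : R => vel k (s, x)) \o shift t) (h *: (1 : R)) - vel k (t, x))) @[h --> 0^'+] --> l.
    exact: (cvg_dnbhs_at_right Hl).
  apply: cvg_trans; apply: near_eq_cvg; near=> h.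
  have h0 : 0 < h by near: h; exact: nbhs_right_gt.
  rewrite uU; last by rewrite addr_ge0// ltW.
  have -> : h *: (1 : R) = h by exact: mulr1.
  by rewrite /= (addrC t h).
exact: (cvg_unique _ L2 L1).
Unshelve. all: by end_near. Qed.

Lemma dxC i j (f : ST -> R) z : smooth f -> dx i (dx j f) z = dx j (dx i f) z.
Proof. by move=> sf; exact: derive_comm. Qed.

Lemma dt_dxC i (f : ST -> R) z : smooth f -> dt (dx i f) z = dx i (dt f) z.
Proof. by move=> sf; exact: derive_comm. Qed.

Lemma partialC i j (f : R * R -> R) x : smooth f -> partial i (partial j f) x = partial j (partial i f) x.
Proof. by move=> sf; exact: derive_comm. Qed.

Lemma partial_momentum_rhs i x (v0 v1 w0 w1 q : R * R -> R) (a0 a1 b0 b1 : R) :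
  smooth v0 -> smooth v1 -> smooth w0 -> smooth w1 -> smooth q ->
  partial i v0 x = a0 -> partial i v1 x = a1 -> partial i w0 x = b0 -> partial i w1 x = b1 ->
  partial i (fun y => - (v0 y * w0 y + v1 y * w1 y) - q y) x =
  - (v0 x * b0 + w0 x * a0 + (v1 x * b1 + w1 x * a1)) - partial i q x.
Proof.
move=> s0 s1 t0 t1 sq <- <- <- <-.
have D f : smooth f -> is_derive x (basis2 i) f (partial i f x).
  by move=> sf; exact: smooth_is_derive.
have := is_deriveE (is_derive_sub (is_derive_cmul (-1) (is_derive_add (is_derive_mul (D _ s0) (D _ t0))
   (is_derive_mul (D _ s1) (D _ t1)))) (D _ sq)).
have -> : (fun y => -1 * (v0 y * w0 y + v1 y * w1 y) - q y) = (fun y => - (v0 y * w0 y + v1 y * w1 y) - q y).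
  by apply/funext => y; rewrite mulN1r.
by rewrite mulN1r.
Qed.

Lemma dx_momentum i k t x : 0 <= t ->
  dx i (dt (vel k)) (t, x) =
  - (vel 0 (t, x) * dx i (dx 0 (vel k)) (t, x) + dx 0 (vel k) (t, x) * dx i (vel 0) (t, x)
    + (vel 1 (t, x) * dx i (dx 1 (vel k)) (t, x) + dx 1 (vel k) (t, x) * dx i (vel 1) (t, x)))
  - partial i (partial k (P t)) x.
Proof.
move=> t0.
have sv j : smooth (vel j) := smooth_vel j.
have sd j : smooth (dx j (vel k)) := smooth_dx j (sv k).
have sP : smooth (P t) by case: (Ppr t0).
have E1 := esym (partial_slice t i x (smooth_dt (sv k))).
have E2 : (fun y => dt (vel k) (t, y)) = (fun y => - (vel 0 (t, y) * dx 0 (vel k) (t, y)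
     + vel 1 (t, y) * dx 1 (vel k) (t, y)) - partial k (P t) y).
  by apply/funext => y; exact: momentum.
have E3 := partial_momentum_rhs (smooth_slice t (sv 0)) (smooth_slice t (sv 1))
  (smooth_slice t (sd 0)) (smooth_slice t (sd 1)) (smooth_partial k sP)
  (partial_slice t i x (sv 0)) (partial_slice t i x (sv 1))
  (partial_slice t i x (sd 0)) (partial_slice t i x (sd 1)).
exact: (etrans E1 (etrans (congr1 (fun f => partial i f x) E2) E3)).
Qed.

(** Here a, b, d, e are the derivatives d_0 v_0, d_1 v_1, d_0 v_1, d_1 v_0, while X and Y collect
    the second derivatives of v_1 and v_0. The pressure terms q, q' cancel by Schwarz's theorem, and
    the remaining term is (a + b) times the vorticity, which is 0. *)
Lemma vorticity_algebra (a b d e v0 v1 X00 X01 X10 Y01 Y10 Y11 q q' T1 T2 V0 V1 T : R) :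
  a + b = 0 -> X10 = X01 -> Y10 = Y01 -> q = q' ->
  T1 = - (v0 * X00 + d * a + (v1 * X01 + b * d)) - q ->
  T2 = - (v0 * Y10 + a * e + (v1 * Y11 + e * b)) - q' ->
  V0 = X00 - Y01 -> V1 = X10 - Y11 -> T = T1 - T2 -> T = - (v0 * V0 + v1 * V1).
Proof. by move=> /eqP; rewrite addr_eq0 => /eqP -> -> -> -> -> -> -> -> ->; ring. Qed.

Lemma vorticity_equation t x : 0 <= t ->
  dt vort (t, x) = - (vel 0 (t, x) * dx 0 vort (t, x) + vel 1 (t, x) * dx 1 vort (t, x)).
Proof.
move=> t0.
have sv k : smooth (vel k) := smooth_vel k.
have sd i k : smooth (dx i (vel k)) := smooth_dx i (sv k).
have sP : smooth (P t) by case: (Ppr t0).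
have dxV i : dx i vort (t, x) = dx i (dx 0 (vel 1)) (t, x) - dx i (dx 1 (vel 0)) (t, x).
  exact: (smooth_deriveB _ _ (sd 0 1) (sd 1 0)).
have dtV : dt vort (t, x) = dt (dx 0 (vel 1)) (t, x) - dt (dx 1 (vel 0)) (t, x).
  exact: (smooth_deriveB _ _ (sd 0 1) (sd 1 0)).
have E1 := etrans (dt_dxC 0 (t, x) (sv 1)) (dx_momentum 0 1 x t0).
have E2 := etrans (dt_dxC 1 (t, x) (sv 0)) (dx_momentum 1 0 x t0).
exact: (vorticity_algebra (vel_div0 x t0) (dxC 1 0 (t, x) (sv 1)) (dxC 1 0 (t, x) (sv 0))
  (partialC 0 1 x sP) E1 E2 (dxV 0) (dxV 1) dtV).
Qed.

End Euler.

(** * Averages of the velocity *)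

Section Divergence_free.
Context {R : realType}.
Local Notation leb2 := (@lebesgue2 R).
Implicit Types (x y c : R * R) (i j k l : 'I_2).

Lemma integral_csupp_sub (f g : R * R -> R) c r : csupp c r f -> csupp c r g ->
  \int[leb2]_x (f x - g x) = \int[leb2]_x f x - \int[leb2]_x g x.
Proof.
by move=> sf sg; rewrite RintegralB//; [exact: csupp_integrable sf|exact: csupp_integrable sg].
Qed.

Lemma integral_csupp_add (f g : R * R -> R) c r : csupp c r f -> csupp c r g ->
  \int[leb2]_x (f x + g x) = \int[leb2]_x f x + \int[leb2]_x g x.
Proof.
by move=> sf sg; rewrite RintegralD//; [exact: csupp_integrable sf|exact: csupp_integrable sg].
Qed.

Lemma integral_csupp_opp (f : R * R -> R) c r : csupp c r f ->
  \int[leb2]_x (- f x) = - \int[leb2]_x f x.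
Proof.
move=> sf; rewrite -mulN1r -RintegralZl//; last exact: csupp_integrable sf.
by apply: eq_Rintegral => x _; rewrite mulN1r.
Qed.

Lemma partialM i (f g : R * R -> R) x : smooth f -> smooth g ->
  partial i (fun y => f y * g y) x = f x * partial i g x + g x * partial i f x.
Proof. by move=> sf sg; exact: smooth_deriveM. Qed.

Variables (v : 'I_2 -> R * R -> R).
Hypotheses (sv : forall i, smooth (v i)).
Hypotheses (dv : forall x, partial 0 (v 0) x + partial 1 (v 1) x = 0).

(** Integration by parts; the term in which the velocity is differentiated carries its
    divergence. *)
Lemma integral_transport (f g : R * R -> R) c r : smooth f -> smooth g -> csupp c r g ->
  \int[leb2]_y ((v 0 y * partial 0 f y + v 1 y * partial 1 f y) * g y) =
  - \int[leb2]_y (f y * (v 0 y * partial 0 g y + v 1 y * partial 1 g y)).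
Proof.
move=> sf sg cg.
have svg i : smooth (fun y => v i y * g y) := smoothM (sv i) sg.
have cvg_ i : csupp c r (fun y => v i y * g y) := csuppMl (smooth_continuous (sv i)) cg.
have I i := integral_by_parts i sf (svg i) (cvg_ i).
have cl i : csupp c r (fun y => partial i f y * (v i y * g y)).
  exact: csuppMl (smooth_continuous (smooth_partial i sf)) (cvg_ i).
have cr i : csupp c r (fun y => f y * partial i (fun y => v i y * g y) y).
  exact: csuppMl (smooth_continuous sf) (csupp_partial i (svg i) (cvg_ i)).
transitivity (\int[leb2]_y (partial 0 f y * (v 0 y * g y) + partial 1 f y * (v 1 y * g y))).
  by apply: eq_Rintegral => y _; ring.
rewrite (integral_csupp_add (cl 0) (cl 1)) !I -opprD -(integral_csupp_add (cr 0) (cr 1)).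
congr (- _); apply: eq_Rintegral => y _.
rewrite !partialM//.
have := dv y; move: (partial 0 (v 0) y) (partial 1 (v 1) y) => a b /eqP; rewrite addr_eq0 => /eqP ->.
by ring.
Qed.

Definition curl2 y := partial 0 (v 1) y - partial 1 (v 0) y.

Lemma continuous_curl2 : continuous curl2.
Proof.
by move=> y; apply: cvgB; apply: smooth_continuous; exact: smooth_partial.
Qed.

Variables (b : 'I_2 -> R * R -> R) (c : R * R) (r : R).
Hypotheses (sb : forall i, smooth (b i)) (cb : forall i, csupp c r (b i)).
Hypotheses (curlb : partial 0 (b 1) =1 partial 1 (b 0)).

(** Integrating by parts throws both derivatives on [b], where they form its curl. *)
Lemma integral_curl_free (f : R * R -> R) : smooth f ->
  \int[leb2]_y (b 0 y * partial 1 f y - b 1 y * partial 0 f y) = 0.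
Proof.
move=> sf.
have I k l := integral_by_parts k sf (sb l) (cb l).
have cl k l : csupp c r (fun y => b l y * partial k f y).
  exact: csuppM (cb l) (smooth_continuous (smooth_partial k sf)).
rewrite (integral_csupp_sub (cl 1 0) (cl 0 1)).
have E k l : \int[leb2]_y (b l y * partial k f y) = - \int[leb2]_y (f y * partial k (b l) y).
  by rewrite -I; apply: eq_Rintegral => y _; rewrite mulrC.
rewrite !E (funext curlb); ring.
Qed.

(** This replaces the Biot-Savart law, and l is the index other than k. After integration by parts,
    [integral_curl_free] with f = v_l is subtracted, and the vanishing divergence leaves one
    component of [b] against the vorticity. Absolute values hide a sign that depends on k. *)
Lemma integral_div_field k : exists l,
  `|\int[leb2]_y (div2 b y * v k y)| = `|\int[leb2]_y (b l y * curl2 y)|.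
Proof.
have I i j := integral_by_parts i (sv j) (sb i) (cb i).
have cvb i j : csupp c r (fun y => v j y * partial i (b i) y).
  exact: csuppMl (smooth_continuous (sv j)) (csupp_partial i (sb i) (cb i)).
have cpb i j l : csupp c r (fun y => partial i (v j) y * b l y).
  exact: csuppMl (smooth_continuous (smooth_partial i (sv j))) (cb l).
have D : \int[leb2]_y (div2 b y * v k y) =
   - \int[leb2]_y (partial 0 (v k) y * b 0 y + partial 1 (v k) y * b 1 y).
  rewrite (integral_csupp_add (cpb 0 k 0) (cpb 1 k 1)) !I -opprD opprK.
  rewrite -(integral_csupp_add (cvb 0 k) (cvb 1 k)).
  by apply: eq_Rintegral => y _; rewrite /div2 /=; ring.
have cbw l : csupp c r (fun y => b l y * curl2 y) := csuppM (cb l) continuous_curl2.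
have cfree j : csupp c r (fun y => b 0 y * partial 1 (v j) y - b 1 y * partial 0 (v j) y).
  by apply: csuppB; apply: csuppM => //; apply: smooth_continuous; exact: smooth_partial.
case: (ord2_cases k) => kE; subst k.
  exists 1; rewrite D normrN.
  transitivity `|\int[leb2]_y ((- (b 0 y * partial 1 (v 1) y - b 1 y * partial 0 (v 1) y)) - b 1 y * curl2 y)|.
    congr (`|_|); apply: eq_Rintegral => y _.
    have := dv y; rewrite /curl2; move: (partial 0 (v 0) y) (partial 1 (v 1) y) => p q /eqP.
    by rewrite addr_eq0 => /eqP ->; ring.
  rewrite (integral_csupp_sub (csuppN (cfree 1)) (cbw 1)) (integral_csupp_opp (cfree 1)).
  by rewrite (integral_curl_free (sv 1)) oppr0 sub0r normrN.
exists 0; rewrite D normrN.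
transitivity `|\int[leb2]_y ((b 0 y * partial 1 (v 0) y - b 1 y * partial 0 (v 0) y) + b 0 y * curl2 y)|.
  congr (`|_|); apply: eq_Rintegral => y _.
  have := dv y; rewrite /curl2; move: (partial 0 (v 0) y) (partial 1 (v 1) y) => p q /eqP.
  by rewrite addr_eq0 => /eqP ->; ring.
by rewrite (integral_csupp_add (cfree 0) (cbw 0)) (integral_curl_free (sv 0)) add0r.
Qed.

End Divergence_free.

(** * Comparison of consecutive averages *)

Section High_frequency.
Context {R : realType}.
Local Notation leb2 := (@lebesgue2 R).
Implicit Types (x y c : R * R) (i j k l : 'I_2).

Lemma moll_average_cvg (f : R * R -> R) c (r : R^nat) : continuous f ->
  (forall n, 0 < r n) -> r n @[n --> \oo] --> (0 : R) ->
  \int[leb2]_y (moll c (r n) y * f y) @[n --> \oo] --> bump_mass * f c.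
Proof.
move=> cf r0 rc.
have k0 : 0 < @bump_mass R := bump_mass_gt0.
apply/cvgrPdist_le => e e0.
have d0 : 0 < e / @bump_mass R by rewrite divr_gt0.
have /cvgrPdist_lt/(_ _ d0)/nbhs_ballP[d /= dp Hd] := cf c.
have /cvgr0Pnorm_lt/(_ (d / 2)) := rc.
rewrite divr_gt0// => /(_ isT); apply: filterS => n rnd.
have rn0 := r0 n; rewrite gtr0_norm// in rnd.
have cm := csupp_moll c rn0; have cmf : csupp c (r n * 2) (fun y => moll c (r n) y * f y).
  exact: csuppM cm cf.
have -> : bump_mass * f c = \int[leb2]_y (moll c (r n) y * f c).
  by rewrite RintegralZr ?integral_moll//; exact: csupp_integrable cm.
have cmc : csupp c (r n * 2) (fun y => moll c (r n) y * f c).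
  by apply: (csuppM cm) => y; exact: cvg_cst.
rewrite -(integral_csupp_sub cmc cmf).
have cd := csuppB cmc cmf.
apply: (le_trans (le_normr_Rintegral measurableT (csupp_integrable cd))).
have I1 := integrable_norm (csupp_integrable cd).
have I2 := csupp_integrable (csuppZ (e / bump_mass) cm).
apply: (le_trans (le_Rintegral measurableT I1 I2 _)).
  move=> y _ /=; rewrite -mulrBr normrM (ger0_norm (moll_ge0 _ _ _)) mulrC.
  have [yb|yb] := pselect (box c (r n * 2) y).
    rewrite ler_wpM2r ?moll_ge0//; apply/ltW/Hd.
    case/boxP: yb => y1 y2; split; rewrite /ball/= distrC.
      by rewrite (le_lt_trans y1)//; lra.
    by rewrite (le_lt_trans y2)//; lra.
  by case: cm => _ _ h; rewrite h// !mulr0.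
rewrite RintegralZl//; last exact: csupp_integrable cm.
by rewrite integral_moll// divfK// gt_eqF.
Qed.

(** The two mollifiers differ by the divergence of a curl-free field, so only the vorticity enters.
    It is bounded through a majorant with a free parameter [a], to be fixed at each scale when the
    scales are summed. *)
Lemma high_frequency_step : exists2 B : R, 0 <= B & forall (v : 'I_2 -> R * R -> R) (h : R * R -> R) c r k (a : R) c' r',
  (forall i, smooth (v i)) -> (forall x, partial 0 (v 0) x + partial 1 (v 1) x = 0) ->
  0 < r -> 0 < a -> csupp c' r' h -> (forall y, 0 <= h y) ->
  (forall y, box c (6 * r) y -> `|curl2 v y| <= a ^+ 3 * h y + a^-1) ->
  `|\int[leb2]_y (moll c r y * v k y) - \int[leb2]_y (moll c (4 * r) y * v k y)| <=
    B * r^-1 * (a ^+ 3 * \int[leb2]_y h y + a^-1 * (2 * (6 * r)) ^+ 2).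
Proof.
have [B B0 HB] := @moll_field_bounds R.
exists B => // v h c r k a c' r' sv dv r0 a0 ch h0 Hh.
have cm1 : csupp c (4 * r * 2) (moll c r).
  by apply: csuppW (csupp_moll c r0); [apply: box_le; lra|lra].
have cm2 : csupp c (4 * r * 2) (moll c (4 * r)) by apply: csupp_moll; rewrite mulr_gt0.
have cv := smooth_continuous (sv k).
rewrite -(integral_csupp_sub (csuppM cm1 cv) (csuppM cm2 cv)).
have -> : \int[leb2]_y (moll c r y * v k y - moll c (4 * r) y * v k y) =
          \int[leb2]_y (div2 (moll_field c r) y * v k y).
  by apply: eq_Rintegral => y _; rewrite div_moll_field// mulrBl.
have sb l := @smooth_moll_field R c r l.
have cb l : csupp c (6 * r) (moll_field c r l) by rewrite mulrC; exact: csupp_moll_field.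
have [l ->] := integral_div_field sv dv sb cb (curl_moll_field c 0 1 r0) k.
have cbw : csupp c (6 * r) (fun y => moll_field c r l y * curl2 v y).
  exact: csuppM (cb l) (continuous_curl2 sv).
apply: (le_trans (le_normr_Rintegral measurableT (csupp_integrable cbw))).
have r6 : 0 <= 6 * r by rewrite mulr_ge0// ltW.
have I1 := integrable_norm (csupp_integrable cbw).
have Ih := csupp_integrable (csuppZ (a ^+ 3) ch).
have Ib : leb2.-integrable setT (EFin \o (fun y => a^-1 * \1_(box c (6 * r)) y)).
  apply: (@integrable_supported _ _ c (6 * r) a^-1) => //.
  - apply: measurable_funM => //; exact: measurable_indic (measurable_box c _).
  - move=> y; have ai : 0 <= a^-1 by rewrite invr_ge0 ltW.
    by rewrite ger0_norm ?mulr_ge0// indicE ler_piMr//; case: (_ \in _).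
  - by move=> y yc; rewrite indicE memNset// mulr0.
have Is := integrableD measurableT Ih Ib.
have Br : 0 <= B * r^-1 by rewrite mulr_ge0// invr_ge0 ltW.
have I2 := integrableZl measurableT (B * r^-1) Is.
apply: (le_trans (le_Rintegral measurableT I1 I2 _)).
  move=> y _ /=; rewrite normrM.
  have ai : 0 <= a^-1 by rewrite invr_ge0 ltW.
  have [yb|yb] := pselect (box c (6 * r) y).
    rewrite indicE mem_set// mulr1 ler_pM//; last exact: Hh.
    by have [hh _] := HB c r r0 y l.
  case: (cb l) => _ _ -> //; rewrite normr0 mul0r; apply: mulr_ge0 => //.
  apply: addr_ge0; apply: mulr_ge0 => //; exact: exprn_ge0 (ltW a0).
rewrite RintegralZl// ler_wpM2l// RintegralD// RintegralZl//; last exact: csupp_integrable ch.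
rewrite lerD2l RintegralZl//; last first.
  apply: (@integrable_supported _ _ c (6 * r) 1) => //.
  - exact: measurable_indic (measurable_box c _).
  - by move=> y; rewrite ger0_norm// indicE; case: (_ \in _).
  - by move=> y yc; rewrite indicE memNset.
rewrite ler_wpM2l ?invr_ge0 ?(ltW a0)//.
rewrite /Rintegral integral_indic//; last exact: measurable_box.
by rewrite setIT lebesgue2_box.
Qed.

End High_frequency.

(** * Evolution of an average of the velocity *)

Section Low_frequency.
Context {R : realType}.
Local Notation leb2 := (@lebesgue2 R).
Local Notation ST := (R * (R * R))%type.
Implicit Types (t : R) (x y c : R * R) (i j k l : 'I_2).

Lemma csupp_test_function (f : R * R -> R) c r : smooth f -> csupp c r f -> test_function f.
Proof.
move=> sf [r0 cf f0]; split => //.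
apply: (@subclosed_compact _ _ (box c r : set (R * R))).
- exact: closed_closure.
- exact: compact_box.
apply: (@subset_trans _ (closure (box c r : set (R * R)))); last exact: closed_box.
apply: closureS => y /= fy.
by apply: contrapT => yc; move: fy; rewrite f0 ?eqxx.
Qed.

Definition euler_flow (u : R -> R * R -> R * R) (U : ST -> R * R) (P : R -> R * R -> R) : Prop :=
  [/\ smooth U, forall t x, 0 <= t -> u t x = U (t, x),
      forall t, 0 <= t -> div_free (u t),
      forall t, 0 <= t -> is_pressure (u t) (P t) &
      momentum_equation u P].

Lemma pressure_force_le : exists2 K : R, 0 <= K & forall u U P t c r k (V : R),
  euler_flow u U P -> 0 <= t -> 0 < r -> (forall k x, `|vel U k (t, x)| <= V) ->
  `|\int[leb2]_y (partial k (P t) y * moll c r y)| <= K * V ^+ 2 / r.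
Proof.
have [K K0 HK] := @pressure_pairing_le R.
exists (4 * K); first by rewrite mulr_ge0.
move=> u U P t c r k V [smU uU div0 Ppr mom] t0 r0 HV.
have [_ Pk] := Ppr t t0.
rewrite (Pk k _ (csupp_test_function (smooth_moll c r) (csupp_moll c r0))).
have H i j : `|multiplier_pairing (pressure_symbol k i j)
        (fun x => coord2 i (u t x) * coord2 j (u t x)) (moll c r)| <= V ^+ 2 * (K / r).
  have E : (fun x => coord2 i (u t x) * coord2 j (u t x)) = (fun x => vel U i (t, x) * vel U j (t, x)).
    by apply/funext => x; rewrite uU.
  rewrite E; apply: (HK c r k i j _ (V ^+ 2) r0).
    apply: smooth_continuous; apply: smoothM; apply: smooth_slice; exact: smooth_vel.
  by move=> x; rewrite normrM expr2; apply: ler_pM => //; exact: HV.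
apply: (le_trans (ler_norm_sum _ _ _)).
apply: (@le_trans _ _ (\sum_(i < 2) \sum_(j < 2) (V ^+ 2 * (K / r)))).
  by apply: ler_sum => i _; apply: (le_trans (ler_norm_sum _ _ _)); apply: ler_sum => j _; exact: H.
rewrite !sumr_const !card_ord -!mulrnA.
set a := V ^+ 2; rewrite -mulr_natl.
rewrite le_eqVlt; apply/orP; left; apply/eqP; rewrite -[K / r]/(K * r^-1); ring.
Qed.

Lemma momentum_mollified_le : exists2 K : R, 0 <= K & forall u U P t c r k (V : R),
  euler_flow u U P -> 0 <= t -> 0 < r -> (forall k x, `|vel U k (t, x)| <= V) ->
  `|\int[leb2]_y (moll c r y * dt (vel U k) (t, y))| <= K * V ^+ 2 / r.
Proof.
have [K1 K10 HK1] := pressure_force_le.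
have [K2 K20 HK2] := @moll_bounds R.
(* 32 = 2 * 4^2: two terms in v . grad moll, on a square of side 4 r. *)
exists (32 * K2 + K1); first by rewrite addr_ge0// mulr_ge0.
move=> u U P t c r k V EF t0 r0 HV.
have [smU uU div0 Ppr mom] := EF.
have V0 : 0 <= V := le_trans (normr_ge0 _) (HV 0 (0, 0)).
pose v i := fun y : R * R => vel U i (t, y).
have sv i : smooth (v i) := smooth_slice t (smooth_vel smU i).
have dv x : partial 0 (v 0) x + partial 1 (v 1) x = 0.
  apply: etrans (vel_div0 smU uU div0 x t0).
  exact: (congr2 +%R (partial_slice t 0 x (smooth_vel smU 0)) (partial_slice t 1 x (smooth_vel smU 1))).
have sm := smooth_moll c r; have cm := csupp_moll c r0.
have sP : smooth (P t) by case: (Ppr t t0).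
have cP := smooth_continuous (smooth_partial k sP).
have cvk := smooth_continuous (sv k).
have cv i := smooth_continuous (sv i).
have sp i := smooth_partial i (sv k).
pose T y := (v 0 y * partial 0 (v k) y + v 1 y * partial 1 (v k) y) * moll c r y.
have cT : csupp c (r * 2) T.
  apply: (csuppMl _ cm) => y; apply: cvgD; apply: cvgM; solve [exact: cv | exact: (smooth_continuous (sp _))].
have cQ : csupp c (r * 2) (fun y => partial k (P t) y * moll c r y) := csuppMl cP cm.
have -> : \int[leb2]_y (moll c r y * dt (vel U k) (t, y)) =
  \int[leb2]_y ((- T y) - partial k (P t) y * moll c r y).
  apply: eq_Rintegral => y _; rewrite (momentum smU uU mom y k t0) /T.
  rewrite -(partial_slice t 0 y (smooth_vel smU k)) -(partial_slice t 1 y (smooth_vel smU k)).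
  rewrite -/(v k) -/(v 0 y) -/(v 1 y).
  move: (partial k _ y) (partial 0 _ y) (partial 1 _ y) (moll c r y) (v 0 y) (v 1 y) => a b d e f g.
  by ring.
rewrite (integral_csupp_sub (csuppN cT) cQ) (integral_csupp_opp cT).
rewrite (integral_transport sv dv (sv k) sm cm) opprK.
apply: (le_trans (ler_normB _ _)).
rewrite !mulrDl; apply: lerD; last exact: (HK1 u U P t c r k V EF t0 r0 HV).
have cS : csupp c (r * 2) (fun y => v k y * (v 0 y * partial 0 (moll c r) y + v 1 y * partial 1 (moll c r) y)).
  apply: (csuppMl cvk).
  by apply: csuppD; (apply: csuppMl; [exact: cv|exact: csupp_partial sm cm]).
have B y : `|v k y * (v 0 y * partial 0 (moll c r) y + v 1 y * partial 1 (moll c r) y)| <= V * (2 * (V * (K2 / r ^+ 3))).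
  have [_ Hp] := HK2 c r r0 y.
  rewrite normrM; apply: ler_pM => //; first exact: HV.
  apply: (le_trans (ler_normD _ _)); rewrite mulr_natl mulr2n; apply: lerD; rewrite normrM; apply: ler_pM => //; exact: HV.
apply: (le_trans (csupp_integral_le cS B)).
have r1 : r != 0 by rewrite gt_eqF.
rewrite le_eqVlt; apply/orP; left; apply/eqP.
move: (K2) (V) => a b; clear -r1; by field.
Qed.

Lemma expR_growth (s lam G K : R) : lam != 0 ->
  is_derive s 1 (fun s : R => K * G ^+ 2 / (2 * lam) * expR (2 * lam * s)) (K * (G * expR (lam * s)) ^+ 2).
Proof.
move=> l0.
have D : is_derive s 1 (fun s : R => expR (2 * lam * s)) (expR (2 * lam * s) * (2 * lam)).
  apply: (@is_derive_chain R _ expR (fun s : R => 2 * lam * s) s 1 (2 * lam) _).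
  by apply: is_derive_linear.
have := is_derive_cmul (K * G ^+ 2 / (2 * lam)) D.
move=> H; suff <- : K * G ^+ 2 / (2 * lam) * (expR (2 * lam * s) * (2 * lam)) = K * (G * expR (lam * s)) ^+ 2 by exact: H.
have -> : expR (2 * lam * s) = expR (lam * s) ^+ 2 by rewrite -expRM_natl mulrA.
move: (expR (lam * s)) => e; clear -l0; by field.
Qed.

(** The rate of change is at most a constant times (G e^(lam s))^2 / r, and integrating this
    exponential in time produces the factor 1 / lam. *)
Lemma mollified_velocity_le : exists2 K : R, 0 <= K & forall u U P T c r k (G lam : R),
  euler_flow u U P -> 0 <= T -> 0 < r -> 0 < lam ->
  (forall t k x, 0 <= t <= T -> `|vel U k (t, x)| <= G * expR (lam * t)) ->
  `|\int[leb2]_y (moll c r y * vel U k (T, y))| <=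
  `|\int[leb2]_y (moll c r y * vel U k (0, y))| + K * (G * expR (lam * T)) ^+ 2 / (lam * r).
Proof.
have [K K0 HK] := momentum_mollified_le.
exists K => // u U P T c r k G lam EF T0 r0 lam0 HG.
have [smU uU div0 Ppr mom] := EF.
have sm := smooth_moll c r; have cm := csupp_moll c r0.
have svk := smooth_vel smU k.
have smx : smooth (fun z : ST => moll c r z.2) := smooth_of_space sm.
have r2 : 0 <= r * 2 by rewrite mulr_ge0// ltW.
have ln0 : lam != 0 by rewrite gt_eqF.
pose B s := K / r * G ^+ 2 / (2 * lam) * expR (2 * lam * s).
have dB (s : R) : is_derive s 1 B (K / r * (G * expR (lam * s)) ^+ 2) := expR_growth s G (K / r) ln0.
(* Here e is a sign: the growth lemma is one-sided, and its two instances bound the absolute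
   value. *)
have G1 (e : R) : e ^+ 2 = 1 -> e * \int[leb2]_y (moll c r y * vel U k (T, y)) <=
   e * \int[leb2]_y (moll c r y * vel U k (0, y)) + (B T - B 0).
  move=> e1.
  have ne : `|e| = 1.
    by apply/eqP; rewrite -(@eqrXn2 _ 2)// expr1n -normrX e1 normr1.
  have cmv t : csupp c (r * 2) (fun y => moll c r y * vel U k (t, y)).
    exact: csuppM cm (smooth_continuous (smooth_slice t svk)).
  have cmd t : csupp c (r * 2) (fun y => moll c r y * dt (vel U k) (t, y)).
    exact: csuppM cm (smooth_continuous (smooth_slice t (smooth_dt svk))).
  rewrite -!RintegralZl//; try exact: csupp_integrable (cmv _).
  pose f (z : ST) := e * (moll c r z.2 * vel U k z).
  have sf : smooth f by exact: smoothZ (smoothM smx svk).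
  have dtf s y : dt f (s, y) = e * (moll c r y * dt (vel U k) (s, y)).
    have := is_deriveE (is_derive_cmul e (is_derive_mul (smooth_is_derive ((1, 0) : ST) (s, y) smx) (smooth_is_derive ((1, 0) : ST) (s, y) svk))).
    move=> H; apply: (etrans H); congr (e * _).
    have := dt_of_space (s, y) sm; rewrite {1}/dt => ->.
    by rewrite mulr0 addr0.
  apply: (@integral_growth_le _ f T (fun s => K / r * (G * expR (lam * s)) ^+ 2) B c (r * 2) T0 sf r2) => //.
    by move=> s y _ yc; rewrite /f /=; case: cm => _ _ ->//; rewrite mul0r mulr0.
  move=> s sT.
  have -> : \int[leb2]_y dt f (s, y) = e * \int[leb2]_y (moll c r y * dt (vel U k) (s, y)).
    rewrite -RintegralZl//; last exact: csupp_integrable (cmd s).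
    by apply: eq_Rintegral => y _; rewrite dtf.
  apply: (le_trans (ler_norm _)); rewrite normrM ne mul1r.
  have /andP[s0 _] := sT.
  rewrite mulrAC.
  by apply: (HK u U P s c r k _ EF s0 r0) => k' x; exact: HG.
have BT : B T - B 0 <= K * (G * expR (lam * T)) ^+ 2 / (lam * r).
  have eE : expR (2 * lam * T) = expR (lam * T) ^+ 2 by rewrite -expRM_natl mulrA.
  have B00 : 0 <= B 0.
    rewrite /B; apply: mulr_ge0; last exact: expR_ge0.
    apply: divr_ge0; last by rewrite mulr_ge0// ltW.
    by apply: mulr_ge0 (sqr_ge0 _); apply: divr_ge0 => //; exact: ltW.
  (* The primitive of e^(2 lam s) gives twice the gain that is claimed. *)
  have BTE : B T = K * (G * expR (lam * T)) ^+ 2 / (lam * r) / 2.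
    rewrite /B eE; move: (expR _) => e; have r1 : r != 0 by rewrite gt_eqF.
    clear -r1 ln0; by field; rewrite ln0 r1.
  have X0 : 0 <= K * (G * expR (lam * T)) ^+ 2 / (lam * r).
    apply: divr_ge0; last by apply: mulr_ge0; exact: ltW.
    by apply: mulr_ge0 (sqr_ge0 _).
  move: X0 B00; rewrite BTE; move: (K * _ / _) (B 0) => a b; lra.
rewrite ler_norml; apply/andP; split.
  have := G1 (-1) ltac:(ring); move: BT; rewrite !mulN1r.
  have := ler_norm (- \int[leb2]_y (moll c r y * vel U k (0, y))); rewrite normrN.
  by move: (\int[leb2]_y _) (\int[leb2]_y _) (`|_|) (B T - B 0) (_ / _) => a b d e f; lra.
have := G1 1 ltac:(ring); move: BT; rewrite !mul1r.
have := ler_norm (\int[leb2]_y (moll c r y * vel U k (0, y))).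
by move: (\int[leb2]_y _) (\int[leb2]_y _) (`|_|) (B T - B 0) (_ / _) => a b d e f; lra.
Qed.

End Low_frequency.

(** * Summation over the scales *)

Section High_frequency_sum.
Context {R : realType}.
Local Notation leb2 := (@lebesgue2 R).
Implicit Types (x y c : R * R) (k : 'I_2).

Lemma cvg_half_sqr (s : R) : (s / 2 ^+ n) ^+ 2 @[n --> \oo] --> (0 : R).
Proof.
have H : (geometric s 2^-1 : R^nat) @ \oo --> (0 : R).
  by apply: cvg_geometric; rewrite gtr0_norm ?invr_gt0// invf_lt1// ltr1n.
have -> : (fun n => (s / 2 ^+ n) ^+ 2) = (fun n => geometric s 2^-1 n * geometric s 2^-1 n).
  by apply/funext => n /=; rewrite exprVn expr2.
by rewrite -(mulr0 0); apply: cvgM.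
Qed.

(** With radius (s / q)^2 and a = s / (q w), both terms of [high_frequency_step] are multiples of s
    / q, so q = 2^n gives a geometric series. The radius is written as a square because a is
    proportional to its square root. *)
Lemma high_frequency_scale (B d s w q : R) : s != 0 -> w != 0 -> q != 0 ->
  B * ((s / q) ^+ 2)^-1 * ((s / q / w) ^+ 3 * d + (s / q / w)^-1 * (2 * (6 * (s / q) ^+ 2)) ^+ 2) =
  B * s * (d / w ^+ 3 + 144 * w) / q.
Proof. by move=> s0 w0 q0; field; rewrite q0 s0 w0. Qed.

Lemma halving_sum (x q : R) : q != 0 -> x / (2 * q) + x * (1 - q^-1) = x * (1 - (2 * q)^-1).
Proof. by move=> q0; field. Qed.

(* Between the scales (s / 2^n)^2 and (s / 2^n.+1)^2 the vorticity is estimated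
   with a = s / (2^n.+1 w), and the errors form a geometric series. *)
Lemma mean_sub_average_le : exists2 C : R, 0 <= C & forall (v : 'I_2 -> R * R -> R) (h : R * R -> R) c s k (w : R) c' r',
  (forall i, smooth (v i)) -> (forall x, partial 0 (v 0) x + partial 1 (v 1) x = 0) ->
  0 < s -> 0 < w -> csupp c' r' h -> (forall y, 0 <= h y) ->
  (forall (a : R) y, 0 < a -> box c (6 * s ^+ 2) y -> `|curl2 v y| <= a ^+ 3 * h y + a^-1) ->
  `|bump_mass * v k c| <= `|\int[leb2]_y (moll c (s ^+ 2) y * v k y)| +
    C * s * (\int[leb2]_y h y / w ^+ 3 + w).
Proof.
have [B B0 HB] := @high_frequency_step R.
exists (144 * B); first by rewrite mulr_ge0.
move=> v h c s k w c' r' sv dv s0 w0 ch h0 Hh.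
pose A n : R := \int[leb2]_y (moll c ((s / 2 ^+ n) ^+ 2) y * v k y).
set H := \int[leb2]_y h y.
have H0 : 0 <= H by apply: Rintegral_ge0 => y _; exact: h0.
have sn0 n : 0 < s / 2 ^+ n by rewrite divr_gt0// exprn_gt0.
pose X := B * s * (H / w ^+ 3 + 144 * w).
have stepA n : `|A n.+1 - A n| <= X / 2 ^+ n.+1.
  have r0 : 0 < (s / 2 ^+ n.+1) ^+ 2 by rewrite exprn_gt0.
  have a0 : 0 < (s / 2 ^+ n.+1) / w by rewrite divr_gt0.
  have HH := HB v h c ((s / 2 ^+ n.+1) ^+ 2) k ((s / 2 ^+ n.+1) / w) c' r' sv dv r0 a0 ch h0.
  have E4 : 4 * (s / 2 ^+ n.+1) ^+ 2 = (s / 2 ^+ n) ^+ 2.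
    have n2 : (2 : R) ^+ n != 0 by rewrite expf_neq0.
    rewrite (exprS 2 n); move: (2 ^+ n) n2 => q q0; clear -q0; by field.
  rewrite E4 in HH.
  apply: (le_trans (HH _)).
    move=> y yb; apply: Hh => //.
    apply: (box_le _ yb); apply: ler_wpM2l => //.
    have sn1 : s / 2 ^+ n.+1 <= s.
      rewrite ler_pdivrMr ?exprn_gt0// ler_peMr//; first exact: ltW.
      by rewrite exprn_ege1// ler1n.
    by apply: lerXn2r => //; rewrite nnegrE; exact: ltW.
  by rewrite high_frequency_scale ?gt_eqF ?exprn_gt0.
have sumA n : `|A n - A 0%N| <= X * (1 - (2 ^+ n)^-1).
  elim: n => [|n IH]; first by rewrite subrr normr0 expr0 invr1 subrr mulr0.
  have E (a b d : R) : a - b = (a - d) + (d - b) by ring.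
  rewrite (E _ _ (A n)).
  apply: (le_trans (ler_normD _ _)); apply: (le_trans (lerD (stepA n) IH)).
  have n2 : (2 : R) ^+ n != 0 by rewrite expf_neq0.
  by rewrite (exprS 2 n) halving_sum.
have X0 : 0 <= X.
  apply: mulr_ge0; first by apply: mulr_ge0 => //; exact: ltW.
  apply: addr_ge0; last by rewrite mulr_ge0// ltW.
  by apply: divr_ge0 => //; apply: exprn_ge0; exact: ltW.
have boundA n : `|A n| <= `|A 0%N| + X.
  rewrite -[A n in X in X <= _](addrNK (A 0%N)) addrC.
  apply: (le_trans (ler_normD _ _)); rewrite lerD2l.
  apply: (le_trans (sumA n)); rewrite ler_piMr// gerBl invr_ge0 exprn_ge0.
have cvA : A n @[n --> \oo] --> bump_mass * v k c.
  have r0 n : 0 < (s / 2 ^+ n) ^+ 2 by rewrite exprn_gt0.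
  exact: (@moll_average_cvg _ (v k) c (fun n => (s / 2 ^+ n) ^+ 2) (smooth_continuous (sv k)) r0 (cvg_half_sqr s)).
have cvN : `|A n| @[n --> \oo] --> `|bump_mass * v k c| by exact: cvg_norm.
have L : `|bump_mass * v k c| <= `|A 0%N| + X.
  rewrite -(cvg_lim _ cvN)//; apply: limr_le; first by apply/cvg_ex; eexists; exact: cvN.
  exact: nearW.
have -> : moll c (s ^+ 2) = moll c ((s / 2 ^+ 0) ^+ 2) by rewrite expr0 divr1.
apply: (le_trans L); rewrite -/(A 0%N) lerD2l /X.
have Hw : 0 <= H / w ^+ 3 by rewrite divr_ge0// exprn_ge0// ltW.
have -> : 144 * B * s * (H / w ^+ 3 + w) = B * s * (144 * (H / w ^+ 3) + 144 * w) by ring.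
apply: ler_wpM2l; first by rewrite mulr_ge0// ltW.
by rewrite lerD2r ler_peMl// ler1n.
Qed.

End High_frequency_sum.

(** * Transport of the vorticity *)

Section Bracket.
Context {R : realType}.
Implicit Types (q s a b p : R).

(** A substitute for |s|^(2q) which is smooth for every real q, positive, and convex once q >= 1/2,
    that is for every Lebesgue exponent p = 2q >= 1. *)
Definition bracket q s : R := powR (1 + s ^+ 2) q.

Lemma sqr1_gt0 s : 0 < 1 + s ^+ 2.
Proof. by rewrite ltr_pwDl// sqr_ge0. Qed.

Lemma sqr1_ge0 s : 0 <= 1 + s ^+ 2.
Proof. exact: ltW (sqr1_gt0 s). Qed.

Lemma bracket_gt0 q s : 0 < bracket q s.
Proof. exact: powR_gt0 (sqr1_gt0 s). Qed.

Lemma bracketE q s : bracket q s = expR (q * ln (1 + s ^+ 2)).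
Proof. by rewrite /bracket /powR gt_eqF ?sqr1_gt0. Qed.

Lemma bracket_succ q s : bracket (q + 1) s = bracket q s * (1 + s ^+ 2).
Proof.
rewrite /bracket powRD; last by apply/implyP => _; rewrite gt_eqF ?sqr1_gt0.
by rewrite powRr1// ltW// sqr1_gt0.
Qed.

Lemma is_derive_bracket q s : is_derive (s : R) 1 (bracket q) (2 * q * s * bracket (q - 1) s).
Proof.
have D0 : is_derive (s : R) 1 (fun s : R => 1 + s * s) (0 + (s * 1 + s * 1)).
  exact: (is_derive_add (is_derive_cst _ _ _) (is_derive_mul (is_derive_id _ _) (is_derive_id _ _))).
have D1 : is_derive (s : R) 1 (@ln R \o (fun s : R => 1 + s * s)) ((1 + s * s)^-1 * (0 + (s * 1 + s * 1))).
  apply: (is_derive_chain D0); apply: is_derive1_ln.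
  by have := sqr1_gt0 s; rewrite expr2.
have D2 := is_derive_cmul q D1.
have D3 := @is_derive_chain _ _ expR _ s 1 _ _ D2 (is_derive_expR _).
have E : bracket q = expR \o (fun y : R => q * (@ln R \o (fun s : R => 1 + s * s)) y).
  by apply/funext => y; rewrite bracketE /= expr2.
rewrite -E in D3.
suff <- : expR (q * (@ln R \o (fun s : R => 1 + s * s)) s) * (q * ((1 + s * s)^-1 * (0 + (s * 1 + s * 1)))) =
  2 * q * s * bracket (q - 1) s by exact: D3.
rewrite /= -expr2 -bracketE -{1}(subrK 1 q) bracket_succ.
have := lt0r_neq0 (sqr1_gt0 s); move: (bracket _ _) => z; clear => n0; by field.
Qed.

Lemma smooth_bracket q : smooth (bracket q).
Proof.
move=> n; elim: n q => [q|n IH q].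
  move=> s; apply: differentiable_continuous; apply/derivable1_diffP.
  by have [] := is_derive_bracket q s.
apply: class_C_1D (is_derive_bracket q) _.
have S : smooth (fun s : R => 2 * q * s) := smoothZ (2 * q) (@smooth_id R).
exact: (class_CM (S n) (IH (q - 1))).
Qed.

Definition dbracket q s : R := 2 * q * s * bracket (q - 1) s.

Lemma smooth_dbracket q : smooth (dbracket q).
Proof. exact: smoothM (smoothZ (2 * q) (@smooth_id R)) (smooth_bracket (q - 1)). Qed.

(** In this factored form the sign of the second derivative for q >= 1/2 can be read off. *)
Lemma is_derive_dbracket q s : is_derive (s : R) 1 (dbracket q)
  (2 * q * bracket (q - 1 - 1) s * (1 + (2 * q - 1) * s ^+ 2)).
Proof.
have D := is_derive_mul (is_derive_linear (2 * q) s) (is_derive_bracket (q - 1) s).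
suff <- : 2 * q * s * (2 * (q - 1) * s * bracket (q - 1 - 1) s) + bracket (q - 1) s * (2 * q) =
  2 * q * bracket (q - 1 - 1) s * (1 + (2 * q - 1) * s ^+ 2) by exact: D.
have := bracket_succ (q - 1 - 1) s; rewrite subrK => ->; move: (bracket _ _) => z; ring.
Qed.

Lemma ler_of_derive_ge0 (f f' : R -> R) a b : (forall s : R, is_derive s 1 f (f' s)) ->
  (forall s, 0 <= f' s) -> a <= b -> f a <= f b.
Proof.
move=> df f0; rewrite le_eqVlt => /predU1P[->//|ab].
have cf : continuous f.
  by move=> s; apply: differentiable_continuous; apply/derivable1_diffP; have [] := df s.
have [c _ E] := @MVT R f f' a b ab (fun s _ => df s) (continuous_subspaceT cf).
by rewrite -subr_ge0 E mulr_ge0// subr_ge0 ltW.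
Qed.

(** Convexity as a tangent inequality: linear in b, so that it can be integrated when b is
    controlled only as a distribution. *)
Lemma bracket_tangent q a b : 2^-1 <= q ->
  bracket q a + dbracket q a * (b - a) <= bracket q b.
Proof.
move=> q2.
have mono x y : x <= y -> dbracket q x <= dbracket q y.
  apply: ler_of_derive_ge0; first exact: is_derive_dbracket.
  move=> s; have := bracket_gt0 (q - 1 - 1) s; move: (bracket _ _) => z z0.
  apply: mulr_ge0; first by apply: mulr_ge0 (ltW z0); lra.
  by apply: addr_ge0 => //; apply: mulr_ge0 (sqr_ge0 _); lra.
have cb : continuous (bracket q) := smooth_continuous (smooth_bracket q).
have [ab|ba|->] := ltgtP a b; last by rewrite subrr mulr0 addr0.
  have [c] := @MVT R _ _ a b ab (fun s _ => is_derive_bracket q s) (continuous_subspaceT cb).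
  rewrite in_itv /= => /andP[/ltW/mono ac _]; rewrite -/(dbracket q c) => E.
  by rewrite -lerBrDl E ler_wpM2r// subr_ge0 ltW.
have [c] := @MVT R _ _ b a ba (fun s _ => is_derive_bracket q s) (continuous_subspaceT cb).
rewrite in_itv /= => /andP[_ /ltW/mono ac]; rewrite -/(dbracket q c) => E.
rewrite -lerBrDl -(opprB a b) mulrN -(opprB (bracket q a) (bracket q b)) lerN2 E.
by rewrite ler_wpM2r// subr_ge0 ltW.
Qed.

Lemma powR_norm_le_bracket p s : 0 <= p -> powR `|s| p <= bracket (p / 2) s.
Proof.
move=> p0; rewrite /bracket.
have -> : powR `|s| p = powR (s ^+ 2) (p / 2).
  rewrite -(@real_normK _ s) ?num_real// -powR_mulrn// -powRrM.
  by congr (powR _ _); rewrite mulrCA divff ?mulr1.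
by apply: ge0_ler_powR; rewrite ?nnegrE ?sqr_ge0 ?divr_ge0 ?sqr1_ge0// lerDr.
Qed.

Lemma bracket_le_powR p s : 0 <= p -> bracket (p / 2) s <= powR 2 p * (powR `|s| p + 1).
Proof.
move=> p0; rewrite /bracket.
have m0 : 0 <= 1 + `|s| by rewrite addr_ge0.
have p20 : 0 <= p / 2 by rewrite divr_ge0.
apply: (@le_trans _ _ (powR ((1 + `|s|) ^+ 2) (p / 2))).
  apply: ge0_ler_powR; rewrite ?nnegrE ?sqr_ge0 ?sqr1_ge0//.
  rewrite sqrrD expr1n -(@real_normK _ s) ?num_real// mul1r lerD2r lerDl.
  by rewrite mulrn_wge0.
rewrite -powR_mulrn// -powRrM (_ : 2%:R * (p / 2) = p); last by rewrite mulrCA divff ?mulr1.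
have [s1|s1] := leP `|s| 1.
  apply: (@le_trans _ _ (powR 2 p)); last by rewrite ler_peMr ?powR_ge0// lerDr powR_ge0.
  by apply: ge0_ler_powR; rewrite ?nnegrE//; lra.
apply: (@le_trans _ _ (powR (2 * `|s|) p)).
  by apply: ge0_ler_powR; rewrite ?nnegrE ?mulr_ge0//; lra.
by rewrite powRM// ler_wpM2l ?powR_ge0// lerDl.
Qed.

Lemma bracket2E s : bracket 2 s = (1 + s ^+ 2) ^+ 2.
Proof. by rewrite /bracket -(powR_mulrn 2 (sqr1_ge0 s)). Qed.

(* Either [|s| <= 1/a], or [a |s| > 1] and then [|s| <= a^3 |s|^4]. *)
Lemma norm_le_bracket2 a s : 0 < a -> `|s| <= a ^+ 3 * bracket 2 s + a^-1.
Proof.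
move=> a0; rewrite bracket2E -(@real_normK _ s) ?num_real//.
move: (normr_ge0 s); move: `|s| => m m0.
have a30 : 0 <= a ^+ 3 by rewrite exprn_ge0// ltW.
have ai : 0 <= a^-1 by rewrite invr_ge0 ltW.
have [am|am] := leP (a * m) 1.
  apply: (@le_trans _ _ a^-1); first by rewrite -[a^-1]mulr1 ler_pdivlMl.
  by rewrite lerDr mulr_ge0// sqr_ge0.
apply: (@le_trans _ _ (a ^+ 3 * (1 + m ^+ 2) ^+ 2)); last by rewrite lerDl.
apply: (@le_trans _ _ (a ^+ 3 * (m ^+ 2) ^+ 2)).
  have -> : a ^+ 3 * (m ^+ 2) ^+ 2 = (a * m) ^+ 3 * m by ring.
  by rewrite ler_peMl// exprn_ege1// ltW.
apply: ler_wpM2l => //; apply: lerXn2r; rewrite ?nnegrE ?addr_ge0 ?sqr_ge0//.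
by rewrite lerDr.
Qed.

End Bracket.

(** * Cutoffs with moving edges *)

Section Cutoff.
Context {R : realType}.
Local Notation ST := (R * (R * R))%type.
Implicit Types (t r sg a b : R) (x y c : R * R) (z : ST) (i j k l : 'I_2).

(** A smooth half-plane cutoff, with sg = 1 or -1 selecting the side. Four of them make a square
    cutoff, equal to 1 up to a layer of width 1. *)
Definition edge sg i c r y : R := step (r + sg * (coord2 i y - coord2 i c)).

Definition cutoff c r y : R :=
  (edge 1 0 c r y * edge (-1) 0 c r y) * (edge 1 1 c r y * edge (-1) 1 c r y).

Lemma edge_ge0 sg i c r y : 0 <= edge sg i c r y.
Proof. exact: step_ge0. Qed.

Lemma edge_le1 sg i c r y : edge sg i c r y <= 1.
Proof. exact: step_le1. Qed.

Lemma cutoff_ge0 c r y : 0 <= cutoff c r y.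
Proof. by apply: mulr_ge0; apply: mulr_ge0; exact: edge_ge0. Qed.

Lemma cutoff_le1 c r y : cutoff c r y <= 1.
Proof.
have H (p q : R) : 0 <= p -> 0 <= q -> p <= 1 -> q <= 1 -> p * q <= 1.
  by move=> p0 q0 p1 q1; apply: mulr_ile1.
have P i : 0 <= edge 1 i c r y * edge (-1) i c r y by apply: mulr_ge0; exact: edge_ge0.
have Q i : edge 1 i c r y * edge (-1) i c r y <= 1.
  by apply: (H); [exact: edge_ge0|exact: edge_ge0|exact: edge_le1|exact: edge_le1].
exact: H (P 0) (P 1) (Q 0) (Q 1).
Qed.

Lemma cutoff_eq1 c r y : box c (r - 1) y -> cutoff c r y = 1.
Proof.
move=> /boxP[]; rewrite !ler_norml => /andP[a1 a2] /andP[b1 b2].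
rewrite /cutoff /edge !coord2_0 !coord2_1 !step_ge1 ?mulr1//; lra.
Qed.

Lemma cutoff_eq0 c r y : ~ box c r y -> cutoff c r y = 0.
Proof.
move=> yc; rewrite /cutoff /edge !coord2_0 !coord2_1.
have [a1|a1] := leP (r + 1 * (y.1 - c.1)) 0; first by rewrite (step_le0 a1) !mul0r.
have [a2|a2] := leP (r + (-1) * (y.1 - c.1)) 0; first by rewrite (step_le0 a2) mulr0 mul0r.
have [a3|a3] := leP (r + 1 * (y.2 - c.2)) 0; first by rewrite (step_le0 a3) mul0r mulr0.
have [a4|a4] := leP (r + (-1) * (y.2 - c.2)) 0; first by rewrite (step_le0 a4) !mulr0.
case: yc; apply/boxP; rewrite !ler_norml; split; lra.
Qed.

Lemma is_derive_time_coord z (v : ST) : is_derive z v (fun w : ST => w.1) v.1.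
Proof.
apply: (@is_derive_affine _ _ _ _ (id : R -> R) (fun w : ST => w.1) z v v.1 v.1).
  by move=> h; rewrite st_line.
Qed.

Lemma is_derive_space_coord i z (v : ST) :
  is_derive z v (fun w : ST => coord2 i w.2) (coord2 i v.2).
Proof.
apply: (@is_derive_affine _ _ _ _ (id : R -> R) (fun w : ST => coord2 i w.2) z v (coord2 i v.2)).
  by move=> h; rewrite st_line; case: (ord2_cases i) => ->; rewrite ?coord2_0 ?coord2_1.
Qed.

Section Moving.
Variables (rho drho : R -> R).
Hypotheses (smrho : smooth rho) (Drho : forall t : R, is_derive t 1 rho (drho t)).

Definition moving_edge sg i c z : R := edge sg i c (rho z.1) z.2.

Lemma smooth_moving_edge sg i c : smooth (moving_edge sg i c).
Proof.
apply: (smooth_comp (@smooth_step R)); apply: smoothD (smooth_of_time smrho) _.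
exact: (smoothZ sg (smoothB (smooth_space i) (@smooth_cst _ _ _ (coord2 i c)))).
Qed.

Lemma is_derive_moving_edge sg i c z (v : ST) : is_derive z v (moving_edge sg i c)
  (dstep (rho z.1 + sg * (coord2 i z.2 - coord2 i c)) *
    (drho z.1 * v.1 + sg * (coord2 i v.2 - 0))).
Proof.
have D1 := is_derive_chain (is_derive_time_coord z v) (Drho z.1).
have D2 := is_derive_cmul sg (is_derive_sub (is_derive_space_coord i z v) (is_derive_cst (coord2 i c) z v)).
exact: (is_derive_chain (is_derive_add D1 D2) (is_derive_step _)).
Qed.

End Moving.

Definition material a b (f : ST -> R) z : R := dt f z + (a * dx 0 f z + b * dx 1 f z).

Lemma materialM a b (f g : ST -> R) z : smooth f -> smooth g ->
  material a b (f \* g) z = f z * material a b g z + g z * material a b f z.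
Proof.
move=> sf sg.
have E (v : ST) : 'D_v (f \* g) z = f z * 'D_v g z + g z * 'D_v f z := smooth_deriveM z v sf sg.
rewrite /material /dt /dx !E.
move: ('D_ _ f z) ('D_ _ f z) ('D_ _ f z) ('D_ _ g z) ('D_ _ g z) ('D_ _ g z) (f z) (g z).
by move=> f0 f1 f2 g0 g1 g2 p q; ring.
Qed.

Lemma materialM_le0 a b (f g : ST -> R) z : smooth f -> smooth g ->
  0 <= f z -> 0 <= g z -> material a b f z <= 0 -> material a b g z <= 0 ->
  material a b (f \* g) z <= 0.
Proof.
move=> sf sg f0 g0 mf mg; rewrite materialM//.
move: mf mg; move: (material _ _ f z) (material _ _ g z) => p q p0 q0.
by rewrite -oppr_ge0 opprD addr_ge0// -mulrN mulr_ge0// oppr_ge0.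
Qed.

Section Moving_cutoff.
Variables (rho drho : R -> R).
Hypotheses (smrho : smooth rho) (Drho : forall t : R, is_derive t 1 rho (drho t)).
Variable c : R * R.

Definition moving_cutoff : ST -> R :=
  (moving_edge rho 1 0 c \* moving_edge rho (-1) 0 c) \*
  (moving_edge rho 1 1 c \* moving_edge rho (-1) 1 c).

Lemma smooth_moving_cutoff : smooth moving_cutoff.
Proof. by apply: smoothM; apply: smoothM; exact: smooth_moving_edge. Qed.

(** The derivative of the argument of [step] along the flow is drho plus or minus one velocity
    component. It is nonpositive when the edge recedes at least as fast as the fluid moves, and
    [dstep] is nonnegative. *)
Lemma material_moving_edge_le0 a b sg i z : `|sg| = 1 ->
  `|a| <= - drho z.1 -> `|b| <= - drho z.1 -> material a b (moving_edge rho sg i c) z <= 0.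
Proof.
move=> sg1 ha hb; have D v := is_deriveE (@is_derive_moving_edge rho drho Drho sg i c z v).
rewrite /material /dt /dx !D.
move: (dstep_ge0 (rho z.1 + sg * (coord2 i z.2 - coord2 i c))).
move: (dstep _) => d d0 /=.
have E : d * (drho z.1 * 1 + sg * (coord2 i (0, 0) - 0)) +
  (a * (d * (drho z.1 * 0 + sg * (coord2 i (basis2 0) - 0))) + b * (d * (drho z.1 * 0 + sg * (coord2 i (basis2 1) - 0)))) =
  d * (drho z.1 + sg * (if i == 0 then a else b)).
  case: (ord2_cases i) => ->; rewrite ?coord2_0 ?coord2_1 /basis2 /=; ring.
rewrite E; rewrite -oppr_ge0 -mulrN mulr_ge0// oppr_ge0.
have : `|sg * (if i == 0 then a else b)| <= - drho z.1 by rewrite normrM sg1 mul1r; case: (i == 0).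
rewrite ler_norml => /andP[_]; lra.
Qed.

(* The support of the cutoff shrinks at least as fast as the flow moves. *)
Lemma material_moving_cutoff_le0 a b z : `|a| <= - drho z.1 -> `|b| <= - drho z.1 ->
  material a b moving_cutoff z <= 0.
Proof.
move=> ha hb.
have n1 : `|1 : R| = 1 by exact: normr1.
have nN1 : `|-1 : R| = 1 by rewrite normrN normr1.
have S sg i : smooth (moving_edge rho sg i c) := smooth_moving_edge smrho sg i c.
have P sg i : 0 <= moving_edge rho sg i c z by exact: edge_ge0.
have M2 i : material a b (moving_edge rho 1 i c \* moving_edge rho (-1) i c) z <= 0.
  by apply: materialM_le0; solve [exact: S|exact: P|exact: material_moving_edge_le0].
apply: materialM_le0; try exact: M2; try (apply: smoothM; exact: S); apply: mulr_ge0; exact: P.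
Qed.

End Moving_cutoff.

Lemma smooth_cutoff c r : smooth (cutoff c r).
Proof.
exact: (smooth_slice 0 (smooth_moving_cutoff (@smooth_cst R R R r) c)).
Qed.

Lemma csupp_cutoff c r : 0 <= r -> csupp c r (cutoff c r).
Proof.
move=> r0; split => //; first exact: smooth_continuous (@smooth_cutoff c r).
by move=> y; exact: cutoff_eq0.
Qed.

End Cutoff.

(** * Decrease of localised convex integrals of the vorticity *)

Section Vorticity_estimate.
Context {R : realType}.
Local Notation leb2 := (@lebesgue2 R).
Local Notation ST := (R * (R * R))%type.
Implicit Types (t r a b : R) (x y c : R * R) (z : ST) (i j k l : 'I_2).

Lemma smooth_expR_scale (lam K : R) : smooth (fun s : R => K * expR (lam * s)).
Proof.
move=> n; elim: n K => [|n IH] K.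
  move=> s; apply: differentiable_continuous; apply/derivable1_diffP.
  by have [] := is_derive_cmul K (is_derive_chain (is_derive_linear lam s) (is_derive_expR _)).
apply: (@class_C_1D _ _ _ (fun s => K * lam * expR (lam * s))); last exact: IH.
move=> s; rewrite -mulrA (mulrC lam).
exact: (is_derive_cmul K (is_derive_chain (is_derive_linear lam s) (is_derive_expR _))).
Qed.

Lemma material_comp (phi : R -> R) (f : ST -> R) a b z : smooth phi -> smooth f ->
  material a b (phi \o f) z = 'D_1 phi (f z) * material a b f z.
Proof.
move=> sphi sf.
have E (v : ST) : 'D_v (phi \o f) z = 'D_1 phi (f z) * 'D_v f z.
  have := is_deriveE (is_derive_chain (smooth_is_derive v z sf) (smooth_is_derive (1 : R) (f z) sphi)).
  by [].
rewrite /material /dt /dx !E.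
by move: ('D_ _ f z) ('D_ _ f z) ('D_ _ f z) ('D_1 phi _) => f0 f1 f2 p; ring.
Qed.

Lemma csupp_dt_slice (f : ST -> R) c r : smooth f -> (forall s, csupp c r (fun y => f (s, y))) ->
  forall s, csupp c r (fun y => dt f (s, y)).
Proof.
move=> sf cf s; have [r0 _ _] := cf s.
split => //; first exact: smooth_continuous (smooth_slice s (smooth_dt sf)).
move=> y yc; rewrite -(is_deriveE (is_derive_time s y sf)).
have -> : (fun s : R => f (s, y)) = cst 0.
  by apply/funext => t; have [_ _ ->] := cf t.
exact: derive_cst.
Qed.

(** The enlargement is the distance that a particle can travel in time T, which for an exponential
    speed bound is at most G e^(lam T) / lam. *)
Lemma vorticity_energy_le u (U : ST -> R * R) P (beta : R -> R) c r T (G lam : R) :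
  euler_flow u U P -> smooth beta -> (forall s, 0 <= beta s) -> 0 <= T -> 0 < lam -> 0 <= r ->
  (forall t k x, 0 <= t <= T -> `|vel U k (t, x)| <= G * expR (lam * t)) ->
  exists2 r', r <= r' <= r + G / lam * expR (lam * T) &
    \int[leb2]_y (beta (vort U (T, y)) * cutoff c r y) <=
    \int[leb2]_y (beta (vort U (0, y)) * cutoff c r' y).
Proof.
move=> EF sb b0 T0 lam0 r0 HG; have [smU uU div0 Ppr mom] := EF.
have G0 : 0 <= G.
  have := HG 0 0 (0, 0); rewrite lexx T0 mulr0 expR0 mulr1 => /(_ isT).
  exact: le_trans.
pose D s := G / lam * expR (lam * s).
have Gl0 : 0 <= G / lam by rewrite divr_ge0// ltW.
have D0 s : 0 <= D s by rewrite mulr_ge0// expR_ge0.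
have dD (s : R) : is_derive s 1 D (G * expR (lam * s)).
  have H := is_derive_cmul (G / lam) (is_derive_chain (is_derive_linear lam s) (is_derive_expR _)).
  suff <- : G / lam * (expR (lam * s) * lam) = G * expR (lam * s) by exact: H.
  by move: (expR _) => e; field; rewrite gt_eqF.
(* [D] is a primitive of the speed bound, so the radius decreases at exactly that speed and equals r
   at time T. *)
pose rho s := (r + D T) - D s.
have smrho : smooth rho := smoothB (@smooth_cst _ _ _ (r + D T)) (smooth_expR_scale lam (G / lam)).
have drho (s : R) : is_derive s 1 rho (0 - G * expR (lam * s)).
  exact: is_derive_sub (is_derive_cst _ _ _) (dD s).
pose chi := moving_cutoff rho c.
have schi : smooth chi := smooth_moving_cutoff smrho c.
have sw : smooth (vort U) := smooth_vort smU.
have sbw : smooth (beta \o vort U) := smooth_comp sb sw.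
pose f := (beta \o vort U) \* chi.
have sf : smooth f := smoothM sbw schi.
have rT : 0 <= r + D T by rewrite addr_ge0.
(* [D] is nonnegative at negative times too, so one box contains the supports at all times. *)
have chi0 s y : ~ box c (r + D T) y -> chi (s, y) = 0.
  move=> yc; apply: cutoff_eq0 => yb; apply: yc; apply: (box_le _ yb).
  by rewrite /rho/= gerBl.
have cchi s : csupp c (r + D T) (fun y => chi (s, y)).
  split => //; first exact: smooth_continuous (smooth_slice s schi).
  by move=> y; exact: chi0.
have := @integral_growth_le _ f T (cst 0) (cst 0) c (r + D T) T0 sf rT.
rewrite /= subrr addr0 => main.
exists (r + D T - D 0).
  apply/andP; split; last by rewrite /rho gerBl.
  rewrite -addrA lerDl subr_ge0 /D ler_wpM2l// ler_expR mulr0.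
  by rewrite mulr_ge0// ltW.
have ET y : f (T, y) = beta (vort U (T, y)) * cutoff c r y.
  rewrite /f /chi /moving_cutoff /moving_edge /=.
  have -> : rho T = r by rewrite /rho addrK.
  by [].
have E0 y : f (0, y) = beta (vort U (0, y)) * cutoff c (r + D T - D 0) y by [].
under eq_Rintegral do rewrite -ET.
under [leRHS]eq_Rintegral do rewrite -E0.
apply: main.
  by move=> s y _ yc; rewrite /f /= chi0// mulr0.
move=> s /andP[s0 sT].
pose v i := fun y : R * R => vel U i (s, y).
have sv i : smooth (v i) := smooth_slice s (smooth_vel smU i).
have dv x : partial 0 (v 0) x + partial 1 (v 1) x = 0.
  apply: etrans (vel_div0 smU uU div0 x s0).
  exact: (congr2 +%R (partial_slice s 0 x (smooth_vel smU 0)) (partial_slice s 1 x (smooth_vel smU 1))).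
pose g := fun y : R * R => (beta \o vort U) (s, y).
pose h := fun y : R * R => chi (s, y).
have sg : smooth g := smooth_slice s sbw.
have sh : smooth h := smooth_slice s schi.
have ch : csupp c (r + D T) h := cchi s.
pose vg y := v 0 y * partial 0 g y + v 1 y * partial 1 g y.
pose vh y := v 0 y * partial 0 h y + v 1 y * partial 1 h y.
have cv i := smooth_continuous (sv i).
have cp i := smooth_continuous (smooth_partial i sg).
have cvg_ : continuous vg.
  move=> y; apply: cvgD; apply: cvgM; solve [exact: cv|exact: cp].
have cvgh : csupp c (r + D T) (fun y => vg y * h y) := csuppMl cvg_ ch.
have cvh : csupp c (r + D T) vh.
  by apply: csuppD; (apply: csuppMl; [exact: cv|exact: csupp_partial sh ch]).
have cgvh : csupp c (r + D T) (fun y => g y * vh y) := csuppMl (smooth_continuous sg) cvh.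
have tr := integral_transport sv dv sg sh ch.
have mw y : dt (beta \o vort U) (s, y) = - vg y.
  have M : material (v 0 y) (v 1 y) (beta \o vort U) (s, y) = 0.
    rewrite material_comp// /material (vorticity_equation smU uU div0 Ppr mom y s0).
    by rewrite addNr mulr0.
  move/eqP: M; rewrite /material addr_eq0 => /eqP ->.
  by rewrite /vg (partial_slice s 0 y sbw) (partial_slice s 1 y sbw).
have dtf y : dt f (s, y) = g y * dt chi (s, y) - vg y * h y.
  apply: (etrans (smooth_deriveM (s, y) ((1, 0) : ST) sbw schi)).
  rewrite -[X in _ + _ * X]/(dt (beta \o vort U) (s, y)) mw mulrN (mulrC (chi _)).
  by [].
(* The added terms have integral 0 by [tr]; with them the integrand becomes g times the material
   derivative of the cutoff, which has a sign at each point. *)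
have mat y : dt f (s, y) + (vg y * h y + g y * vh y) <= 0.
  rewrite dtf.
  have -> : g y * dt chi (s, y) - vg y * h y + (vg y * h y + g y * vh y) = g y * (dt chi (s, y) + vh y).
    by move: (g y) (dt _ _) (vg y) (h y) (vh y) => p q m n o; ring.
  have -> : dt chi (s, y) + vh y = material (v 0 y) (v 1 y) chi (s, y).
    by rewrite /material /vh (partial_slice s 0 y schi) (partial_slice s 1 y schi).
  rewrite -oppr_ge0 -mulrN; apply: mulr_ge0; first exact: b0.
  rewrite oppr_ge0; apply: (@material_moving_cutoff_le0 _ rho (fun s => 0 - G * expR (lam * s))) => //=;
    rewrite sub0r opprK; apply: HG; exact/andP.
have cdt : csupp c (r + D T) (fun y => dt f (s, y)).
  have := csuppB (csuppMl (smooth_continuous sg) (csupp_dt_slice schi cchi s)) cvgh.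
  by rewrite (_ : _ \- _ = (fun y => dt f (s, y)))//; apply/funext => y; rewrite dtf.
have I1 := csuppD cdt (csuppD cvgh cgvh).
have I0 : \int[leb2]_y (dt f (s, y) + (vg y * h y + g y * vh y)) <= 0.
  rewrite -oppr_ge0 -(integral_csupp_opp I1).
  by apply: Rintegral_ge0 => y _; rewrite oppr_ge0; exact: mat.
move: I0; rewrite (integral_csupp_add cdt (csuppD cvgh cgvh)) (integral_csupp_add cvgh cgvh).
by rewrite tr addNr addr0.
Qed.

End Vorticity_estimate.

(** * Uniformly local norms *)

Section Covering.
Context {R : realType}.
Local Notation mR := (measurableTypeR R).
Local Notation P2 := (measurableTypeR R * measurableTypeR R)%type.
Local Notation leb2 := (@lebesgue2 R).
Implicit Types (r : R) (x y c : R * R).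

Lemma continuous_dot2_self : continuous (fun x : R * R => dot2 x x).
Proof.
move=> x; rewrite /dot2.
by apply: cvgD; apply: cvgM; solve [exact: cvg_fst|exact: cvg_snd].
Qed.

Lemma continuous_enorm : continuous (@enorm R).
Proof.
move=> x; apply: (@continuous_comp _ _ _ (fun x : R * R => dot2 x x) Num.sqrt).
  exact: continuous_dot2_self.
exact: sqrt_continuous.
Qed.

Lemma enorm_lt1 x : (enorm x < 1) = (dot2 x x < 1).
Proof. by rewrite /enorm -{1}[1]sqrtr1 ltr_sqrt// ltr01. Qed.

Lemma measurable_unit_disk x : measurable (unit_disk x : set P2).
Proof.
apply: open_measurable_plane.
have -> : unit_disk x = (fun y => enorm (x - y)) @^-1` [set t : R | t < 1] by [].
apply: (@open_comp _ _ (fun y : R * R => enorm (x - y))) (@open_lt _ (1 : R)) => y _.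
apply: (@continuous_comp _ _ _ (fun y : R * R => x - y) (@enorm R)); last exact: continuous_enorm.
by apply: cvgB; [exact: cvg_cst|exact: cvg_id].
Qed.

Lemma box_half_disk x : box x 2^-1 `<=` (unit_disk x : set P2).
Proof.
move=> y /boxP[h1 h2]; rewrite /unit_disk/= enorm_lt1 /dot2 /=.
have S (a b : R) : `|b - a| <= 2^-1 -> (a - b) * (a - b) <= 4^-1.
  rewrite distrC => h; rewrite -expr2 -(@real_normK _ (a - b)) ?num_real//.
  have -> : (4 : R)^-1 = 2^-1 ^+ 2 by field.
  by apply: lerXn2r; rewrite ?nnegrE// invr_ge0.
have := S _ _ h1; have := S _ _ h2; lra.
Qed.

Lemma disk_box1 x : (unit_disk x : set P2) `<=` box x 1.
Proof.
move=> y; rewrite /unit_disk/= enorm_lt1 /dot2 /= => h; apply/boxP.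
have S (a b : R) : (a - b) * (a - b) < 1 -> `|b - a| <= 1.
  rewrite distrC -expr2 -(@real_normK _ (a - b)) ?num_real// => h1.
  by rewrite -(@ler_pXn2r _ 2)// ?nnegrE// expr1n ltW.
split; apply: S; apply: le_lt_trans h; first by rewrite lerDl -expr2 sqr_ge0.
by rewrite lerDr -expr2 sqr_ge0.
Qed.

Local Open Scope ereal_scope.

(** Pairs at distance at most 1/2 in the maximum norm: the slice at either variable is a unit square
    about it, and this symmetry is what Tonelli exploits. *)
Definition near_diag : set (P2 * P2) :=
  [set p | (`|p.2.1 - p.1.1| <= 2^-1)%R /\ (`|p.2.2 - p.1.2| <= 2^-1)%R].

Lemma near_diagE x y : near_diag (x, y) = box x 2^-1 y.
Proof. by apply/propext; exact: iff_sym (boxP x 2^-1 y). Qed.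

Lemma near_diagEC x y : near_diag (x, y) = box y 2^-1 x.
Proof.
rewrite near_diagE; apply/propext.
have E (a b : P2) : box a 2^-1 b -> box b 2^-1 a.
  move=> /boxP[h1 h2]; apply: (iffRL (boxP _ _ _)); split.
    by rewrite distrC; exact: h1.
  by rewrite distrC; exact: h2.
by split; exact: E.
Qed.

Lemma indic_near_diag x y : \1_near_diag (x, y) = \1_(box x 2^-1) y :> R.
Proof.
rewrite !indicE; congr (nat_of_bool _)%:R.
by apply/idP/idP => /set_mem h; apply: mem_set; [rewrite -near_diagE|rewrite near_diagE].
Qed.

Lemma indic_near_diagC x y : \1_near_diag (x, y) = \1_(box y 2^-1) x :> R.
Proof.
rewrite !indicE; congr (nat_of_bool _)%:R.
by apply/idP/idP => /set_mem h; apply: mem_set; [rewrite -near_diagEC|rewrite near_diagEC].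
Qed.

Lemma indicM_subset (T : Type) (A B : set T) (x : T) : A `<=` B -> (\1_B x * \1_A x = \1_A x :> R)%R.
Proof.
move=> AB; rewrite !indicE; have [xA|xA] := pselect (A x).
  by rewrite (mem_set xA) (mem_set (AB x xA)) mulr1.
by rewrite (memNset xA) mulr0.
Qed.

Lemma measurable_near_diag : measurable near_diag.
Proof.
pose D (f : P2 -> mR) (p : P2 * P2) : mR := (f p.2 - f p.1)%R.
have mD f : measurable_fun [set: P2] f -> measurable_fun [set: P2 * P2] (D f).
  move=> mf; apply: measurable_funB.
    exact: (measurableT_comp mf measurable_snd).
  exact: (measurableT_comp mf measurable_fst).
have m1 := mD fst measurable_fst; have m2 := mD snd measurable_snd.
pose I : set R := [set` `[(- 2^-1)%R, 2^-1%R]].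
have -> : near_diag = D fst @^-1` I `&` D snd @^-1` I.
  by apply/seteqP; split=> p; rewrite /near_diag /I /D /= !in_itv /= !ler_norml.
apply: measurableI.
  by rewrite -[X in measurable X]setTI; apply: m1 => //; exact: measurable_itv.
by rewrite -[X in measurable X]setTI; apply: m2 => //; exact: measurable_itv.
Qed.

(* Tonelli: average the integral over the unit squares centred in the box. *)
Lemma integral_box_le_disks (f : P2 -> \bar R) c r (A : R) :
  measurable_fun setT f -> (forall x, 0 <= f x) -> (0 <= r)%R ->
  (forall x, \int[leb2]_(y in unit_disk x) f y <= A%:E) ->
  \int[leb2]_(y in box c r) f y <= (A * (2 * (r + 1)) ^+ 2)%:E.
Proof.
move=> mf f0 r0 fA.
have r10 : (0 <= r + 1)%R by rewrite addr_ge0.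
pose B := box c (r + 1).
have mB : measurable B := measurable_box c (r + 1).
have A0 : (0 <= A)%R.
  by rewrite -lee_fin; apply: le_trans (fA c); apply: integral_ge0.
have mI (a : P2) : measurable_fun [set: P2] (fun x => (\1_(box a 2^-1) x)%:E : \bar R).
  by apply/measurable_EFinP; exact: measurable_indic (measurable_box _ _).
have I0 (a x : P2) : 0 <= (\1_(box a 2^-1) x)%:E :> \bar R by rewrite lee_fin.
have sq1 : ((2 * 2^-1) ^+ 2 = 1 :> R)%R by rewrite mulfV ?expr1n// pnatr_eq0.
have iI (D : set P2) : measurable D -> \int[@lebesgue2_sf R]_x (\1_D x)%:E = leb2 D.
  by move=> mD; rewrite (integral_indic _ measurableT mD) setIT.
pose F (p : P2 * P2) : \bar R := f p.2 * ((\1_B p.1)%:E * (\1_near_diag p)%:E).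
have mF : measurable_fun setT F.
  apply: emeasurable_funM; first exact: (measurableT_comp mf measurable_snd).
  apply: emeasurable_funM; apply/measurable_EFinP.
    exact: (measurableT_comp (measurable_indic mB) measurable_fst).
  exact: measurable_indic measurable_near_diag.
have F0 p : 0 <= F p by rewrite /F !mule_ge0// lee_fin.
have E := @fubini_tonelli _ _ P2 P2 R (@lebesgue2_sf R) (@lebesgue2_sf R) F mF F0.
pose G y := \int[@lebesgue2_sf R]_x F (x, y).
have G0 y : 0 <= G y by apply: integral_ge0 => x _; exact: F0.
have mG : measurable_fun [set: P2] G.
  exact: (@measurable_fun_fubini_tonelli_G _ _ P2 P2 R (@lebesgue2_sf R) F mF F0).
have mfb : measurable_fun [set: P2] (f \_ (box c r)).
  apply/(measurable_restrictT _ _).1; [exact: measurable_box|exact: measurable_funTS].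
have fb0 y : 0 <= (f \_ (box c r)) y by rewrite patchE; case: ifP.
apply: (@le_trans _ _ (\int[leb2]_y G y)).
  rewrite integral_mkcond. apply: (ge0_le_integral leb2 measurableT (fun y _ => fb0 y) mfb mG).
  move=> y _; rewrite patchE; case: ifPn => [|_]; last exact: G0.
  rewrite inE => yc; rewrite /G.
  (* The unit square about a point of the smaller box stays in [B], so integrating over the centres
     returns the full value f y. *)
  have yB : box y 2^-1 `<=` B.
    by apply: subset_box; case/boxP: yc => h1 h2; lra.
  have FE x : F (x, y) = f y * (\1_(box y 2^-1) x)%:E.
    by rewrite /F -EFinM indic_near_diagC indicM_subset.
  under eq_integral do rewrite FE.
  rewrite (ge0_integralZl (@lebesgue2_sf R) measurableT (mI _) (fun x _ => I0 _ x) (f0 y)).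
  rewrite iI; last exact: measurable_box.
  rewrite lebesgue2_box; last by rewrite invr_ge0.
  rewrite sq1 mule1.
  exact: lexx.
rewrite (_ : \int[leb2]_y G y = \int[@lebesgue2_sf R]_x \int[@lebesgue2_sf R]_y F (x, y)); last exact: esym E.
have FE x : \int[@lebesgue2_sf R]_y F (x, y) = (\1_B x)%:E * \int[leb2]_(y in box x 2^-1) f y.
  have m1 : measurable_fun [set: P2] (f \_ (box x 2^-1)).
    by apply/(measurable_restrictT _ _).1; [exact: measurable_box|exact: measurable_funTS].
  have p1 y : 0 <= (f \_ (box x 2^-1)) y by rewrite patchE; case: ifP.
  have B0 : 0 <= (\1_B x)%:E :> \bar R by rewrite lee_fin.
  rewrite [in RHS]integral_mkcond -(ge0_integralZl leb2 measurableT m1 (fun y _ => p1 y) B0).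
  apply: eq_integral => y _; rewrite /F /= muleCA; congr (_ * _).
  rewrite indic_near_diag indicE patchE; case: ifP => _; last by rewrite mule0.
  by rewrite mule1.
(* In the other order, the inner integral is over a unit square, which lies in the unit disk with
   the same centre. *)
apply: (@le_trans _ _ (\int[leb2]_x (A%:E * (\1_B x)%:E))).
  pose G2 x := \int[@lebesgue2_sf R]_y F (x, y).
  have G20 x : 0 <= G2 x by apply: integral_ge0 => y _; exact: F0.
  have mG2 : measurable_fun [set: P2] G2.
    exact: (@measurable_fun_fubini_tonelli_F _ _ P2 P2 R (@lebesgue2_sf R) F mF F0).
  have mB2 : measurable_fun [set: P2] (fun x => A%:E * (\1_B x)%:E).
    apply: emeasurable_funM; first exact: measurable_cst.
    by apply/measurable_EFinP; exact: measurable_indic mB.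
  apply: (ge0_le_integral leb2 measurableT (fun y _ => G20 y) mG2 mB2).
  move=> x _; rewrite /G2 FE muleC; apply: lee_wpmul2r; first by rewrite lee_fin.
  apply: le_trans (fA x).
  exact: (ge0_subset_integral leb2 (measurable_box x 2^-1) (measurable_unit_disk x) (measurable_funTS mf)
    (fun y _ => f0 y) (@box_half_disk x)).
have mB3 : measurable_fun [set: P2] (fun x => (\1_B x)%:E : \bar R).
  by apply/measurable_EFinP; exact: measurable_indic mB.
have B30 (x : P2) : 0 <= (\1_B x)%:E :> \bar R by rewrite lee_fin.
have A0' : 0 <= A%:E by rewrite lee_fin.
rewrite (ge0_integralZl leb2 measurableT mB3 (fun x _ => B30 x) A0').
rewrite (iI _ mB) (lebesgue2_box c r10).
exact: lexx.
Qed.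

End Covering.

(** * From uniformly local norms to integrals over large boxes *)

Section Local_Lp.
Context {R : realType}.
Local Notation mR := (measurableTypeR R).
Local Notation P2 := (measurableTypeR R * measurableTypeR R)%type.
Local Notation leb2 := (@lebesgue2 R).
Implicit Types (r p w m : R) (x y c : R * R).

Lemma powRrK p m : 0 < p -> 0 <= m -> powR (powR m p) p^-1 = m.
Proof. by move=> p0 m0; rewrite -powRrM divff ?gt_eqF// powRr1. Qed.

Lemma Lpul_disk_le p w (f : R * R -> R) : 0 < p -> 0 <= w -> (Lpul_norm p f <= w%:E)%E ->
  forall x, (\int[leb2]_(y in unit_disk x) (powR `|f y| p)%:E <= (powR w p)%:E)%E.
Proof.
move=> p0 w0 H x.
set I := (\int[leb2]_(y in unit_disk x) (powR `|f y| p)%:E)%E.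
have I0 : (0 <= I)%E by apply: integral_ge0 => y _; rewrite lee_fin powR_ge0.
have Iw : (poweR I p^-1 <= w%:E)%E.
  by apply: le_trans H; apply: ereal_sup_ubound; exists x.
have -> : I = poweR (poweR I p^-1) p.
  by rewrite -poweRrM mulVf ?gt_eqF// poweRe1.
rewrite -poweR_EFin; apply: gt0_ler_poweR => //.
- exact: ltW.
- by rewrite in_itv /= poweR_ge0 leey.
- by rewrite in_itv /= lee_fin w0 leey.
Qed.

Lemma Lpul_norm_le p m (f : R * R -> R) : 0 < p -> 0 <= m ->
  (forall x, (\int[leb2]_(y in unit_disk x) (powR `|f y| p)%:E <= (powR m p)%:E)%E) ->
  (Lpul_norm p f <= m%:E)%E.
Proof.
move=> p0 m0 H; apply: ge_ereal_sup => _ [x _ <-].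
rewrite -[in leRHS](powRrK p0 m0) -poweR_EFin; apply: gt0_ler_poweR.
- by rewrite invr_ge0 ltW.
- rewrite in_itv /= leey andbT; apply: integral_ge0 => y _; rewrite lee_fin; exact: powR_ge0.
- by rewrite in_itv /= lee_fin powR_ge0 leey.
- exact: H.
Qed.

Lemma measure_unit_disk_le x : (leb2 (unit_disk x) <= 4%:E)%E.
Proof.
have -> : 4%:E = leb2 (box x 1).
  by rewrite lebesgue2_box// mulr1 expr2 -natrM.
apply: le_measure; rewrite ?inE.
- exact: measurable_unit_disk.
- exact: measurable_box.
- exact: disk_box1.
Qed.

Lemma measurable_bracket q (f : R * R -> R) : measurable_fun [set: P2] (f : P2 -> mR) ->
  measurable_fun [set: P2] (fun y => (bracket q (f y))%:E).
Proof.
move=> mf; apply/measurable_EFinP.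
have mb : measurable_fun [set: mR] (bracket q : mR -> mR).
  by apply: continuous_measurable_fun; exact: smooth_continuous (smooth_bracket q).
exact: (measurableT_comp mb mf).
Qed.

(** The 4 is the contribution of the constant 1 in [bracket_le_powR]: the area of the unit disk is
    bounded by that of a square of side 2. *)
Lemma integral_bracket_box_le p w (f : R * R -> R) c r : 0 < p -> 0 <= w -> 0 <= r ->
  measurable_fun [set: P2] (f : P2 -> mR) -> (Lpul_norm p f <= w%:E)%E ->
  (\int[leb2]_(y in box c r) (bracket (p / 2) (f y))%:E <=
    (powR 2 p * (powR w p + 4) * (2 * (r + 1)) ^+ 2)%:E)%E.
Proof.
move=> p0 w0 r0 mf H.
apply: integral_box_le_disks => //; first exact: measurable_bracket.
  by move=> x; rewrite lee_fin ltW// bracket_gt0.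
move=> x.
have mD := measurable_unit_disk x.
have mp : measurable_fun [set: P2] (fun y => (powR `|f y| p)%:E).
  have mn := (@measurableT_comp _ _ _ _ _ _ (Num.norm : mR -> mR) _ _ (@normr_measurable _ _) mf).
  apply/measurable_EFinP; exact: (measurableT_comp (measurable_powR p) mn).
have p20 : (0 <= (powR 2 p)%:E)%E by rewrite lee_fin powR_ge0.
have g0 y : (0 <= (powR `|f y| p)%:E + 1)%E by rewrite -EFinD lee_fin addr_ge0// powR_ge0.
have mg : measurable_fun (unit_disk x) (fun y : P2 => (powR `|f y| p)%:E + 1)%E.
  apply: emeasurable_funD; [exact: measurable_funTS mp|exact: measurable_cst].
apply: (@le_trans _ _ (\int[leb2]_(y in unit_disk x) ((powR 2 p)%:E * ((powR `|f y| p)%:E + 1)))%E).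
  apply: (ge0_le_integral leb2 mD).
  - by move=> y _; rewrite lee_fin ltW// bracket_gt0.
  - exact: measurable_funTS (measurable_bracket _ mf).
  - by apply: emeasurable_funM => //; exact: measurable_cst.
  - by move=> y _; rewrite -EFinD -EFinM lee_fin bracket_le_powR// ltW.
rewrite (ge0_integralZl leb2 mD mg (fun y _ => g0 y) p20) EFinM.
apply: lee_wpmul2l => //.
have k0 y : (0 <= (powR `|f y| p)%:E)%E by rewrite lee_fin powR_ge0.
rewrite (ge0_integralD leb2 mD (fun y _ => k0 y) (measurable_funTS mp) (fun y _ => lee01) (measurable_cst _)).
rewrite EFinD; apply: leeD; first exact: Lpul_disk_le.
rewrite (integral_cst leb2 mD) mul1e; exact: measure_unit_disk_le.
Qed.

End Local_Lp.

(** * Bounds on the initial vorticity *)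

Section Initial_energy.
Context {R : realType}.
Local Notation mR := (measurableTypeR R).
Local Notation P2 := (measurableTypeR R * measurableTypeR R)%type.
Local Notation leb2 := (@lebesgue2 R).
Implicit Types (r p w m : R) (x y c : R * R).

Variables (u0 : R * R -> R * R) (omega0 : R * R -> R) (v : 'I_2 -> R * R -> R).
Hypotheses (mu0 : measurable_fun [set: P2] (u0 : P2 -> P2)).
Hypotheses (wv : weak_vorticity u0 omega0) (sv : forall i, smooth (v i)).
Hypothesis (u0v : {ae leb2, forall y, u0 y = (v 0 y, v 1 y)}).
Hypothesis (locw : locally_integrable2 omega0).

(** [u0] agrees with the smooth field only almost everywhere, which suffices under the integral of
    the weak formulation. *)
Lemma integral_vorticity_test (g : R * R -> R) c r : smooth g -> csupp c r g ->
  \int[leb2]_y (omega0 y * g y) = \int[leb2]_y (curl2 v y * g y).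
Proof.
move=> sg cg; rewrite (wv (csupp_test_function sg cg)).
have cpg i := csupp_partial i sg cg.
have cv i := smooth_continuous (sv i).
transitivity (\int[leb2]_y (v 0 y * partial 1 g y - v 1 y * partial 0 g y)).
  rewrite /Rintegral; congr fine; apply: ae_eq_integral => //.
  - have mp i : measurable_fun [set: P2] (partial i g : P2 -> mR).
      by apply: continuous_measurable_plane; case: (cpg i).
    apply/measurable_EFinP; apply: measurable_funB; apply: measurable_funM; try exact: mp.
      exact: (measurableT_comp measurable_fst mu0).
    exact: (measurableT_comp measurable_snd mu0).
  - apply/measurable_EFinP; apply: continuous_measurable_plane.
    have [_ c1 _] := csuppB (csuppMl (cv 0) (cpg 1)) (csuppMl (cv 1) (cpg 0)).
    exact: c1.
  - apply: (negligibleS _ u0v) => y; apply: contra_not => E _ /=.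
    by rewrite E coord2_0 coord2_1.
rewrite (integral_csupp_sub (csuppMl (cv 0) (cpg 1)) (csuppMl (cv 1) (cpg 0))).
have I i j := integral_by_parts i (sv j) sg cg.
have cI i j : csupp c r (fun y => partial i (v j) y * g y).
  exact: csuppMl (smooth_continuous (smooth_partial i (sv j))) cg.
transitivity (\int[leb2]_y (partial 0 (v 1) y * g y - partial 1 (v 0) y * g y)); last first.
  by apply: eq_Rintegral => y _; rewrite /curl2 mulrBl.
rewrite (integral_csupp_sub (cI 0 1) (cI 1 0)) !I.
by rewrite opprK addrC.
Qed.

Lemma integrable_locally_csupp (g : R * R -> R) c r : csupp c r g ->
  leb2.-integrable setT (EFin \o (fun y => omega0 y * g y)).
Proof.
move=> cg; have [r0 cg' g0] := cg; have [mw iw] := locw.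
have [M M0 HM] := csupp_bounded cg.
have Ib := iw (box c r : set (R * R)) (@compact_box R c r).
have mb := measurable_box c r.
have I1 : leb2.-integrable setT ((EFin \o omega0) \_ (box c r)) := iffLR (integrable_mkcond _ mb) Ib.
have I2 := integrableZl measurableT M I1.
apply: (le_integrable measurableT _ _ I2).
  apply/measurable_EFinP; apply: measurable_funM; first exact: mw.
  exact: continuous_measurable_plane cg'.
move=> y _; rewrite patchE.
have [yb|yb] := pselect (box c r y).
  rewrite mem_set//= lee_fin !normrM (mulrC `|omega0 y|).
  by rewrite (ger0_norm M0) ler_wpM2r.
by rewrite memNset// /comp g0// mulr0 mule0.
Qed.

(* Convexity: the graph of [bracket q] lies above its tangent at curl v, and the linear
   term integrates to 0 because omega0 and curl v agree as distributions. *)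
Lemma initial_energy_le p w c r : 1 <= p -> 0 <= w -> 0 <= r -> (Lpul_norm p omega0 <= w%:E)%E ->
  \int[leb2]_y (bracket (p / 2) (curl2 v y) * cutoff c r y) <=
    powR 2 p * (powR w p + 4) * (2 * (r + 1)) ^+ 2.
Proof.
move=> p1 w0 r0 Hw.
have p0 : 0 < p by apply: lt_le_trans p1.
have [mw _] := locw.
set q := p / 2; have q2 : 2^-1 <= q by rewrite /q ler_pdivlMr// mulVf.
have scv : smooth (curl2 v) by apply: smoothB; apply: smooth_partial; exact: sv.
have sc := @smooth_cutoff R c r; have cc := csupp_cutoff c r0.
have sb : smooth (bracket q \o curl2 v) := smooth_comp (smooth_bracket q) scv.
have sdb : smooth (dbracket q \o curl2 v) := smooth_comp (smooth_dbracket q) scv.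
(* The slope of the tangent times the cutoff. The curl of v is smooth, so this is an admissible test
   function, although it depends on v. *)
pose g y := dbracket q (curl2 v y) * cutoff c r y.
have sg : smooth g := smoothM sdb sc.
have cg : csupp c r g := csuppMl (smooth_continuous sdb) cc.
have cF : csupp c r (fun y => bracket q (curl2 v y) * cutoff c r y) := csuppMl (smooth_continuous sb) cc.
have IF := csupp_integrable cF.
have Iwg := integrable_locally_csupp cg.
have Ivg := csupp_integrable (csuppMl (smooth_continuous scv) cg).
have I1 := integrableB measurableT Iwg Ivg.
have I2 := integrableD measurableT IF I1.
have E : \int[leb2]_y (bracket q (curl2 v y) * cutoff c r y) =
  \int[leb2]_y (bracket q (curl2 v y) * cutoff c r y + (omega0 y * g y - curl2 v y * g y)).
  rewrite RintegralD// RintegralB//.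
  by rewrite (integral_vorticity_test sg cg) subrr addr0.
rewrite E -lee_fin.
have -> : (\int[leb2]_y (bracket q (curl2 v y) * cutoff c r y + (omega0 y * g y - curl2 v y * g y)))%:E =
  (\int[leb2]_y (bracket q (curl2 v y) * cutoff c r y + (omega0 y * g y - curl2 v y * g y))%:E)%E.
  by rewrite (Rintegral_EFin I2).
have fin := integral_bracket_box_le c p0 w0 r0 mw Hw.
apply: le_trans fin; rewrite -/q.
rewrite [leRHS]integral_mkcond.
have mb : measurable_fun [set: P2] ((fun y : P2 => (bracket q (omega0 y))%:E) \_ (box c r)).
  apply/(measurable_restrictT _ _).1; [exact: measurable_box|exact: measurable_funTS (measurable_bracket q mw)].
have b0 y : (0 <= ((fun y : P2 => (bracket q (omega0 y))%:E) \_ (box c r)) y)%E.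
  by rewrite patchE; case: ifP => // _; rewrite lee_fin ltW// bracket_gt0.
have IB : leb2.-integrable setT ((fun y : P2 => (bracket q (omega0 y))%:E) \_ (box c r)).
  apply/integrableP; split => //.
  rewrite (eq_integral ((fun y : P2 => (bracket q (omega0 y))%:E) \_ (box c r))); last first.
    by move=> y _; rewrite gee0_abs.
  rewrite -integral_mkcond; apply: le_lt_trans (integral_bracket_box_le c p0 w0 r0 mw Hw) _.
  exact: ltry.
apply: (le_integral measurableT I2 IB) => y _.
rewrite patchE; have [yb|yb] := pselect (box c r y).
  rewrite mem_set// lee_fin /g.
  apply: (@le_trans _ _ (bracket q (omega0 y) * cutoff c r y)); last first.
    by apply: ler_piMr; [exact: ltW (bracket_gt0 _ _)|exact: cutoff_le1].
  have := ler_wpM2r (cutoff_ge0 c r y) (bracket_tangent (curl2 v y) (omega0 y) q2).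
  have A (a d k o x b : R) : (a + d * (o - k)) * x <= b * x -> a * x + (o * (d * x) - k * (d * x)) <= b * x.
    by rewrite (_ : (a + d * (o - k)) * x = a * x + (o * (d * x) - k * (d * x)))//; ring.
  exact: A.
have E0 : bracket q (curl2 v y) * cutoff c r y + (omega0 y * g y - curl2 v y * g y) = 0.
  by rewrite /g (cutoff_eq0 yb) !mulr0 subrr addr0.
apply: (@le_trans _ _ 0%E); last by rewrite (memNset yb); exact: lexx.
by rewrite lee_fin E0.
Qed.

End Initial_energy.

(** * A priori estimates *)

Section Linf.
Context {R : realType}.
Local Notation leb2 := (@lebesgue2 R).
Implicit Types (r M : R) (x y c : R * R) (v : R * R -> R * R) (k : 'I_2).

Lemma enorm_ge0 x : 0 <= enorm x. Proof. exact: sqrtr_ge0. Qed.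

Lemma coord2_le_enorm k x : `|coord2 k x| <= enorm x.
Proof. by rewrite -sqrtr_sqr; apply: ler_wsqrtr; exact: coord2_sq_le. Qed.

Lemma enorm_le_coord2 x M : (forall k, `|coord2 k x| <= M) -> enorm x <= 2 * M.
Proof.
move=> H; have M0 : 0 <= M := le_trans (normr_ge0 _) (H 0).
have M20 : 0 <= 2 * M by rewrite mulr_ge0.
rewrite /enorm -[leRHS](ger0_norm M20) -sqrtr_sqr.
apply: ler_wsqrtr; rewrite /dot2 -!expr2.
have S (a : R) : `|a| <= M -> a ^+ 2 <= M ^+ 2.
  by move=> h; rewrite -(@real_normK _ a) ?num_real//; apply: lerXn2r; rewrite ?nnegrE.
have h1 := S _ (H 0); have h2 := S _ (H 1).
rewrite coord2_0 in h1; rewrite coord2_1 in h2.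
apply: (le_trans (lerD h1 h2)); rewrite -subr_ge0.
by rewrite (_ : _ - _ = 2 * M ^+ 2) ?mulr_ge0 ?sqr_ge0//; ring.
Qed.

Lemma lebesgue2_setT_gt0 : (0 < leb2 setT)%E.
Proof.
apply: (@lt_le_trans _ _ (leb2 (box 0 1))).
  by rewrite lebesgue2_box// lte_fin exprn_gt0// mulr_gt0.
by apply: le_measure; rewrite ?inE//; exact: measurable_box.
Qed.

Lemma Linf_normE v : Linf_norm v = ess_sup leb2 (fun x => (enorm (v x))%:E).
Proof.
rewrite /Linf_norm Lnorm.unlock lebesgue2_setT_gt0; congr ess_sup.
by apply/funext => x /=; rewrite ger0_norm// enorm_ge0.
Qed.

Lemma Linf_norm_ae v M : (Linf_norm v <= M%:E)%E -> {ae leb2, forall x, enorm (v x) <= M}.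
Proof.
rewrite Linf_normE => /ess_supP H; apply: (negligibleS _ H) => x.
by apply: contra_not => /=; rewrite lee_fin.
Qed.

Lemma Linf_norm_le v M : (forall x, enorm (v x) <= M) -> (Linf_norm v <= M%:E)%E.
Proof.
move=> H; rewrite Linf_normE; apply/ess_supP.
exists set0; split; [exact: measurable0|exact: measure0|].
by move=> x /= []; rewrite lee_fin.
Qed.

(** A point of excess would bring a whole box of excess, of positive measure. *)
Lemma ae_le_continuous (f : R * R -> R) M : continuous f ->
  {ae leb2, forall x, f x <= M} -> forall x, f x <= M.
Proof.
move=> cf [A [mA A0 HA]] x; rewrite leNgt; apply/negP => fx.
have e0 : 0 < f x - M by rewrite subr_gt0.
have /cvgrPdist_lt/(_ _ e0)/nbhs_ballP[d /= d0 Hd] := cf x.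
have d20 : 0 < d / 2 by rewrite divr_gt0.
have sub : box x (d / 2) `<=` A.
  move=> y /boxP[h1 h2]; apply: HA => /= fy.
  have xy : ball x d y.
    by split; rewrite /ball/= distrC; [apply: (le_lt_trans h1)|apply: (le_lt_trans h2)]; lra.
  have := Hd _ xy; rewrite ltr_norml => /andP[_]; move: fy; lra.
have : (leb2 (box x (d / 2)) <= leb2 A)%E.
  by apply: le_measure; rewrite ?inE//; exact: measurable_box.
rewrite A0 (lebesgue2_box _ (ltW d20)) lee_fin leNgt => /negP; apply.
by rewrite exprn_gt0// mulr_gt0.
Qed.

Lemma Linf_norm_coord2 v M k : continuous v -> (Linf_norm v <= M%:E)%E ->
  forall x, `|coord2 k (v x)| <= M.
Proof.
move=> cv H x; apply: (le_trans (coord2_le_enorm k (v x))).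
apply: (@ae_le_continuous (fun x => enorm (v x))); last exact: Linf_norm_ae.
by move=> y; apply: (@continuous_comp _ _ _ v (@enorm R)); [exact: cv|exact: continuous_enorm].
Qed.

Lemma moll_average_le (f : R * R -> R) c r M : 0 < r -> continuous f -> (forall x, `|f x| <= M) ->
  `|\int[leb2]_y (moll c r y * f y)| <= bump_mass * M.
Proof.
move=> r0 cf HM; have cm := csupp_moll c r0.
have cmf := csupp_integrable (csuppM cm cf).
apply: (le_trans (le_normr_Rintegral measurableT cmf)).
have <- : \int[leb2]_y (moll c r y * M) = bump_mass * M.
  by rewrite RintegralZr ?integral_moll//; exact: csupp_integrable cm.
have cM : csupp c (r * 2) (fun y => moll c r y * M).
  by apply: (csuppM cm) => y; exact: cvg_cst.
apply: (le_Rintegral measurableT (integrable_norm cmf) (csupp_integrable cM)) => y _.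
suff: `|moll c r y * f y| <= moll c r y * M by [].
rewrite normrM (ger0_norm (moll_ge0 c r y)).
apply: ler_wpM2l; first exact: moll_ge0.
exact: HM.
Qed.

End Linf.

(** * One improvement step for the velocity bound *)

Section Velocity_bound.
Context {R : realType}.
Local Notation P2 := (measurableTypeR R * measurableTypeR R)%type.
Local Notation leb2 := (@lebesgue2 R).
Local Notation ST := (R * (R * R))%type.
Implicit Types (t r : R) (x y c : R * R) (k : 'I_2).

Variables (u0 : R * R -> R * R) (omega0 : R * R -> R).
Hypotheses (mu0 : measurable_fun [set: P2] (u0 : P2 -> P2)).
Hypotheses (wv : weak_vorticity u0 omega0) (locw : locally_integrable2 omega0).

Definition flow_from (U : ST -> R * R) : Prop :=
  {ae leb2, forall y, u0 y = (vel U 0 (0, y), vel U 1 (0, y))}.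

Lemma curl2_slice (U : ST -> R * R) t y : smooth U ->
  curl2 (fun k y => vel U k (t, y)) y = vort U (t, y).
Proof.
move=> smU.
exact: (congr2 (fun a b => a - b) (partial_slice t 0 y (smooth_vel smU 1)) (partial_slice t 1 y (smooth_vel smU 0))).
Qed.

Lemma energy_constant_ge0 (p w : R) : 0 <= powR 2 p * (powR w p + 4).
Proof. exact: mulr_ge0 (powR_ge0 _ _) (addr_ge0 (powR_ge0 _ _) (ler0n _ 4)). Qed.

Lemma vorticity_energy_bound u (U : ST -> R * R) P p w c r T (G lam : R) :
  euler_flow u U P -> flow_from U -> 1 <= p -> 0 <= w -> 0 <= r -> 0 <= T -> 0 < lam ->
  (Lpul_norm p omega0 <= w%:E)%E ->
  (forall t k x, 0 <= t <= T -> `|vel U k (t, x)| <= G * expR (lam * t)) ->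
  \int[leb2]_y (bracket (p / 2) (vort U (T, y)) * cutoff c r y) <=
  powR 2 p * (powR w p + 4) * (2 * (r + G / lam * expR (lam * T) + 1)) ^+ 2.
Proof.
move=> EF fU p1 w0 r0 T0 lam0 Hw HG.
have b0 s : 0 <= bracket (p / 2) s := ltW (bracket_gt0 _ _).
have [r' /andP[rr' r'D] H] := vorticity_energy_le c EF (smooth_bracket (p / 2)) b0 T0 lam0 r0 HG.
apply: (le_trans H).
have [smU uU div0 Ppr mom] := EF.
pose v k y := vel U k (0, y).
have sv k : smooth (v k) := smooth_slice 0 (smooth_vel smU k).
have r'0 : 0 <= r' := le_trans r0 rr'.
have E : \int[leb2]_y (bracket (p / 2) (vort U (0, y)) * cutoff c r' y) =
         \int[leb2]_y (bracket (p / 2) (curl2 v y) * cutoff c r' y).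
  apply: eq_Rintegral => y _.
  exact: (congr1 (fun z => bracket (p / 2) z * cutoff c r' y) (esym (curl2_slice 0 y smU))).
have IE := initial_energy_le mu0 wv sv fU locw c p1 w0 r'0 Hw.
rewrite E; apply: (le_trans IE).
apply: (ler_wpM2l (energy_constant_ge0 p w)).
move: rr' r'D r0; move: (G / lam * expR _) => D; clear => h1 h2 h3.
by apply: lerXn2r; rewrite ?nnegrE; lra.
Qed.

(** Here e / nu is the square root of the mollification radius, lam = nu^4, and [H] is the local
    integral of the fourth-power density, of order e^4 because the area is of order E^2. *)
Lemma combine_bounds (k0 U0 K C CH e nu H E low val : R) : 0 <= C -> 0 <= CH -> 0 < e -> 1 <= nu ->
  E = e ^+ 2 -> 0 <= K ->
  low <= k0 * U0 + K * E ^+ 2 / (nu ^+ 4 * (e / nu) ^+ 2) ->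
  H <= CH * e ^+ 4 ->
  val <= low + C * (e / nu) * (H / e ^+ 3 + e) ->
  val <= k0 * U0 + (K + C * (CH + 1)) * E / nu.
Proof.
move=> C0 CH0 e0 nu1 EE K0 hl hH hv.
have nu0 : 0 < nu by lra.
have [en nn] : e != 0 /\ nu != 0 by rewrite !gt_eqF.
have h1 : K * E ^+ 2 / (nu ^+ 4 * (e / nu) ^+ 2) = K * E / nu ^+ 2.
  by rewrite EE; field; rewrite en nn.
have h2 : K * E / nu ^+ 2 <= K * E / nu.
  have E0 : 0 <= E by rewrite EE sqr_ge0.
  rewrite ler_wpM2l ?mulr_ge0// lef_pV2 ?posrE ?exprn_gt0//.
  by rewrite expr2 ler_peMl// ltW.
have h3 : H / e ^+ 3 + e <= (CH + 1) * e.
  rewrite mulrDl mul1r lerD2r ler_pdivrMr ?exprn_gt0//.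
  by apply: (le_trans hH); rewrite le_eqVlt; apply/orP; left; apply/eqP; ring.
have h4 : C * (e / nu) * (H / e ^+ 3 + e) <= C * (e / nu) * ((CH + 1) * e).
  by apply: ler_wpM2l => //; rewrite mulr_ge0// divr_ge0// ltW.
have h5 : C * (e / nu) * ((CH + 1) * e) = C * (CH + 1) * E / nu.
  by rewrite EE; field.
apply: (le_trans hv); apply: (le_trans (lerD hl h4)).
rewrite h1 h5 (mulrDl K) mulrDl -addrA; apply: lerD => //.
by rewrite lerD2r.
Qed.

(* With E = G e^(lam t), lam = nu^4, the average is taken at the scale E / nu^2: the
   pressure then contributes O(E / nu^2), and the vorticity O(E / nu). *)
Lemma velocity_improvement (w U0 : R) : 0 <= w -> (Lpul_norm 4 omega0 <= w%:E)%E ->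
  exists2 lam : R, 0 < lam & forall u (U : ST -> R * R) P T (G : R),
    euler_flow u U P -> flow_from U -> 0 <= T -> 1 <= G ->
    (forall k x, `|vel U k (0, x)| <= U0) ->
    (forall t k x, 0 <= t <= T -> `|vel U k (t, x)| <= G * expR (lam * t)) ->
    forall t k x, 0 <= t <= T -> `|vel U k (t, x)| <= U0 + 2^-1 * (G * expR (lam * t)).
Proof.
move=> w0 Hw.
have [K K0 HK] := @mollified_velocity_le R.
have [C C0 HC] := @mean_sub_average_le R.
have k0 : 0 < @bump_mass R := bump_mass_gt0.
(* 18 = 2 * 9: with e >= 1 the radius of the initial box satisfies 6 (e/nu)^2 + 1 + E/lam + 1 <= 9
   e^2. *)
pose CH : R := powR 2 4 * (powR w 4 + 4) * 18 ^+ 2.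
have CH0 : 0 <= CH.
  exact: mulr_ge0 (energy_constant_ge0 4 w) (sqr_ge0 _).
pose A := K + C * (CH + 1).
have A0 : 0 <= A by rewrite addr_ge0// mulr_ge0// addr_ge0.
(* This makes A / nu at most half of the mass, so after division by the mass the errors cost at most
   E / 2. *)
pose nu := 1 + 2 * A / @bump_mass R.
have nu1 : 1 <= nu by rewrite lerDl divr_ge0 ?mulr_ge0// ltW.
have nu0 : 0 < nu by exact: lt_le_trans nu1.
have Anu : A / nu <= @bump_mass R / 2.
  rewrite ler_pdivrMr// /nu mulrDr mulr1.
  rewrite (_ : bump_mass / 2 * (2 * A / bump_mass) = A); first by rewrite lerDr divr_ge0// ltW.
  by field; rewrite gt_eqF.
pose lam := nu ^+ 4.
have lam0 : 0 < lam by rewrite exprn_gt0.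
have lam1 : 1 <= lam by rewrite exprn_ege1.
exists lam => // u U P T G EF fU T0 G1 HU0 HG t k x /andP[t0 tT].
have HGt s k' y : 0 <= s <= t -> `|vel U k' (s, y)| <= G * expR (lam * s).
  by move=> /andP[s0 st]; apply: HG; rewrite s0 (le_trans st tT).
have [smU uU div0 Ppr mom] := EF.
pose E := G * expR (lam * t).
have E1 : 1 <= E.
  by apply: mulr_ege1 => //; rewrite -expR0 ler_expR mulr_ge0// ltW.
pose e := Num.sqrt E.
have EE : E = e ^+ 2 by rewrite sqr_sqrtr// (le_trans _ E1).
have e1 : 1 <= e by rewrite -sqrtr1; apply: ler_wsqrtr.
have e0 : 0 < e by exact: lt_le_trans e1.
have s0 : 0 < e / nu by rewrite divr_gt0.
have r0 : 0 < (e / nu) ^+ 2 by rewrite exprn_gt0.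
have se : (e / nu) ^+ 2 <= e ^+ 2.
  by apply: lerXn2r; rewrite ?nnegrE ?(ltW s0) ?(ltW e0)// ler_pdivrMr// ler_peMr// ltW.
pose v i y := vel U i (t, y).
have sv i : smooth (v i) := smooth_slice t (smooth_vel smU i).
have dv y : partial 0 (v 0) y + partial 1 (v 1) y = 0.
  apply: etrans (vel_div0 smU uU div0 y t0).
  exact: (congr2 +%R (partial_slice t 0 y (smooth_vel smU 0)) (partial_slice t 1 y (smooth_vel smU 1))).
(* The 1 is the width of the layer in which the cutoff falls from 1 to 0. *)
pose rad := 6 * (e / nu) ^+ 2 + 1.
have rad0 : 0 <= rad by rewrite addr_ge0// mulr_ge0// sqr_ge0.
pose h y := bracket 2 (vort U (t, y)) * cutoff x rad y.
have ch : csupp x rad h.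
  apply: csuppMl (csupp_cutoff x rad0).
  exact: smooth_continuous (smooth_comp (smooth_bracket 2) (smooth_slice t (smooth_vort smU))).
have h0 y : 0 <= h y := mulr_ge0 (ltW (bracket_gt0 _ _)) (cutoff_ge0 _ _ _).
have curlE y : curl2 v y = vort U (t, y).
  exact: curl2_slice.
have Hh (a : R) y : 0 < a -> box x (6 * (e / nu) ^+ 2) y -> `|curl2 v y| <= a ^+ 3 * h y + a^-1.
  move=> a0 yb; rewrite curlE /h cutoff_eq1; first by rewrite mulr1; exact: norm_le_bracket2.
  by apply: (box_le _ yb); rewrite /rad addrK.
have mean := HC v h x (e / nu) k e x rad sv dv s0 e0 ch h0 Hh.
have low := HK u U P t x ((e / nu) ^+ 2) k G lam EF t0 r0 lam0 HGt.
have init := moll_average_le x r0 (smooth_continuous (smooth_slice 0 (smooth_vel smU k))) (HU0 k).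
have p14 : (1 : R) <= 4 by rewrite ler1n.
have energy := vorticity_energy_bound x EF fU p14 w0 rad0 t0 lam0 Hw HGt.
have p4 : (4 : R) / 2 = 2 by rewrite (natrM R 2 2) mulfK.
rewrite p4 in energy.
have HH : \int[leb2]_y h y <= CH * e ^+ 4.
  apply: (le_trans energy).
  rewrite /CH -[X in _ <= X]mulrA; apply: (ler_wpM2l (energy_constant_ge0 4 w)).
  have GE : G / lam * expR (lam * t) = E / lam by rewrite /E mulrAC.
  have El : E / lam <= e ^+ 2.
    by rewrite -EE ler_pdivrMr// ler_peMr// (le_trans _ E1).
  have e21 : 1 <= e ^+ 2 by rewrite -EE.
  have El0 : 0 <= E / lam by rewrite divr_ge0// ?(ltW lam0)// (le_trans _ E1).
  have -> : 18 ^+ 2 * e ^+ 4 = (18 * e ^+ 2) ^+ 2 by rewrite exprMn -exprM.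
  rewrite GE; apply: lerXn2r; rewrite ?nnegrE.
  - by rewrite mulr_ge0// addr_ge0// addr_ge0.
  - by rewrite mulr_ge0// sqr_ge0.
  rewrite /rad; move: se El e21 El0; move: ((e / nu) ^+ 2) (e ^+ 2) (E / lam) => a b d; lra.
have key : `|bump_mass * v k x| <= bump_mass * U0 + A * E / nu.
  apply: (combine_bounds C0 CH0 e0 nu1 EE K0 _ HH mean).
  apply: (le_trans low); apply: lerD => //.
have fin : A * E / nu <= bump_mass * (2^-1 * E).
  rewrite (mulrAC A E) (mulrA bump_mass).
  exact: (ler_wpM2r (le_trans ler01 E1) Anu).
have : bump_mass * `|v k x| <= bump_mass * (U0 + 2^-1 * E).
  rewrite mulrDr; apply: le_trans (lerD (lexx _) fin).
  by rewrite normrM (gtr0_norm k0) in key.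
by rewrite ler_pM2l.
Qed.

End Velocity_bound.

(** * Bounds depending on the data only *)

Section A_priori.
Context {R : realType}.
Local Notation mR := (measurableTypeR R).
Local Notation P2 := (measurableTypeR R * measurableTypeR R)%type.
Local Notation leb2 := (@lebesgue2 R).
Local Notation ST := (R * (R * R))%type.
Implicit Types (t r : R) (x y c : R * R) (k : 'I_2).

Variables (u0 : R * R -> R * R) (omega0 : R * R -> R).
Hypotheses (mu0 : measurable_fun [set: P2] (u0 : P2 -> P2)).
Hypotheses (wv : weak_vorticity u0 omega0) (locw : locally_integrable2 omega0).

(* The smallest [G] with [|u(t)| <= G e^(lam t)] on [0, T] improves to [U0 + G / 2]. *)
Lemma velocity_bound (w U0 : R) : 0 <= w -> (Lpul_norm 4 omega0 <= w%:E)%E -> 0 <= U0 ->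
  exists2 lam : R, 0 < lam & forall u (U : ST -> R * R) P T (M : R),
    euler_flow u U P -> flow_from u0 U -> 0 <= T ->
    (forall k x, `|vel U k (0, x)| <= U0) ->
    (forall t k x, 0 <= t <= T -> `|vel U k (t, x)| <= M) ->
    forall t k x, 0 <= t <= T -> `|vel U k (t, x)| <= (1 + 2 * U0) * expR (lam * t).
Proof.
move=> w0 Hw U00; have [lam lam0 IMP] := velocity_improvement mu0 wv locw U0 w0 Hw.
exists lam => // u U P T M EF fU T0 HU0 HM.
have e1 t : 0 <= t -> 1 <= expR (lam * t).
  by move=> t0; rewrite -expR0 ler_expR mulr_ge0// ltW.
pose S : set R := [set G | 1 <= G /\
  forall t k x, 0 <= t <= T -> `|vel U k (t, x)| <= G * expR (lam * t)].
have lS : lbound S 1 by move=> G [].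
have hS : has_lbound S by exists 1.
have S0 : S !=set0.
  exists (1 + `|M|); split; first by rewrite lerDl.
  move=> t k x /[dup] tT /andP[t0 _]; apply: (le_trans (HM t k x tT)).
  apply: (@le_trans _ _ (1 + `|M|)); first by rewrite (le_trans (ler_norm M))// lerDr.
  by rewrite ler_peMr ?addr_ge0// e1.
(* The infimum is attained, since the conditions on G are non-strict inequalities. *)
have S1 : S (inf S).
  split; first exact: lb_le_inf.
  move=> t k x tT; rewrite -ler_pdivrMr ?expR_gt0//.
  by apply: lb_le_inf => // G [_ HG]; rewrite ler_pdivrMr ?expR_gt0//; exact: HG.
(* The improvement, applied to the infimum, gives an admissible constant again; U0 is put under the
   exponential, which is at least 1. *)
have S2 : S (Num.max 1 (U0 + 2^-1 * inf S)).
  split; first by rewrite le_max lexx.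
  move=> t k x tT; have /andP[t0 _] := tT.
  have H := IMP u U P T (inf S) EF fU T0 S1.1 HU0 S1.2 t k x tT.
  apply: (le_trans H); apply: (@le_trans _ _ ((U0 + 2^-1 * inf S) * expR (lam * t))).
    by rewrite mulrDl mulrA lerD2r ler_peMr// e1.
  by apply: ler_wpM2r; [exact: expR_ge0|rewrite le_max lexx orbT].
(* The infimum g satisfies g <= max(1, U0 + g / 2); either case gives g <= 1 + 2 U0. *)
have gB : inf S <= 1 + 2 * U0.
  have := ge_inf hS S2; rewrite le_max; move: (inf S) => g.
  by case/orP => h; lra.
move=> t k x tT; apply: (le_trans (S1.2 t k x tT)).
by apply: ler_wpM2r => //; exact: expR_ge0.
Qed.

(** As p >= 1, a factor at least 1 is bounded by its p-th power: 5 M moves into the base, where 5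
    comes from w^p + 4 <= 5 (w + 1)^p and 10 = 2 * 5. The base is independent of p, and extracting
    the p-th root leaves a constant uniform in p. *)
Lemma powR_bound (p w M : R) : 1 <= p -> 0 <= w -> 1 <= M ->
  powR 2 p * (powR w p + 4) * M <= powR (10 * M * (w + 1)) p.
Proof.
move=> p1 w0 M1; have p0 : 0 <= p by exact: le_trans p1.
have w1 : 1 <= w + 1 by rewrite lerDr.
have h1 : powR w p <= powR (w + 1) p.
  by apply: ge0_ler_powR; rewrite ?nnegrE//; lra.
have h2 : 1 <= powR (w + 1) p.
  have one : powR 1 p = 1 by rewrite powR1.
  rewrite -[leLHS]one; apply: ge0_ler_powR; rewrite ?nnegrE//; lra.
have h3 : 5 * M <= powR (5 * M) p.
  rewrite -[leLHS]powRr1; last by lra.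
  by apply: ler_powR => //; lra.
have -> : 10 * M * (w + 1) = 2 * (5 * M) * (w + 1) by ring.
have E1 : powR (2 * (5 * M) * (w + 1)) p = powR (2 * (5 * M)) p * powR (w + 1) p.
  by apply: powRM; lra.
have E2 : powR (2 * (5 * M)) p = powR 2 p * powR (5 * M) p by apply: powRM; lra.
rewrite E1 E2.
have -> : powR 2 p * powR (5 * M) p * powR (w + 1) p = powR 2 p * (powR (5 * M) p * powR (w + 1) p).
  by rewrite mulrA.
rewrite -mulrA; apply: ler_wpM2l; first exact: powR_ge0.
apply: (@le_trans _ _ (5 * M * powR (w + 1) p)); last first.
  by apply: ler_wpM2r => //; exact: powR_ge0.
rewrite (mulrAC 5 M) ; apply: ler_wpM2r; first by lra.
lra.
Qed.

(** A cutoff of radius 2 equals 1 on the unit disk, so the local norm at time T is bounded by the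
    energy at that time. The dependence on w is affine with coefficients independent of p. *)
Lemma vorticity_Lpul_bound u (U : ST -> R * R) P p w T (G lam : R) :
  euler_flow u U P -> flow_from u0 U -> 1 <= p -> 0 <= w -> 0 <= T -> 0 < lam -> 0 <= G ->
  (Lpul_norm p omega0 <= w%:E)%E ->
  (forall t k x, 0 <= t <= T -> `|vel U k (t, x)| <= G * expR (lam * t)) ->
  (Lpul_norm p (vorticity (u T)) <=
    (10 * (2 * (3 + G / lam * expR (lam * T))) ^+ 2 * (w + 1))%:E)%E.
Proof.
move=> EF fU p1 w0 T0 lam0 G0 Hw HG; have [smU uU div0 Ppr mom] := EF.
have p0 : 0 < p by exact: lt_le_trans p1.
set D := G / lam * expR (lam * T).
have D0 : 0 <= D by rewrite mulr_ge0 ?expR_ge0// divr_ge0// ltW.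
set M := (2 * (3 + D)) ^+ 2.
have M1 : 1 <= M by apply: exprn_ege1; lra.
have w10 : 0 <= w + 1 by rewrite addr_ge0.
apply: Lpul_norm_le => //.
  by rewrite mulr_ge0// mulr_ge0// sqr_ge0.
move=> x.
have r2 : (0 : R) <= 2 by [].
have EB := vorticity_energy_bound mu0 wv locw x EF fU p1 w0 r2 T0 lam0 Hw HG.
rewrite -/D in EB.
have RM : 2 * (2 + D + 1) = 2 * (3 + D) by ring.
rewrite RM -/M in EB.
have sb : smooth (fun y => bracket (p / 2) (vort U (T, y))).
  exact: (smooth_comp (smooth_bracket (p / 2)) (smooth_slice T (smooth_vort smU))).
have cb : csupp x 2 (fun y => bracket (p / 2) (vort U (T, y)) * cutoff x 2 y).
  exact: csuppMl (smooth_continuous sb) (csupp_cutoff x r2).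
have Ib := csupp_integrable cb.
have EB2 : (\int[leb2]_y (bracket (p / 2) (vort U (T, y)) * cutoff x 2 y)%:E <=
   (powR (10 * M * (w + 1)) p)%:E)%E.
  rewrite (Rintegral_EFin Ib) lee_fin.
  exact: (le_trans EB (powR_bound p1 w0 M1)).
apply: le_trans EB2.
rewrite integral_mkcond.
have mD := measurable_unit_disk x.
have mw : measurable_fun [set: P2] (fun y => (powR `|vorticity (u T) y| p)%:E).
  have cw : continuous (fun y => vort U (T, y)) := smooth_continuous (smooth_slice T (smooth_vort smU)).
  have mv := continuous_measurable_plane cw.
  have mn := (@measurableT_comp _ _ _ _ _ _ (Num.norm : mR -> mR) _ _ (@normr_measurable _ _) mv).
  have -> : (fun y : P2 => (powR `|vorticity (u T) y| p)%:E) = (fun y : P2 => (powR `|vort U (T, y)| p)%:E).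
    by apply/funext => y; rewrite (vorticityE smU uU y T0).
  apply/measurable_EFinP; exact: (measurableT_comp (measurable_powR p) mn).
have mL : measurable_fun [set: P2] ((fun y : P2 => (powR `|vorticity (u T) y| p)%:E) \_ (unit_disk x)).
  by apply/(measurable_restrictT _ _).1; [exact: mD|exact: measurable_funTS mw].
have L0 y : (0 <= ((fun y : P2 => (powR `|vorticity (u T) y| p)%:E) \_ (unit_disk x)) y)%E.
  by rewrite patchE; case: ifP => // _; rewrite lee_fin powR_ge0.
have mR_ : measurable_fun [set: P2] (fun y => (bracket (p / 2) (vort U (T, y)) * cutoff x 2 y)%:E).
  by case/integrableP: Ib.
apply: (ge0_le_integral leb2 measurableT (fun y _ => L0 y) mL mR_) => y _.
have b0 := bracket_gt0 (p / 2) (vort U (T, y)).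
have R0 : 0 <= bracket (p / 2) (vort U (T, y)) * cutoff x 2 y.
  exact: mulr_ge0 (ltW b0) (cutoff_ge0 _ _ _).
rewrite patchE; case: ifPn => [|_]; last by rewrite lee_fin.
rewrite inE => /disk_box1 yb; rewrite lee_fin (vorticityE smU uU y T0).
rewrite cutoff_eq1; last first.
  by apply: (box_le _ yb); rewrite (_ : 2 - 1 = 1)//; ring.
rewrite mulr1; exact: (powR_norm_le_bracket _ (ltW p0)).
Qed.

End A_priori.

Lemma smooth_solution_flow (R : realType) (u0 : R * R -> R * R) u : smooth_euler_solution u0 u ->
  exists U, exists P, euler_flow u U P /\ flow_from u0 U.
Proof.
move=> [[U smU uU] _ div0 [P [Ppr mom]] E0].
exists U, P; split; first by split.
apply: (negligibleS _ E0) => y; apply: contra_not => /= <-.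
by rewrite uU// /vel coord2_0 coord2_1; case: (U _).
Qed.

Lemma Yul_norm_le (R : realType) (Theta : R -> R) (f : R * R -> R) (Y : R) :
  (forall p, 1 <= p -> 1 <= Theta p) ->
  (forall p, 1 <= p -> (Lpul_norm p f <= (Y * Theta p)%:E)%E) -> (Yul_norm Theta f <= Y%:E)%E.
Proof.
move=> T1 H; apply: ge_ereal_sup => _ [p + <-]; rewrite /= in_itv /= andbT => p1.
have T0 : 0 < Theta p := lt_le_trans ltr01 (T1 p p1).
have Ti : (0 <= ((Theta p)^-1)%:E)%E by rewrite lee_fin invr_ge0 ltW.
apply: (le_trans (lee_wpmul2r Ti (H p p1))).
by rewrite -EFinM mulfK// gt_eqF.
Qed.

Lemma Lpul_norm_le_Yul (R : realType) (Theta : R -> R) (f : R * R -> R) :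
  (forall p, 1 <= p -> 1 <= Theta p) -> (Yul_norm Theta f < +oo)%E ->
  exists2 Y : R, 0 <= Y & forall p, 1 <= p -> (Lpul_norm p f <= (Y * Theta p)%:E)%E.
Proof.
move=> T1 Yfin.
have up p : 1 <= p -> (Lpul_norm p f * ((Theta p)^-1)%:E <= Yul_norm Theta f)%E.
  by move=> p1; apply: ereal_sup_ubound; exists p => //=; rewrite in_itv /= p1.
have L0 p : (0 <= Lpul_norm p f)%E.
  by apply: le_trans (poweR_ge0 _ _) (ereal_sup_ubound _); exists 0.
have Y0 : (0 <= Yul_norm Theta f)%E.
  apply: le_trans (up 1 (lexx _)); apply: mule_ge0 => //.
  by rewrite lee_fin invr_ge0 (le_trans ler01)// T1.
exists (fine (Yul_norm Theta f)); first exact: fine_ge0.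
move=> p p1; have T0 : 0 < Theta p := lt_le_trans ltr01 (T1 p p1).
rewrite EFinM fineK; last by rewrite ge0_fin_numE.
have Tp : (0 <= (Theta p)%:E)%E by rewrite lee_fin ltW.
have := lee_wpmul2r Tp (up p p1).
by rewrite -muleA -EFinM mulVf ?gt_eqF// mule1.
Qed.

Theorem proposition3p3 (R : realType) (Theta : R -> R)
    (Theta_A1 : class_A1 Theta)
    (Theta_ge1 : forall p, 1 <= p -> 1 <= Theta p)
    (u0 : R * R -> R * R) (omega0 : R * R -> R)
    (u0_Linf : in_Linf u0) (u0_div : weak_div_free u0)
    (omega0_vort : weak_vorticity u0 omega0)
    (omega0_Y : in_Yul Theta omega0) :
  exists C : R -> R,
    [/\ smooth C,
        forall t, 0 <= t -> 0 < C t &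
        forall u : R -> R * R -> R * R, smooth_euler_solution u0 u ->
          forall t, 0 <= t ->
            (Linf_norm (u t) + Yul_norm Theta (vorticity (u t)) <= (C t)%:E)%E].
Proof.
have [mu0 fu0] := u0_Linf.
have [inL Yfin] := omega0_Y.
have [Y Y0 HY] := Lpul_norm_le_Yul Theta_ge1 Yfin.
have [locw _] := inL 1 (lexx _).
pose U0 := fine (Linf_norm u0).
have L0 : (0 <= Linf_norm u0)%E by exact: Lnorm_ge0.
have U00 : 0 <= U0 by exact: fine_ge0.
have LU0 : (Linf_norm u0 <= U0%:E)%E by rewrite fineK ?ge0_fin_numE.
have p14 : (1 : R) <= 4 by rewrite ler1n.
have T40 : 0 <= Theta 4 by exact: le_trans ler01 (Theta_ge1 4 p14).
have w40 : 0 <= Y * Theta 4 by exact: mulr_ge0.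
have [lam lam0 HV] := velocity_bound mu0 omega0_vort locw w40 (HY 4 p14) U00.
pose G := 1 + 2 * U0.
have G0 : 0 < G by rewrite /G; lra.
pose D t := G / lam * expR (lam * t).
pose K t := 2 * (3 + D t).
(* The first 2 passes from coordinates to the Euclidean norm; the second term is the bound on the
   vorticity with Y + 1 in place of Y Theta(p) + 1 over Theta(p). *)
pose C t := 2 * (G * expR (lam * t)) + 10 * (K t * K t) * (Y + 1).
exists C; split.
- have sE : smooth (fun t : R => 2 * (G * expR (lam * t))) := smoothZ 2 (smooth_expR_scale lam G).
  have sK : smooth K.
    exact: (smoothZ 2 (smoothD (@smooth_cst R R R 3) (smooth_expR_scale lam (G / lam)))).
  exact: (smoothD sE (smoothM (smoothZ 10 (smoothM sK sK)) (@smooth_cst R R R (Y + 1)))).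
- move=> t t0; apply: ltr_pwDl.
    by rewrite mulr_gt0// mulr_gt0// expR_gt0.
  rewrite mulr_ge0 ?addr_ge0// mulr_ge0// -expr2; exact: sqr_ge0.
move=> u usol t t0.
have [U [P [EF fU]]] := smooth_solution_flow usol.
have [smU uU _ _ _] := EF; have [_ lb _ _ E0] := usol.
have cu s : 0 <= s -> continuous (u s).
  move=> s0; have -> : u s = (fun x => U (s, x)) by apply/funext => x; rewrite uU.
  move=> x; apply: (@continuous_comp _ _ _ (fun x : R * R => (s, x)) U).
    exact: continuous_pairr.
  exact: (smooth_continuous smU).
have velu s k x : 0 <= s -> vel U k (s, x) = coord2 k (u s x) by move=> s0; rewrite uU.
have HU0 k x : `|vel U k (0, x)| <= U0.
  rewrite velu//; apply: (le_trans (coord2_le_enorm k (u 0 x))).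
  apply: (@ae_le_continuous _ (fun x => enorm (u 0 x))).
    by move=> y; apply: (@continuous_comp _ _ _ (u 0) (@enorm R)); [exact: cu|exact: continuous_enorm].
  apply: (negligibleS _ (negligibleU E0 (Linf_norm_ae LU0))) => y ny.
  apply: contrapT => /not_orP[/contrapT Ey /contrapT ly]; apply: ny.
  by rewrite /= Ey.
(* This bound depends on the solution; it feeds [velocity_bound], whose conclusion is free of it. *)
have [M HM] := lb t.
have HVt := HV u U P t M EF fU t0 HU0.
have {HVt} HVt : forall s k x, 0 <= s <= t -> `|vel U k (s, x)| <= G * expR (lam * s).
  apply: HVt => s k x /andP[s0 st]; rewrite velu//.
  by apply: Linf_norm_coord2; [exact: cu|exact: HM].
rewrite /C EFinD; apply: leeD.
  apply: Linf_norm_le => x; apply: enorm_le_coord2 => k.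
  by rewrite -velu//; apply: HVt; rewrite t0 lexx.
apply: Yul_norm_le => // p p1.
have Tp1 := Theta_ge1 p p1.
have wp0 : 0 <= Y * Theta p by rewrite mulr_ge0// (le_trans ler01).
apply: (le_trans (vorticity_Lpul_bound mu0 omega0_vort locw EF fU p1 wp0 t0 lam0 (ltW G0) (HY p p1) HVt)).
rewrite lee_fin -/(D t) -/(K t) expr2 -[leRHS]mulrA.
apply: ler_wpM2l.
  by rewrite mulr_ge0// -expr2 sqr_ge0.
(* Y Theta(p) + 1 <= (Y + 1) Theta(p), because Theta(p) >= 1. *)
by rewrite mulrDl mul1r lerD2l.
Qed.
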